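(* Let $p>3$ be prime and $0\le m\le p-1$. Then (i) $\mathcal{K}^{(C)}_{p,0}(\zeta_p,z)$ is a weakly holomorphic modular form of weight $1$ on $\Gamma_1(p)$; (ii) if $1\le m\le p-1$, then $\mathcal{K}^{(C)}_{p,m}(\zeta_p,z)$ is a weakly holomorphic modular form of weight $1$ on $\Gamma(p)$, and in particular $$\big(\mathcal{K}^{(C)}_{p,m}(\zeta_p,z)\big)\big|[A]_1=\exp\!\Big(\frac{2\pi i bm}{p}\Big)\,\mathcal{K}^{(C)}_{p,m}(\zeta_p,z)\quad\text{for all } A=\begin{pmatrix} a&b\\ c&d\end{pmatrix}\in\Gamma_1(p).$$
   Context: $z$ in the upper half-plane, $q=e^{2\pi i z}$, $q^r=e^{2\pi i r z}$, $\zeta_p=e^{2\pi i/p}$, $(a;q)_\infty=\prod_{k\ge0}(1-aq^k)$; $(F|[A]_k)(z)=(cz+d)^{-k}F\big(\tfrac{az+b}{cz+d}\big)$. Crank generating function: $C(x,q)=\frac{(q;q)_\infty}{(xq;q)_\infty(x^{-1}q;q)_\infty}$; write $C(\zeta_p,q)=\sum_{n\ge0}c(n)q^n$ with $c(n)=0$ for $n<0$ (equivalently $c(n)=\sum_{k=0}^{p-1}M(k,p,n)\zeta_p^{k}$ where $M(k,p,n)$ counts partitions of $n$ with crank $\equiv k \pmod p$, with the generating-function convention at $n=1$). Let $s_p=\frac{p^2-1}{24}$ and $\mathcal{K}^{(C)}_{p,m}(\zeta_p,z)=q^{m/p}\prod_{n\ge1}(1-q^{pn})\sum_{n\in\mathbb{Z}}c(pn+m-s_p)\,q^n$.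 *)

(* Defs.v *)
From Stdlib Require Import Reals ZArith Znumtheory.
From Coquelicot Require Import Coquelicot.
Open Scope R_scope.

Definition cexp (z : C) : C :=
  (exp (Re z) * cos (Im z), exp (Re z) * sin (Im z)).

Definition Ci : C := (0, 1).

Definition e2pi (w : C) : C := cexp (Cmult (Cmult (RtoC (2 * PI)) Ci) w).

Definition zeta (p : Z) : C := e2pi (RtoC (1 / IZR p)).

(* limit of a complex sequence (meaningful when it converges) *)
Definition limC (u : nat -> C) : C :=
  (real (Lim_seq (fun n => Re (u n))), real (Lim_seq (fun n => Im (u n)))).

Definition converges_to (u : nat -> C) (l : C) : Prop :=
  filterlim u eventually (locally l).

Definition conv (f g : nat -> C) (n : nat) : C :=
  sum_n (fun i => Cmult (f i) (g (n - i)%nat)) n.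

(* coefficients of 1 - q^k (k >= 1) *)
Definition one_minus_qk (k : nat) (n : nat) : C :=
  if Nat.eqb n 0 then RtoC 1 else if Nat.eqb n k then RtoC (-1) else RtoC 0.

(* coefficients of 1/(1 - x q^k) = sum_j x^j q^(k j)  (k >= 1) *)
Definition geom_qk (x : C) (k : nat) (n : nat) : C :=
  if Nat.eqb (n mod k) 0 then pow_n x (n / k) else RtoC 0.

Definition crank_factor (x : C) (k : nat) : nat -> C :=
  conv (one_minus_qk k) (conv (geom_qk x k) (geom_qk (Cinv x) k)).

Fixpoint crank_partial (x : C) (N : nat) : nat -> C :=
  match N with
  | O => fun n => if Nat.eqb n 0 then RtoC 1 else RtoC 0
  | S N' => conv (crank_partial x N') (crank_factor x N)
  end.

(* c(n) : coefficient of q^n in C(x,q) = (q;q)_oo / ((xq;q)_oo (x^{-1}q;q)_oo).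
   Factors with k > n are 1 + O(q^k), so the q^n coefficient is
   already determined by the first n factors. c(n) = 0 for n < 0. *)
Definition crank_coef (x : C) (n : Z) : C :=
  if Z.ltb n 0 then RtoC 0
  else crank_partial x (Z.to_nat n) (Z.to_nat n).

(* s_p = (p^2 - 1)/24 (an integer for primes p > 3) *)
Definition s_p (p : Z) : Z := ((p * p - 1) / 24)%Z.

Definition qpow (r : R) (z : C) : C := e2pi (Cmult (RtoC r) z).

Fixpoint eta_partial (p : Z) (z : C) (N : nat) : C :=
  match N with
  | O => RtoC 1
  | S N' => Cmult (eta_partial p z N')
                  (Cminus (RtoC 1) (qpow (IZR p * INR N) z))
  end.

Definition Ksum_partial (p m : Z) (z : C) (N : nat) : C :=
  sum_n (fun k =>
    let n := (Z.of_nat k - Z.of_nat N)%Z in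
    Cmult (crank_coef (zeta p) (p * n + m - s_p p)%Z) (qpow (IZR n) z))
    (2 * N)%nat.

Definition Kcrank (p m : Z) (z : C) : C :=
  Cmult (qpow (IZR m / IZR p) z)
        (Cmult (limC (eta_partial p z)) (limC (Ksum_partial p m z))).

Definition upper_half (z : C) : Prop := 0 < Im z.

Record mat2 := Mat2 { ma : Z; mb : Z; mc : Z; md : Z }.

Definition in_SL2Z (A : mat2) : Prop := (ma A * md A - mb A * mc A = 1)%Z.

Definition in_Gamma1 (N : Z) (A : mat2) : Prop :=
  in_SL2Z A /\ (ma A mod N = 1 mod N)%Z /\ (md A mod N = 1 mod N)%Z
  /\ (mc A mod N = 0)%Z.

Definition in_Gamma (N : Z) (A : mat2) : Prop :=
  in_SL2Z A /\ (ma A mod N = 1 mod N)%Z /\ (md A mod N = 1 mod N)%Z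
  /\ (mb A mod N = 0)%Z /\ (mc A mod N = 0)%Z.

Fixpoint Cpow (w : C) (k : nat) : C :=
  match k with O => RtoC 1 | S k' => Cmult w (Cpow w k') end.

Definition slash (k : nat) (F : C -> C) (A : mat2) (z : C) : C :=
  let j := Cplus (Cmult (RtoC (IZR (mc A))) z) (RtoC (IZR (md A))) in
  Cmult (Cinv (Cpow j k))
        (F (Cdiv (Cplus (Cmult (RtoC (IZR (ma A))) z) (RtoC (IZR (mb A)))) j)).

Definition holomorphic_on_H (F : C -> C) : Prop :=
  forall z, upper_half z -> @ex_derive C_AbsRing C_NormedModule F z.

Definition meromorphic_at_cusps (k : nat) (F : C -> C) : Prop :=
  forall g, in_SL2Z g ->
    exists (M : positive) (N0 : Z) (a : Z -> C),
      (forall n, (n < N0)%Z -> a n = RtoC 0) /\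
      forall z, upper_half z ->
        converges_to
          (fun L => sum_n (fun j =>
              let n := (Z.of_nat j - Z.of_nat L)%Z in
              Cmult (a n) (qpow (IZR n / IZR (Zpos M)) z)) (2 * L)%nat)
          (slash k F g z).

Definition weakly_holomorphic_modular_form
  (k : nat) (Gam : mat2 -> Prop) (F : C -> C) : Prop :=
  holomorphic_on_H F /\
  (forall A, Gam A -> forall z, upper_half z -> slash k F A z = F z) /\
  meromorphic_at_cusps k F.

(* Main.v *)
(** Write [q = e(z)], [y = q^(1/p)], [h = (p-1)/2] and let [G(z)] be
    [y^(s_p) prod (1 - q^(p n)) prod (1 - y^n) / ((1 - zeta y^n) (1 - y^n / zeta))].
    Splitting the crank series by residues modulo [p] shows that [Kcrank p m] is the component
    [(1/p) sum_j e(-j m / p) G(z + j)] of [G] on which [z -> z + 1] acts by [e(m/p)].  Since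
    [Gamma1(p)] is generated by [Gamma(p)] and this translation, it is enough that [G] has
    weight 1 on [Gamma(p)] and expansions at all cusps.

    Both follow from the factorisation of [G], up to a constant, into Klein forms:
    [prod_{s=1..h} k_(0,2s/p) k_(2s/p,0) / prod_{r=-h..h} k_(2r/p,(p+1)/p)].
    Klein forms satisfy [k_a(g z) = (c z + d)^(-1) k_(a g)(z)] without any multiplier, and shifting
    [a] by the even vector [2 b] multiplies [k_a] by [e(b2 a1 - b1 a2)]; for [g] in [Gamma(p)] these
    factors cancel because [1^2 + ... + h^2 = p s_p].

    The law for [z -> -1/z] is Eisenstein's: the theta function is the product of
    [1 - z/(m tau + n)] taken row by row (through the product formula of the sine), exchanging rows
    and columns changes it by [exp(kappa z^2)] only, and [kappa] is read off from the
    quasi-periods. *)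

Require Import Defs.
From Stdlib Require Import Reals ZArith Znumtheory Lra Lia FunctionalExtensionality.
From Coquelicot Require Import Coquelicot.
Open Scope R_scope.
Open Scope C_scope.

(** * Complex limits, finite sums and products *)

(** Two obstacles shape the proof. The sum of [w^(-2)] over a lattice converges only conditionally,
    so the product of [1 - z^2/w^2] depends on the order of its factors. The factors
    [(1 - z^2/w^2) exp(z^2/w^2)] converge absolutely and do not see the order; what the row order
    leaves behind is one factor [exp(- z^2 G)] whose [G] is never evaluated. Two such constants make
    up [kappa], and the quasi-periods determine it because [theta] is nonzero at the points close to
    0. The other obstacle is the behaviour at all cusps, where reciprocals of Klein forms occur. A
    matrix of SL2(Z) only moves the index vectors inside [(1/p) Z^2], so every slash of the quotient
    is a quotient of the same shape. One class of functions, [q^(-N/M)] times a power series in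
    [q^(1/M)], therefore serves all cusps and also gives holomorphy. Reciprocals stay in this class
    because each one has an explicit infinite product of its own. The denominator [M = 2 p^2] comes
    from the leading exponent [(a^2 - a)/2] of a Klein form with [a] in [(1/p) Z]. *)

Lemma Cmod_minus_sym (x y : C) : Cmod (x - y) = Cmod (y - x).
Proof. rewrite <- Cmod_opp. f_equal. ring. Qed.

Lemma Cmod_sub_triangle (x y z : C) : (Cmod (x - z) <= Cmod (x - y) + Cmod (y - z))%R.
Proof. replace (x - z) with ((x - y) + (y - z)) by ring. apply Cmod_triangle. Qed.

Lemma Cmod_le_sub (x y : C) : (Cmod x <= Cmod y + Cmod (x - y))%R.
Proof. replace x with (y + (x - y)) at 1 by ring. apply Cmod_triangle. Qed.

Lemma Cmod_neq0 (x : C) : (0 < Cmod x)%R -> x <> 0.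
Proof. apply Cmod_gt_0. Qed.

Lemma Cmod_pos (x : C) : x <> 0 -> (0 < Cmod x)%R.
Proof. apply Cmod_gt_0. Qed.

Lemma im_le_Cmod (c : C) : (Rabs (Im c) <= Cmod c)%R.
Proof. eapply Rle_trans; [|apply Rmax_Cmod]. apply Rmax_r. Qed.

Lemma Cmod_le_abs (c : C) : (Cmod c <= Rabs (Re c) + Rabs (Im c))%R.
Proof.
  destruct c as [a b]; simpl.
  replace (a, b) with (RtoC a + Ci * RtoC b).
  - eapply Rle_trans; [apply Cmod_triangle|].
    rewrite Cmod_mult, !Cmod_R, Cmod_Ci. lra.
  - unfold Ci, RtoC, Cplus, Cmult; simpl. f_equal; ring.
Qed.

Lemma Cmult_neq0_r (x y : C) : x * y <> 0 -> y <> 0.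
Proof. intros H E. apply H. rewrite E. ring. Qed.

(** Phrased with [Cmod] so that limits and norm estimates combine directly; [limC_eq] and
    [Clim_converges_to] carry it over to the two notions of limit in the statement. *)
Definition Clim (u : nat -> C) (l : C) : Prop :=
  forall eps : R, (0 < eps)%R ->
    exists N : nat, forall n : nat, (N <= n)%nat -> (Cmod (u n - l) < eps)%R.

Lemma Clim_const (c : C) : Clim (fun _ => c) c.
Proof.
  intros eps He. exists O. intros n _. replace (c - c) with (RtoC 0) by ring.
  now rewrite Cmod_0.
Qed.

Lemma Clim_ext_ev (u v : nat -> C) (l : C) (N : nat) :
  (forall n, (N <= n)%nat -> u n = v n) -> Clim u l -> Clim v l.
Proof.
  intros E H eps He. destruct (H eps He) as [N' HN]. exists (max N N').
  intros n Hn. rewrite <- E by lia. apply HN. lia.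
Qed.

Lemma Clim_ext (u v : nat -> C) (l : C) :
  (forall n, u n = v n) -> Clim u l -> Clim v l.
Proof. intros E. apply (Clim_ext_ev u v l O). auto. Qed.

Lemma Clim_unique (u : nat -> C) (l l' : C) : Clim u l -> Clim u l' -> l = l'.
Proof.
  intros H H'. destruct (Ceq_dec l l') as [|D]; [assumption|exfalso].
  assert (P : (0 < Cmod (l - l'))%R) by (apply Cmod_pos, Cminus_eq_contra, D).
  destruct (H (Cmod (l - l') / 2)%R) as [N HN]; [lra|].
  destruct (H' (Cmod (l - l') / 2)%R) as [N' HN']; [lra|].
  specialize (HN (max N N') ltac:(lia)). specialize (HN' (max N N') ltac:(lia)).
  pose proof (Cmod_sub_triangle l (u (max N N')) l').
  rewrite (Cmod_minus_sym l (u (max N N'))) in H0. lra.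
Qed.

Lemma Clim_plus (u v : nat -> C) (l m : C) :
  Clim u l -> Clim v m -> Clim (fun n => u n + v n) (l + m).
Proof.
  intros H H' eps He. destruct (H (eps / 2)%R) as [N HN]; [lra|].
  destruct (H' (eps / 2)%R) as [N' HN']; [lra|].
  exists (max N N'). intros n Hn. specialize (HN n ltac:(lia)).
  specialize (HN' n ltac:(lia)).
  replace (u n + v n - (l + m)) with ((u n - l) + (v n - m)) by ring.
  pose proof (Cmod_triangle (u n - l) (v n - m)). lra.
Qed.

Lemma Clim_le_real (u : nat -> C) (l : C) (r : nat -> R) :
  is_lim_seq r 0%R -> (forall n, (Cmod (u n - l) <= r n)%R) -> Clim u l.
Proof.
  intros Hr Hb eps He. apply is_lim_seq_spec in Hr.
  destruct (Hr (mkposreal eps He)) as [N HN]. exists N. intros n Hn.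
  specialize (HN n Hn). simpl in HN. rewrite Rminus_0_r in HN.
  apply Rle_lt_trans with (2 := HN). eapply Rle_trans; [apply Hb|apply Rle_abs].
Qed.

Lemma Clim_bounded (u : nat -> C) (l : C) :
  Clim u l -> exists N : nat, forall n : nat, (N <= n)%nat -> (Cmod (u n) <= Cmod l + 1)%R.
Proof.
  intros H. destruct (H 1%R) as [N HN]; [lra|]. exists N. intros n Hn.
  specialize (HN n Hn). pose proof (Cmod_le_sub (u n) l). lra.
Qed.

Lemma Clim_mult (u v : nat -> C) (l m : C) :
  Clim u l -> Clim v m -> Clim (fun n => u n * v n) (l * m).
Proof.
  intros H H' eps He. destruct (Clim_bounded u l H) as [N0 HN0].
  pose proof (Cmod_ge_0 l) as Pl. pose proof (Cmod_ge_0 m) as Pm.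
  destruct (H (eps / (2 * (Cmod m + 1)))%R) as [N HN].
  { apply Rdiv_lt_0_compat; lra. }
  destruct (H' (eps / (2 * (Cmod l + 1)))%R) as [N' HN'].
  { apply Rdiv_lt_0_compat; lra. }
  exists (max N0 (max N N')). intros n Hn.
  specialize (HN0 n ltac:(lia)). specialize (HN n ltac:(lia)).
  specialize (HN' n ltac:(lia)).
  replace (u n * v n - l * m) with (u n * (v n - m) + (u n - l) * m) by ring.
  eapply Rle_lt_trans; [apply Cmod_triangle|]. rewrite !Cmod_mult.
  apply Rle_lt_trans with ((Cmod l + 1) * Cmod (v n - m) + Cmod (u n - l) * (Cmod m + 1))%R.
  - apply Rplus_le_compat.
    + apply Rmult_le_compat_r; [apply Cmod_ge_0|lra].
    + apply Rmult_le_compat_l; [apply Cmod_ge_0|lra].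
  - apply (Rmult_lt_compat_l (Cmod l + 1)) in HN'; [|lra].
    apply (Rmult_lt_compat_r (Cmod m + 1)) in HN; [|lra].
    replace ((Cmod l + 1) * (eps / (2 * (Cmod l + 1))))%R with (eps / 2)%R in HN' by (field; lra).
    replace (eps / (2 * (Cmod m + 1)) * (Cmod m + 1))%R with (eps / 2)%R in HN by (field; lra).
    lra.
Qed.

Lemma Clim_scal (c : C) (u : nat -> C) (l : C) :
  Clim u l -> Clim (fun n => c * u n) (c * l).
Proof. intros H. apply Clim_mult; [apply Clim_const|exact H]. Qed.

Lemma Clim_opp (u : nat -> C) (l : C) : Clim u l -> Clim (fun n => - u n) (- l).
Proof.
  intros H. apply (Clim_ext (fun n => (-1) * u n)); [intros; ring|].
  replace (- l) with ((-1) * l) by ring. now apply Clim_scal.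
Qed.

Lemma Clim_minus (u v : nat -> C) (l m : C) :
  Clim u l -> Clim v m -> Clim (fun n => u n - v n) (l - m).
Proof. intros H H'. apply Clim_plus; [exact H|now apply Clim_opp]. Qed.

Lemma Clim_inv (u : nat -> C) (l : C) :
  l <> 0 -> Clim u l -> Clim (fun n => / u n) (/ l).
Proof.
  intros Hl H eps He. pose proof (Cmod_pos l Hl) as Pl.
  destruct (H (Cmod l / 2)%R) as [N HN]; [lra|].
  destruct (H (eps * (Cmod l * Cmod l) / 2)%R) as [N' HN'].
  { apply Rdiv_lt_0_compat; [|lra]. apply Rmult_lt_0_compat; [lra|]. nra. }
  exists (max N N'). intros n Hn. specialize (HN n ltac:(lia)).
  specialize (HN' n ltac:(lia)).
  assert (Q : (Cmod l / 2 < Cmod (u n))%R).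
  { pose proof (Cmod_le_sub l (u n)). rewrite (Cmod_minus_sym l) in H0. lra. }
  assert (Un : u n <> 0) by (apply Cmod_neq0; lra).
  replace (/ u n - / l) with ((l - u n) / (u n * l)) by (field; auto).
  rewrite Cmod_div by (apply Cmult_neq_0; auto).
  rewrite Cmod_mult, (Cmod_minus_sym l).
  apply Rmult_lt_reg_r with (Cmod (u n) * Cmod l)%R; [nra|].
  unfold Rdiv. rewrite Rmult_assoc, Rinv_l by nra.
  rewrite Rmult_1_r. apply Rlt_le_trans with (1 := HN').
  assert (Cmod l * Cmod l / 2 <= Cmod (u n) * Cmod l)%R by nra.
  apply (Rmult_le_compat_l eps) in H0; lra.
Qed.

Lemma Clim_div (u v : nat -> C) (l m : C) :
  m <> 0 -> Clim u l -> Clim v m -> Clim (fun n => u n / v n) (l / m).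
Proof. intros Hm H H'. apply Clim_mult; [exact H|now apply Clim_inv]. Qed.

Lemma Clim_subseq (u : nat -> C) (l : C) (f : nat -> nat) :
  (forall n, (n <= f n)%nat) -> Clim u l -> Clim (fun n => u (f n)) l.
Proof.
  intros Hf H eps He. destruct (H eps He) as [N HN]. exists N. intros n Hn.
  apply HN. specialize (Hf n). lia.
Qed.

Lemma Clim_Cmod_le (u : nat -> C) (l : C) (B : R) (N : nat) :
  Clim u l -> (forall n, (N <= n)%nat -> (Cmod (u n) <= B)%R) -> (Cmod l <= B)%R.
Proof.
  intros H Hb. apply Rnot_lt_le. intros C.
  destruct (H (Cmod l - B)%R) as [N' HN]; [lra|].
  specialize (HN (max N N') ltac:(lia)). specialize (Hb (max N N') ltac:(lia)).
  pose proof (Cmod_le_sub l (u (max N N'))).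
  rewrite (Cmod_minus_sym l) in H0. lra.
Qed.

Lemma Clim_Re (u : nat -> C) (l : C) : Clim u l -> is_lim_seq (fun n => Re (u n)) (Re l).
Proof.
  intros H. apply is_lim_seq_spec. intros eps. destruct (H eps (cond_pos eps)) as [N HN].
  exists N. intros n Hn. eapply Rle_lt_trans; [|apply (HN n Hn)].
  replace (Re (u n) - Re l)%R with (Re (u n - l)); [apply re_le_Cmod|].
  reflexivity.
Qed.

Lemma Clim_Im (u : nat -> C) (l : C) : Clim u l -> is_lim_seq (fun n => Im (u n)) (Im l).
Proof.
  intros H. apply is_lim_seq_spec. intros eps. destruct (H eps (cond_pos eps)) as [N HN].
  exists N. intros n Hn. eapply Rle_lt_trans; [|apply (HN n Hn)].
  replace (Im (u n) - Im l)%R with (Im (u n - l)); [apply im_le_Cmod|].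
  reflexivity.
Qed.

Lemma Clim_of_Re_Im (u : nat -> C) (a b : R) :
  is_lim_seq (fun n => Re (u n)) a -> is_lim_seq (fun n => Im (u n)) b -> Clim u (a, b).
Proof.
  intros Ha Hb eps He. apply is_lim_seq_spec in Ha. apply is_lim_seq_spec in Hb.
  assert (He2 : (0 < eps / 2)%R) by lra.
  destruct (Ha (mkposreal _ He2)) as [N HN]. destruct (Hb (mkposreal _ He2)) as [N' HN'].
  exists (max N N'). intros n Hn. specialize (HN n ltac:(lia)). specialize (HN' n ltac:(lia)).
  simpl in HN, HN'. eapply Rle_lt_trans; [apply Cmod_le_abs|].
  change (Re (u n - (a, b))) with (Re (u n) - a)%R.
  change (Im (u n - (a, b))) with (Im (u n) - b)%R. lra.
Qed.

Lemma limC_eq (u : nat -> C) (l : C) : Clim u l -> limC u = l.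
Proof.
  intros H. unfold limC. rewrite (is_lim_seq_unique _ _ (Clim_Re u l H)).
  rewrite (is_lim_seq_unique _ _ (Clim_Im u l H)). now destruct l.
Qed.

Lemma Clim_converges_to (u : nat -> C) (l : C) : Clim u l -> converges_to u l.
Proof.
  intros H. unfold converges_to. apply filterlim_locally. intros eps.
  destruct (H eps (cond_pos eps)) as [N HN]. exists N. intros n Hn.
  apply C_NormedModule_mixin_compat1. apply (HN n Hn).
Qed.

Lemma Clim_of_Cauchy (u : nat -> C) :
  (forall eps : R, (0 < eps)%R -> exists N : nat, forall m n : nat,
     (N <= m)%nat -> (N <= n)%nat -> (Cmod (u m - u n) < eps)%R) ->
  exists l : C, Clim u l.
Proof.
  intros H.
  assert (A : ex_finite_lim_seq (fun n => Re (u n))).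
  { apply ex_lim_seq_cauchy_corr. intros eps. destruct (H eps (cond_pos eps)) as [N HN].
    exists N. intros n m Hn Hm. eapply Rle_lt_trans; [|apply (HN n m Hn Hm)].
    apply (re_le_Cmod (u n - u m)). }
  assert (B : ex_finite_lim_seq (fun n => Im (u n))).
  { apply ex_lim_seq_cauchy_corr. intros eps. destruct (H eps (cond_pos eps)) as [N HN].
    exists N. intros n m Hn Hm. eapply Rle_lt_trans; [|apply (HN n m Hn Hm)].
    apply (im_le_Cmod (u n - u m)). }
  destruct A as [a Ha]. destruct B as [b Hb]. exists (a, b).
  now apply Clim_of_Re_Im.
Qed.

Lemma Clim_limC (u : nat -> C) (l : C) : Clim u l -> Clim u (limC u).
Proof. intros H. now rewrite (limC_eq u l H). Qed.

(** * Finite sums and products over the first [n] indices *)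

Fixpoint Csum (f : nat -> C) (n : nat) : C :=
  match n with O => 0 | S n' => Csum f n' + f n' end.

Fixpoint Cprod (f : nat -> C) (n : nat) : C :=
  match n with O => 1 | S n' => Cprod f n' * f n' end.

Fixpoint Rsum (f : nat -> R) (n : nat) : R :=
  match n with O => 0%R | S n' => (Rsum f n' + f n')%R end.

Lemma Csum_ext (f g : nat -> C) (n : nat) :
  (forall i, (i < n)%nat -> f i = g i) -> Csum f n = Csum g n.
Proof.
  induction n as [|n IH]; intros H; simpl; [reflexivity|].
  rewrite IH by (intros; apply H; lia). now rewrite H by lia.
Qed.

Lemma Cprod_ext (f g : nat -> C) (n : nat) :
  (forall i, (i < n)%nat -> f i = g i) -> Cprod f n = Cprod g n.
Proof.
  induction n as [|n IH]; intros H; simpl; [reflexivity|].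
  rewrite IH by (intros; apply H; lia). now rewrite H by lia.
Qed.

Lemma Rsum_ext (f g : nat -> R) (n : nat) :
  (forall i, (i < n)%nat -> f i = g i) -> Rsum f n = Rsum g n.
Proof.
  induction n as [|n IH]; intros H; simpl; [reflexivity|].
  rewrite IH by (intros; apply H; lia). now rewrite H by lia.
Qed.

Lemma Csum_plus (f g : nat -> C) (n : nat) :
  Csum (fun i => f i + g i) n = Csum f n + Csum g n.
Proof. induction n as [|n IH]; simpl; [ring|rewrite IH; ring]. Qed.

Lemma Csum_scal (c : C) (f : nat -> C) (n : nat) :
  Csum (fun i => c * f i) n = c * Csum f n.
Proof. induction n as [|n IH]; simpl; [ring|rewrite IH; ring]. Qed.

Lemma Csum_0 (f : nat -> C) (n : nat) :
  (forall i, (i < n)%nat -> f i = 0) -> Csum f n = 0.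
Proof.
  induction n as [|n IH]; intros H; simpl; [reflexivity|].
  rewrite IH by (intros; apply H; lia). rewrite H by lia. ring.
Qed.

Lemma Cprod_mult (f g : nat -> C) (n : nat) :
  Cprod (fun i => f i * g i) n = Cprod f n * Cprod g n.
Proof. induction n as [|n IH]; simpl; [ring|rewrite IH; ring]. Qed.

Lemma Cprod_neq0 (f : nat -> C) (n : nat) :
  (forall i, (i < n)%nat -> f i <> 0) -> Cprod f n <> 0.
Proof.
  induction n as [|n IH]; intros H; simpl; [apply C1_nz|].
  apply Cmult_neq_0; [apply IH; intros; apply H; lia|apply H; lia].
Qed.

Lemma Cprod_inv (f : nat -> C) (n : nat) :
  (forall i, (i < n)%nat -> f i <> 0) -> Cprod (fun i => / f i) n = / Cprod f n.
Proof.
  induction n as [|n IH]; intros H; simpl; [field; apply C1_nz|].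
  rewrite IH by (intros; apply H; lia). field.
  split; [apply H; lia|apply Cprod_neq0; intros; apply H; lia].
Qed.

Lemma Cprod_const (c : C) (n : nat) : Cprod (fun _ => c) n = c ^ n.
Proof. induction n as [|n IH]; simpl; [reflexivity|rewrite IH; ring]. Qed.

Lemma Cprod_shift (f : nat -> C) (n : nat) :
  Cprod f (S n) = f O * Cprod (fun i => f (S i)) n.
Proof.
  induction n as [|n IH]; [simpl; ring|].
  change (Cprod f (S (S n))) with (Cprod f (S n) * f (S n)).
  rewrite IH. simpl. ring.
Qed.

Lemma Csum_shift (f : nat -> C) (n : nat) :
  Csum f (S n) = f O + Csum (fun i => f (S i)) n.
Proof.
  induction n as [|n IH]; [simpl; ring|].
  change (Csum f (S (S n))) with (Csum f (S n) + f (S n)).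
  rewrite IH. simpl. ring.
Qed.

Lemma Csum_add (f : nat -> C) (m n : nat) :
  Csum f (m + n) = Csum f m + Csum (fun i => f (m + i)%nat) n.
Proof.
  induction n as [|n IH]; [rewrite Nat.add_0_r; simpl; ring|].
  rewrite Nat.add_succ_r. simpl. rewrite IH. ring.
Qed.

Lemma Cprod_add (f : nat -> C) (m n : nat) :
  Cprod f (m + n) = Cprod f m * Cprod (fun i => f (m + i)%nat) n.
Proof.
  induction n as [|n IH]; [rewrite Nat.add_0_r; simpl; ring|].
  rewrite Nat.add_succ_r. simpl. rewrite IH. ring.
Qed.

Lemma Cprod_swap (f : nat -> nat -> C) (m n : nat) :
  Cprod (fun i => Cprod (f i) n) m = Cprod (fun j => Cprod (fun i => f i j) m) n.
Proof.
  induction m as [|m IH]; simpl.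
  - induction n as [|n IHn]; simpl; [reflexivity|rewrite <- IHn; ring].
  - now rewrite IH, Cprod_mult.
Qed.

Lemma Csum_swap (f : nat -> nat -> C) (m n : nat) :
  Csum (fun i => Csum (f i) n) m = Csum (fun j => Csum (fun i => f i j) m) n.
Proof.
  induction m as [|m IH]; simpl.
  - symmetry. apply Csum_0. reflexivity.
  - now rewrite IH, Csum_plus.
Qed.

Lemma Cprod_rev (f : nat -> C) (n : nat) :
  Cprod f n = Cprod (fun i => f (n - 1 - i)%nat) n.
Proof.
  induction n as [|n IH]; [reflexivity|].
  rewrite (Cprod_shift (fun i => f (S n - 1 - i)%nat)). simpl Cprod at 1. rewrite IH.
  rewrite Cmult_comm. f_equal; [f_equal; lia|].
  apply Cprod_ext. intros i Hi. f_equal. lia.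
Qed.

Lemma Cmod_Csum (f : nat -> C) (n : nat) :
  (Cmod (Csum f n) <= Rsum (fun i => Cmod (f i)) n)%R.
Proof.
  induction n as [|n IH]; simpl; [rewrite Cmod_0; lra|].
  eapply Rle_trans; [apply Cmod_triangle|]. lra.
Qed.

Lemma Rsum_le (f g : nat -> R) (n : nat) :
  (forall i, (i < n)%nat -> (f i <= g i)%R) -> (Rsum f n <= Rsum g n)%R.
Proof.
  induction n as [|n IH]; intros H; simpl; [lra|].
  apply Rplus_le_compat; [apply IH; intros; apply H; lia|apply H; lia].
Qed.

Lemma Rsum_ge0 (f : nat -> R) (n : nat) :
  (forall i, (i < n)%nat -> (0 <= f i)%R) -> (0 <= Rsum f n)%R.
Proof.
  induction n as [|n IH]; intros H; simpl; [lra|].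
  apply Rplus_le_le_0_compat; [apply IH; intros; apply H; lia|apply H; lia].
Qed.

Lemma Rsum_scal (c : R) (f : nat -> R) (n : nat) :
  Rsum (fun i => (c * f i)%R) n = (c * Rsum f n)%R.
Proof. induction n as [|n IH]; simpl; [ring|rewrite IH; ring]. Qed.

Lemma Rsum_plus (f g : nat -> R) (n : nat) :
  Rsum (fun i => (f i + g i)%R) n = (Rsum f n + Rsum g n)%R.
Proof. induction n as [|n IH]; simpl; [ring|rewrite IH; ring]. Qed.

Lemma Rsum_add (f : nat -> R) (m n : nat) :
  Rsum f (m + n) = (Rsum f m + Rsum (fun i => f (m + i)%nat) n)%R.
Proof.
  induction n as [|n IH]; [rewrite Nat.add_0_r; simpl; ring|].
  rewrite Nat.add_succ_r. simpl. rewrite IH. ring.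
Qed.

Lemma Rsum_shift (f : nat -> R) (n : nat) :
  Rsum f (S n) = (f O + Rsum (fun i => f (S i)) n)%R.
Proof.
  induction n as [|n IH]; [simpl; ring|].
  change (Rsum f (S (S n))) with (Rsum f (S n) + f (S n))%R.
  rewrite IH. simpl. ring.
Qed.

Lemma Rsum_incr (f : nat -> R) (m n : nat) :
  (forall i, (0 <= f i)%R) -> (m <= n)%nat -> (Rsum f m <= Rsum f n)%R.
Proof.
  intros H Hmn. replace n with (m + (n - m))%nat by lia. rewrite Rsum_add.
  pose proof (Rsum_ge0 (fun i => f (m + i)%nat) (n - m) (fun i _ => H _)). lra.
Qed.

(** The off-by-one between the two conventions: [sum_n] includes its upper index, [Csum] stops
    before it. *)
Lemma sum_n_Csum (f : nat -> C) (n : nat) : sum_n f n = Csum f (S n).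
Proof.
  induction n as [|n IH].
  - rewrite sum_O. simpl. ring.
  - rewrite sum_Sn, IH. reflexivity.
Qed.

(** * Majorants and absolute convergence *)

Lemma Rsum_bounded_Cauchy (f : nat -> R) (B : R) :
  (forall i, (0 <= f i)%R) -> (forall n, (Rsum f n <= B)%R) ->
  forall eps : R, (0 < eps)%R -> exists N : nat, forall n : nat,
    (N <= n)%nat -> (Rsum f n - Rsum f N < eps)%R.
Proof.
  intros Hf Hb eps He.
  assert (G : ex_finite_lim_seq (Rsum f)).
  { apply ex_finite_lim_seq_incr with B; [|exact Hb].
    intros n. simpl. specialize (Hf n). lra. }
  apply ex_lim_seq_cauchy_corr in G.
  destruct (G (mkposreal eps He)) as [N HN]. exists N. intros n Hn.
  specialize (HN n N Hn (le_n N)). simpl in HN.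
  eapply Rle_lt_trans; [apply Rle_abs|exact HN].
Qed.

Lemma Csum_abs_Cauchy (f : nat -> C) (b : nat -> R) (m n : nat) :
  (forall i, (Cmod (f i) <= b i)%R) -> (m <= n)%nat ->
  (Cmod (Csum f n - Csum f m) <= Rsum b n - Rsum b m)%R.
Proof.
  intros H Hmn. replace n with (m + (n - m))%nat by lia.
  rewrite Csum_add, Rsum_add.
  replace (Csum f m + Csum (fun i => f (m + i)%nat) (n - m) - Csum f m)
    with (Csum (fun i => f (m + i)%nat) (n - m)) by ring.
  eapply Rle_trans; [apply Cmod_Csum|].
  replace (Rsum b m + Rsum (fun i => b (m + i)%nat) (n - m) - Rsum b m)%R
    with (Rsum (fun i => b (m + i)%nat) (n - m)) by ring.
  apply Rsum_le. intros; apply H.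
Qed.

(** The majorant test in a form that covers series and products alike: bounded partial sums of [b]
    are Cauchy and pass this on to [u]. The error estimate is the bound on increments with the later
    index sent to infinity. *)
Lemma Clim_of_increments (u : nat -> C) (b : nat -> R) (B : R) :
  (forall i, (0 <= b i)%R) -> (forall n, (Rsum b n <= B)%R) ->
  (forall m n, (m <= n)%nat -> (Cmod (u n - u m) <= Rsum b n - Rsum b m)%R) ->
  exists l, Clim u l /\ forall m, (Cmod (l - u m) <= B - Rsum b m)%R.
Proof.
  intros Hb HB Hu.
  assert (E : exists l, Clim u l).
  { apply Clim_of_Cauchy. intros eps He.
    destruct (Rsum_bounded_Cauchy b B Hb HB (eps / 2)%R) as [N HN]; [lra|].
    exists N. intros m n Hm Hn.
    pose proof (Hu N m Hm). pose proof (Hu N n Hn). pose proof (HN m Hm). pose proof (HN n Hn).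
    pose proof (Cmod_sub_triangle (u m) (u N) (u n)).
    rewrite (Cmod_minus_sym (u N)) in H3. lra. }
  destruct E as [l Hl]. exists l. split; [exact Hl|]. intros m.
  apply (Clim_Cmod_le (fun n => u n - u m) (l - u m) _ m).
  - apply Clim_minus; [exact Hl|apply Clim_const].
  - intros n Hn. specialize (Hu m n Hn). specialize (HB n). lra.
Qed.

Lemma Clim_Csum_abs (f : nat -> C) (b : nat -> R) (B : R) :
  (forall i, (Cmod (f i) <= b i)%R) -> (forall n, (Rsum b n <= B)%R) ->
  exists l, Clim (Csum f) l /\ (Cmod l <= B)%R.
Proof.
  intros H HB.
  destruct (Clim_of_increments (Csum f) b B) as [l [Hl Hm]]; auto.
  - intros i. eapply Rle_trans; [apply Cmod_ge_0|apply H].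
  - intros m n Hmn. now apply Csum_abs_Cauchy.
  - exists l. split; [exact Hl|]. specialize (Hm O). simpl in Hm.
    replace (l - 0) with l in Hm by ring. lra.
Qed.

Lemma exp_le_compat (x y : R) : (x <= y)%R -> (exp x <= exp y)%R.
Proof. intros [H|H]; [left; now apply exp_increasing|right; now rewrite H]. Qed.

Lemma Cmod_Cprod_le (v : nat -> C) (b : nat -> R) (n : nat) :
  (forall i, (i < n)%nat -> (Cmod (v i) <= b i)%R) ->
  (Cmod (Cprod (fun i => 1 + v i)%C n) <= exp (Rsum b n))%R.
Proof.
  induction n as [|n IH]; intros H; simpl.
  - rewrite Cmod_1, exp_0. lra.
  - rewrite Cmod_mult, exp_plus. apply Rmult_le_compat; try apply Cmod_ge_0.
    + apply IH. intros; apply H; lia.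
    + eapply Rle_trans; [apply Cmod_triangle|]. rewrite Cmod_1.
      specialize (H n ltac:(lia)). pose proof (exp_ineq1_le (b n)). lra.
Qed.

(** Telescoping: one more factor changes the product by the product so far times [v n], and the
    product so far is at most [exp B]. *)
Lemma Cprod_diff_le (v : nat -> C) (b : nat -> R) (B : R) (m n : nat) :
  (forall i, (i < n)%nat -> (Cmod (v i) <= b i)%R) ->
  (forall k, (k <= n)%nat -> (Rsum b k <= B)%R) -> (m <= n)%nat ->
  (Cmod (Cprod (fun i => 1 + v i)%C n - Cprod (fun i => 1 + v i)%C m)
   <= exp B * (Rsum b n - Rsum b m))%R.
Proof.
  intros H HB Hmn. revert H HB. induction Hmn as [|n Hmn IH]; intros H HB.
  - replace (Cprod _ m - Cprod _ m) with (RtoC 0) by ring. rewrite Cmod_0. lra.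
  - simpl. replace (Cprod (fun i => 1 + v i) n * (1 + v n) - Cprod (fun i => 1 + v i) m)
      with ((Cprod (fun i => 1 + v i) n - Cprod (fun i => 1 + v i) m)
            + Cprod (fun i => 1 + v i) n * v n) by ring.
    eapply Rle_trans; [apply Cmod_triangle|].
    replace (exp B * (Rsum b n + b n - Rsum b m))%R
      with (exp B * (Rsum b n - Rsum b m) + exp B * b n)%R by ring.
    apply Rplus_le_compat.
    + apply IH; intros; [apply H|apply HB]; lia.
    + rewrite Cmod_mult. apply Rmult_le_compat; try apply Cmod_ge_0; [|apply H; lia].
      eapply Rle_trans; [apply (Cmod_Cprod_le v b); intros; apply H; lia|].
      apply exp_le_compat, HB. lia.
Qed.

Lemma Clim_Cprod_abs (v : nat -> C) (b : nat -> R) (B : R) :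
  (forall i, (Cmod (v i) <= b i)%R) -> (forall n, (Rsum b n <= B)%R) ->
  exists l, Clim (Cprod (fun i => 1 + v i)) l /\
    forall m, (Cmod (l - Cprod (fun i => 1 + v i)%C m) <= exp B * (B - Rsum b m))%R.
Proof.
  intros H HB.
  destruct (Clim_of_increments (Cprod (fun i => 1 + v i)) (fun i => exp B * b i)%R
              (exp B * B)%R) as [l [Hl Hm]].
  - intros i. apply Rmult_le_pos; [left; apply exp_pos|].
    eapply Rle_trans; [apply Cmod_ge_0|apply H].
  - intros n. rewrite Rsum_scal. apply Rmult_le_compat_l; [left; apply exp_pos|apply HB].
  - intros m n Hmn. rewrite !Rsum_scal.
    pose proof (Cprod_diff_le v b B m n ltac:(auto) ltac:(auto) Hmn). lra.
  - exists l. split; [exact Hl|]. intros m. specialize (Hm m). rewrite Rsum_scal in Hm. lra.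
Qed.

(** Tannery's theorem for products: a common majorant makes all tails beyond some [K] small
    uniformly in [h], and below [K] the limit can be taken factor by factor. The number of factors
    grows with [h], as in the finite product of the sine. *)
Lemma Clim_Cprod_dominated (v : nat -> nat -> C) (w : nat -> C) (b : nat -> R) (B : R) (L : C) :
  (forall h i, (i < h)%nat -> (Cmod (v h i) <= b i)%R) ->
  (forall n, (Rsum b n <= B)%R) -> (forall i, (0 <= b i)%R) ->
  (forall i, Clim (fun h => v h i) (w i)) ->
  Clim (fun h => Cprod (fun i => 1 + v h i) h) L ->
  Clim (Cprod (fun i => 1 + w i)) L.
Proof.
  intros H HB Hb Hw HL.
  assert (Hwb : forall i, (Cmod (w i) <= b i)%R).
  { intros i. apply (Clim_Cmod_le (fun h => v h i) _ _ (S i) (Hw i)).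
    intros h Hh. apply H. lia. }
  destruct (Clim_Cprod_abs w b B Hwb HB) as [l [Hl Hm]].
  assert (E : L = l); [|now rewrite E].
  destruct (Ceq_dec L l) as [|D]; [assumption|exfalso].
  assert (P : (0 < Cmod (L - l))%R) by (apply Cmod_pos, Cminus_eq_contra, D).
  (* Five distances, each smaller than [d], lead from [L] to [l]; a sixth of the total distance is
     thus small enough for a contradiction. *)
  set (d := (Cmod (L - l) / 6)%R). assert (Pd : (0 < d)%R) by (unfold d; lra).
  pose proof (exp_pos B) as Pe.
  destruct (Rsum_bounded_Cauchy b B Hb HB (d / exp B)%R) as [K HK].
  { now apply Rdiv_lt_0_compat. }
  assert (F : Clim (fun h => Cprod (fun i => 1 + v h i) K) (Cprod (fun i => 1 + w i) K)).
  { clear - Hw. induction K as [|K IH]; simpl; [apply Clim_const|].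
    apply Clim_mult; [exact IH|]. apply Clim_plus; [apply Clim_const|apply Hw]. }
  destruct (F d Pd) as [N1 H1]. destruct (HL d Pd) as [N2 H2]. destruct (Hl d Pd) as [N3 H3].
  set (n := (K + N1 + N2 + N3)%nat).
  specialize (H1 n ltac:(lia)). specialize (H2 n ltac:(lia)). specialize (H3 n ltac:(lia)).
  assert (T1 : (Cmod (Cprod (fun i => 1 + v n i)%C n - Cprod (fun i => 1 + v n i)%C K) < d)%R).
  { eapply Rle_lt_trans; [apply (Cprod_diff_le (v n) b B K n)|].
    - intros; apply H; lia.
    - intros; apply HB.
    - lia.
    - specialize (HK n ltac:(lia)).
      apply (Rmult_lt_compat_l (exp B)) in HK; [|lra].
      replace (exp B * (d / exp B))%R with d in HK by (field; lra). exact HK. }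
  assert (T2 : (Cmod (Cprod (fun i => 1 + w i)%C n - Cprod (fun i => 1 + w i)%C K) < d)%R).
  { eapply Rle_lt_trans; [apply (Cprod_diff_le w b B K n)|].
    - intros; apply Hwb; lia.
    - intros; apply HB.
    - lia.
    - specialize (HK n ltac:(lia)).
      apply (Rmult_lt_compat_l (exp B)) in HK; [|lra].
      replace (exp B * (d / exp B))%R with d in HK by (field; lra). exact HK. }
  set (A := Cprod (fun i => 1 + v n i) n) in *.
  set (A' := Cprod (fun i => 1 + v n i) K) in *.
  set (W := Cprod (fun i => 1 + w i) n) in *.
  set (W' := Cprod (fun i => 1 + w i) K) in *.
  assert (Q : (Cmod (L - l) <= Cmod (A - L) + Cmod (A - A') + Cmod (A' - W')
                 + Cmod (W - W') + Cmod (W - l))%R).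
  { replace (L - l) with (- (A - L) + (A - A') + (A' - W') + - (W - W') + (W - l)) by ring.
    repeat (eapply Rle_trans; [apply Cmod_triangle|apply Rplus_le_compat]);
      rewrite ?Cmod_opp; lra. }
  unfold d in *. lra.
Qed.

(** * The exponential and the product formula of the sine *)

(** [is_derive_ext] leaves equations typed in the carrier of a canonical structure; restating them
    in [R] lets [ring] recognise them. *)
Ltac as_real_eq := match goal with |- @eq _ ?a ?b => change (@eq R a b) end.

Lemma cexp_plus (a b : C) : cexp (a + b) = cexp a * cexp b.
Proof.
  destruct a as [a1 a2], b as [b1 b2]. unfold cexp, Cplus, Cmult; simpl.
  rewrite exp_plus, cos_plus, sin_plus. f_equal; ring.
Qed.

Lemma cexp_0 : cexp 0 = 1.
Proof. unfold cexp; simpl. rewrite exp_0, cos_0, sin_0. unfold RtoC. f_equal; ring. Qed.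

Lemma Cmod_cexp (w : C) : Cmod (cexp w) = exp (Re w).
Proof.
  unfold cexp, Cmod; simpl. rewrite !Rmult_1_r.
  replace (_ + _)%R with ((exp (Re w))² * ((sin (Im w))² + (cos (Im w))²))%R
    by (unfold Rsqr; ring).
  rewrite sin2_cos2, Rmult_1_r. apply sqrt_Rsqr. left; apply exp_pos.
Qed.

Lemma cexp_neq0 (w : C) : cexp w <> 0.
Proof. apply Cmod_neq0. rewrite Cmod_cexp. apply exp_pos. Qed.

Lemma cexp_opp (w : C) : cexp (- w) = / cexp w.
Proof.
  assert (H : cexp w * cexp (- w) = 1).
  { rewrite <- cexp_plus. replace (w + - w) with (RtoC 0) by ring. apply cexp_0. }
  rewrite <- (Cmult_1_l (cexp (- w))). rewrite <- (Cinv_l (cexp w)) by apply cexp_neq0.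
  rewrite <- Cmult_assoc, H. ring.
Qed.

(** There is no mean value point for complex values. Projecting on the direction [D = f 1 - f 0]
    gives a real function whose total increase is [Cmod D ^ 2]; the real theorem and Cauchy-Schwarz
    then bound [Cmod D]. *)
Lemma mean_value_ineq (f f' : R -> C) (M : R) :
  (0 <= M)%R ->
  (forall s, is_derive (fun t => Re (f t)) s (Re (f' s))) ->
  (forall s, is_derive (fun t => Im (f t)) s (Im (f' s))) ->
  (forall s, (0 <= s <= 1)%R -> (Cmod (f' s) <= M)%R) ->
  (Cmod (f 1%R - f 0%R) <= M)%R.
Proof.
  intros HM Hr Hi Hb. set (D := f 1%R - f 0%R).
  destruct (MVT_gen (fun t => Re D * Re (f t) + Im D * Im (f t))%R 0 1
              (fun s => Re D * Re (f' s) + Im D * Im (f' s))%R) as [c [Hc E]].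
  - intros x _. apply @is_derive_plus; now apply is_derive_scal.
  - intros x _. apply continuity_pt_filterlim.
    apply (ex_derive_continuous (fun t => Re D * Re (f t) + Im D * Im (f t))%R).
    eexists. apply @is_derive_plus; apply is_derive_scal; eauto.
  - rewrite Rmin_left, Rmax_right in Hc by lra. specialize (Hb c Hc).
    assert (Q : (Cmod D ^ 2 = Re D * Re (f' c) + Im D * Im (f' c))%R).
    { rewrite Cmod2_alt. rewrite Rminus_0_r, Rmult_1_r in E. rewrite <- E. unfold D.
      unfold Cminus. rewrite re_plus, im_plus, re_opp, im_opp. ring. }
    assert (CS : (Re D * Re (f' c) + Im D * Im (f' c) <= Cmod D * Cmod (f' c))%R).
    { rewrite <- Cmod_conj with (f' c), <- Cmod_mult.
      replace (Re D * Re (f' c) + Im D * Im (f' c))%R with (Re (D * Cconj (f' c))).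
      - eapply Rle_trans; [apply Rle_abs|apply re_le_Cmod].
      - unfold Cmult, Cconj, Re, Im; simpl. ring. }
    pose proof (Cmod_ge_0 D).
    assert (Cmod D * Cmod (f' c) <= Cmod D * M)%R by (apply Rmult_le_compat_l; lra).
    destruct (Rle_lt_dec (Cmod D) M) as [|L]; [assumption|].
    assert (Cmod D ^ 2 <= Cmod D * M)%R by (rewrite Q; lra). nra.
Qed.

Lemma Cmod_cexp_scal_le (t : C) (s : R) :
  (0 <= s <= 1)%R -> (Cmod (cexp (RtoC s * t)) <= exp (Cmod t))%R.
Proof.
  intros Hs. rewrite Cmod_cexp, re_scal_l.
  apply exp_le_compat.
  pose proof (re_le_Cmod t). pose proof (Rle_abs (Re t)). pose proof (Cmod_ge_0 t).
  destruct (Rle_lt_dec 0 (Re t)); nra.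
Qed.

Lemma Re_cexp_scal (t : C) (s : R) :
  Re (cexp (RtoC s * t)) = (exp (s * Re t) * cos (s * Im t))%R.
Proof.
  change (Re (cexp (RtoC s * t))) with (exp (Re (RtoC s * t)) * cos (Im (RtoC s * t)))%R.
  now rewrite re_scal_l, im_scal_l.
Qed.

Lemma Im_cexp_scal (t : C) (s : R) :
  Im (cexp (RtoC s * t)) = (exp (s * Re t) * sin (s * Im t))%R.
Proof.
  change (Im (cexp (RtoC s * t))) with (exp (Re (RtoC s * t)) * sin (Im (RtoC s * t)))%R.
  now rewrite re_scal_l, im_scal_l.
Qed.

Lemma cexp_sub_1_le (t : C) : (Cmod (cexp t - 1) <= Cmod t * exp (Cmod t))%R.
Proof.
  pose proof (mean_value_ineq (fun s => cexp (RtoC s * t)) (fun s => t * cexp (RtoC s * t))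
                (Cmod t * exp (Cmod t))) as H.
  cbv beta in H. rewrite Cmult_1_l, Cmult_0_l, cexp_0 in H. apply H; clear H.
  - apply Rmult_le_pos; [apply Cmod_ge_0|left; apply exp_pos].
  - intros s. apply (is_derive_ext (fun s => exp (s * Re t) * cos (s * Im t))%R).
    { intros; symmetry; apply Re_cexp_scal. }
    rewrite re_mult, Re_cexp_scal, Im_cexp_scal. auto_derive; [auto|ring].
  - intros s. apply (is_derive_ext (fun s => exp (s * Re t) * sin (s * Im t))%R).
    { intros; symmetry; apply Im_cexp_scal. }
    rewrite im_mult, Re_cexp_scal, Im_cexp_scal. auto_derive; [auto|ring].
  - intros s Hs. rewrite Cmod_mult. apply Rmult_le_compat_l; [apply Cmod_ge_0|].
    now apply Cmod_cexp_scal_le.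
Qed.

Lemma cexp_sub_1_sub_le (t : C) :
  (Cmod (cexp t - 1 - t) <= Cmod t ^ 2 * exp (Cmod t))%R.
Proof.
  pose proof (mean_value_ineq (fun s => cexp (RtoC s * t) - RtoC s * t)
                (fun s => t * cexp (RtoC s * t) - t)
                (Cmod t ^ 2 * exp (Cmod t))) as H.
  cbv beta in H. rewrite Cmult_1_l, Cmult_0_l, cexp_0 in H.
  replace (cexp t - t - (1 - 0)) with (cexp t - 1 - t) in H by ring. apply H; clear H.
  - apply Rmult_le_pos; [apply pow2_ge_0|left; apply exp_pos].
  - intros s. apply (is_derive_ext (fun s => exp (s * Re t) * cos (s * Im t) - s * Re t)%R).
    { intros; symmetry; as_real_eq. unfold Cminus. rewrite re_plus, re_opp, Re_cexp_scal, re_scal_l. ring. }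
    unfold Cminus. rewrite re_plus, re_opp, re_mult, Re_cexp_scal, Im_cexp_scal.
    auto_derive; [auto|ring].
  - intros s. apply (is_derive_ext (fun s => exp (s * Re t) * sin (s * Im t) - s * Im t)%R).
    { intros; symmetry; as_real_eq. unfold Cminus. rewrite im_plus, im_opp, Im_cexp_scal, im_scal_l. ring. }
    unfold Cminus. rewrite im_plus, im_opp, im_mult, Re_cexp_scal, Im_cexp_scal.
    auto_derive; [auto|ring].
  - intros s Hs. replace (t * cexp (RtoC s * t) - t) with (t * (cexp (RtoC s * t) - 1)) by ring.
    rewrite Cmod_mult. simpl. rewrite Rmult_1_r, Rmult_assoc.
    apply Rmult_le_compat_l; [apply Cmod_ge_0|].
    eapply Rle_trans; [apply cexp_sub_1_le|].
    assert (L : (Cmod (RtoC s * t) <= Cmod t)%R).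
    { rewrite Cmod_mult, Cmod_R, Rabs_right by lra. pose proof (Cmod_ge_0 t). nra. }
    apply Rmult_le_compat; [apply Cmod_ge_0|left; apply exp_pos|exact L|].
    now apply exp_le_compat.
Qed.

(** The derivative of [(1 - s t) exp(s t)] in [s] is [- s t^2 exp(s t)]: the linear terms cancel.
    With [t = z^2/w^2] the deviation from 1 is of order [w^(-4)], which is summable over a
    lattice. *)
Lemma weierstrass_factor_le (t : C) :
  (Cmod ((1 - t) * cexp t - 1) <= Cmod t ^ 2 * exp (Cmod t))%R.
Proof.
  pose proof (mean_value_ineq (fun s => (1 - RtoC s * t) * cexp (RtoC s * t))
                (fun s => - (RtoC s * (t * t)) * cexp (RtoC s * t))
                (Cmod t ^ 2 * exp (Cmod t))) as H.
  cbv beta in H. rewrite Cmult_1_l, Cmult_0_l, cexp_0 in H.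
  replace ((1 - t) * cexp t - (1 - 0) * 1) with ((1 - t) * cexp t - 1) in H by ring. apply H; clear H.
  - apply Rmult_le_pos; [apply pow2_ge_0|left; apply exp_pos].
  - intros s. apply (is_derive_ext (fun s => (1 - s * Re t) * (exp (s * Re t) * cos (s * Im t))
                     + s * Im t * (exp (s * Re t) * sin (s * Im t)))%R).
    { intros; symmetry; as_real_eq. unfold Cminus.
      rewrite re_mult, re_plus, im_plus, re_opp, im_opp, Re_cexp_scal, Im_cexp_scal, re_scal_l, im_scal_l.
      simpl. ring. }
    rewrite re_mult, re_opp, im_opp, re_scal_l, im_scal_l, re_mult, im_mult, Re_cexp_scal, Im_cexp_scal.
    auto_derive; [auto|ring].
  - intros s. apply (is_derive_ext (fun s => (1 - s * Re t) * (exp (s * Re t) * sin (s * Im t))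
                     - s * Im t * (exp (s * Re t) * cos (s * Im t)))%R).
    { intros; symmetry; as_real_eq. unfold Cminus.
      rewrite im_mult, re_plus, im_plus, re_opp, im_opp, Re_cexp_scal, Im_cexp_scal, re_scal_l, im_scal_l.
      simpl. ring. }
    rewrite im_mult, re_opp, im_opp, re_scal_l, im_scal_l, re_mult, im_mult, Re_cexp_scal, Im_cexp_scal.
    auto_derive; [auto|ring].
  - intros s Hs. rewrite Cmod_mult, Cmod_opp, !Cmod_mult, Cmod_R, Rabs_right by lra.
    apply Rmult_le_compat; try apply Rmult_le_pos; try apply Cmod_ge_0; try lra.
    + apply Rmult_le_pos; apply Cmod_ge_0.
    + pose proof (Cmod_ge_0 t). simpl. nra.
    + now apply Cmod_cexp_scal_le.
Qed.

Lemma e2pi_plus (a b : C) : e2pi (a + b) = e2pi a * e2pi b.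
Proof. unfold e2pi. rewrite <- cexp_plus. f_equal. ring. Qed.

Lemma e2pi_0 : e2pi 0 = 1.
Proof. unfold e2pi. rewrite Cmult_0_r. apply cexp_0. Qed.

Lemma e2pi_neq0 (w : C) : e2pi w <> 0.
Proof. apply cexp_neq0. Qed.

Lemma e2pi_opp (w : C) : e2pi (- w) = / e2pi w.
Proof. unfold e2pi. rewrite <- cexp_opp. f_equal. ring. Qed.

Lemma e2pi_minus (a b : C) : e2pi (a - b) = e2pi a / e2pi b.
Proof. unfold Cminus. now rewrite e2pi_plus, e2pi_opp. Qed.

Lemma e2pi_pow (w : C) (n : nat) : e2pi w ^ n = e2pi (RtoC (INR n) * w).
Proof.
  induction n as [|n IH].
  - simpl. rewrite Cmult_0_l, e2pi_0. reflexivity.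
  - rewrite Cpow_S, IH, <- e2pi_plus, S_INR, RtoC_plus. f_equal. ring.
Qed.

Lemma e2pi_R (t : R) : e2pi (RtoC t) = (cos (2 * PI * t), sin (2 * PI * t)).
Proof.
  unfold e2pi, cexp. rewrite re_scal_r, im_scal_r, re_scal_l, im_scal_l. simpl.
  rewrite Rmult_0_r, Rmult_0_l, exp_0. f_equal; rewrite Rmult_1_l; f_equal; ring.
Qed.

Lemma e2pi_INR (n : nat) : e2pi (RtoC (INR n)) = 1.
Proof.
  replace (RtoC (INR n)) with (RtoC (INR n) * 1) by ring. rewrite <- e2pi_pow.
  rewrite e2pi_R, Rmult_1_r, cos_2PI, sin_2PI. change (1%R, 0%R) with (RtoC 1).
  apply Cpow_1_l.
Qed.

Lemma e2pi_IZR (n : Z) : e2pi (RtoC (IZR n)) = 1.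
Proof.
  destruct (Z_le_gt_dec 0 n) as [H|H].
  - rewrite <- (Z2Nat.id n) by exact H. rewrite <- INR_IZR_INZ. apply e2pi_INR.
  - replace n with (- (- n))%Z by lia. rewrite opp_IZR, RtoC_opp, e2pi_opp.
    rewrite <- (Z2Nat.id (- n)) by lia. rewrite <- INR_IZR_INZ, e2pi_INR.
    field.
Qed.

Lemma Cmod_e2pi (w : C) : Cmod (e2pi w) = exp (- (2 * PI * Im w)).
Proof.
  unfold e2pi. rewrite Cmod_cexp. f_equal.
  rewrite re_mult, re_scal_l, im_scal_l. simpl. ring.
Qed.

Lemma Cmod_e2pi_R (t : R) : Cmod (e2pi (RtoC t)) = 1%R.
Proof. rewrite Cmod_e2pi, im_RtoC, Rmult_0_r, Ropp_0. apply exp_0. Qed.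

Lemma e2pi_R_neq1 (t : R) : (0 < t < 1)%R -> e2pi (RtoC t) <> 1.
Proof.
  intros Ht E. rewrite e2pi_R in E. apply (f_equal Re) in E. simpl in E.
  replace (2 * PI * t)%R with (2 * (PI * t))%R in E by ring.
  rewrite cos_2a_sin in E.
  assert (P : (0 < sin (PI * t))%R) by (apply sin_gt_0; pose proof PI_RGT_0; nra).
  nra.
Qed.

Definition two_pi_i : C := RtoC (2 * PI) * Defs.Ci.

Lemma e2pi_cexp (w : C) : e2pi w = cexp (two_pi_i * w).
Proof. reflexivity. Qed.

Lemma Cmod_two_pi_i : Cmod two_pi_i = (2 * PI)%R.
Proof.
  unfold two_pi_i. change Defs.Ci with Ci. rewrite Cmod_mult, Cmod_R, Cmod_Ci, Rabs_right, Rmult_1_r; [reflexivity|].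
  pose proof PI_RGT_0; lra.
Qed.

Lemma two_pi_i_neq0 : two_pi_i <> 0.
Proof. apply Cmod_neq0. rewrite Cmod_two_pi_i. pose proof PI_RGT_0; lra. Qed.

(* [sin2i u] is [2 i sin (pi u)]. *)
Definition sin2i (u : C) : C := e2pi (u / 2) - e2pi (- (u / 2)).

Lemma C2_neq0 : RtoC 2 <> 0.
Proof. intros E. apply (f_equal Re) in E. simpl in E. lra. Qed.

Lemma sin2i_0 : sin2i 0 = 0.
Proof. unfold sin2i. replace (- (0 / 2)) with (0 / 2) by field. ring. Qed.

Lemma sin2i_opp (u : C) : sin2i (- u) = - sin2i u.
Proof.
  unfold sin2i. replace (- u / 2) with (- (u / 2)) by field.
  replace (- - (u / 2)) with (u / 2) by ring. ring.
Qed.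

Lemma sin2i_alt (u : C) : sin2i u = - e2pi (- (u / 2)) * (1 - e2pi u).
Proof.
  unfold sin2i. replace (e2pi (u / 2)) with (e2pi (- (u / 2)) * e2pi u); [ring|].
  rewrite <- e2pi_plus. f_equal. field.
Qed.

Lemma sin2i_plus_1 (u : C) : sin2i (u + 1) = - sin2i u.
Proof.
  rewrite !sin2i_alt. rewrite (e2pi_plus u 1). rewrite (e2pi_IZR 1).
  replace (- ((u + 1) / 2)) with (- (u / 2) + RtoC (- (1 / 2))%R).
  2:{ rewrite RtoC_opp, RtoC_div by lra. field. }
  rewrite e2pi_plus, e2pi_R.
  replace (2 * PI * - (1 / 2))%R with (- PI)%R by field.
  rewrite cos_neg, sin_neg, cos_PI, sin_PI.
  replace ((-1)%R, (- 0)%R) with (RtoC (-1)) by (unfold RtoC; f_equal; ring). ring.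
Qed.

Lemma sin2i_mul (a b : C) : sin2i (a + b) * sin2i (a - b) = sin2i a ^ 2 - sin2i b ^ 2.
Proof.
  unfold sin2i.
  replace ((a + b) / 2) with (a / 2 + b / 2) by field.
  replace ((a - b) / 2) with (a / 2 + - (b / 2)) by field.
  replace (- (a / 2 + b / 2)) with (- (a / 2) + - (b / 2)) by ring.
  replace (- (a / 2 + - (b / 2))) with (- (a / 2) + b / 2) by ring.
  rewrite !e2pi_plus, !e2pi_opp.
  field. split; apply e2pi_neq0.
Qed.

Lemma sin2i_R (t : R) : Cmod (sin2i (RtoC t)) = (2 * Rabs (sin (PI * t)))%R.
Proof.
  unfold sin2i. rewrite <- RtoC_div by lra. rewrite <- RtoC_opp, !e2pi_R.
  replace (2 * PI * - (t / 2))%R with (- (PI * t))%R by field.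
  replace (2 * PI * (t / 2))%R with (PI * t)%R by field.
  rewrite cos_neg, sin_neg.
  replace (_ - _) with (RtoC (2 * sin (PI * t)) * Ci).
  - rewrite Cmod_mult, Cmod_R, Cmod_Ci, Rabs_mult, (Rabs_right 2) by lra. ring.
  - unfold Cminus, Cplus, Copp, Cmult, Ci, RtoC; simpl. f_equal; ring.
Qed.

Lemma sin2i_le (v : C) :
  (Cmod (sin2i v) <= 2 * PI * Cmod v * exp (3 * PI * Cmod v))%R.
Proof.
  rewrite sin2i_alt. rewrite Cmod_mult, Cmod_opp, Cmod_minus_sym, Cmod_e2pi.
  pose proof PI_RGT_0 as HP. pose proof (Cmod_ge_0 v) as Hv.
  assert (A : (Cmod (e2pi v - 1) <= 2 * PI * Cmod v * exp (2 * PI * Cmod v))%R).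
  { rewrite e2pi_cexp. eapply Rle_trans; [apply cexp_sub_1_le|].
    rewrite Cmod_mult, Cmod_two_pi_i. lra. }
  assert (B : (exp (- (2 * PI * Im (- (v / 2)))) <= exp (PI * Cmod v))%R).
  { apply exp_le_compat. rewrite im_opp.
    replace (Im (v / 2)) with (Im v / 2)%R.
    2:{ unfold Cdiv. rewrite <- RtoC_inv by lra. rewrite im_scal_r. reflexivity. }
    pose proof (im_le_Cmod v). pose proof (Rle_abs (Im v)). nra. }
  apply Rle_trans with (exp (PI * Cmod v) * (2 * PI * Cmod v * exp (2 * PI * Cmod v)))%R.
  - apply Rmult_le_compat; [left; apply exp_pos|apply Cmod_ge_0|exact B|exact A].
  - replace (3 * PI * Cmod v)%R with (PI * Cmod v + 2 * PI * Cmod v)%R by ring.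
    rewrite exp_plus. right. ring.
Qed.

Lemma is_lim_seq_inv_INR_S : is_lim_seq (fun n => / INR (S n))%R 0%R.
Proof.
  apply (is_lim_seq_incr_1 (fun n => / INR n)%R).
  replace (Finite 0) with (Rbar_inv p_infty) by reflexivity.
  apply is_lim_seq_inv; [apply is_lim_seq_INR|discriminate].
Qed.

(** Both exponentials are expanded to first order; the linear terms add up to the limit and the
    remainders are of order [1/N^2]. The function [f] leaves room for restricting to odd [N], where
    the finite product is available. *)
Lemma Clim_scaled_sin2i (u : C) (f : nat -> nat) :
  (forall h, (h < f h)%nat) ->
  Clim (fun h => RtoC (INR (f h)) * sin2i (u / RtoC (INR (f h)))) (two_pi_i * u).
Proof.
  intros Hf. pose proof PI_RGT_0 as HP. pose proof (Cmod_ge_0 u) as Hu.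
  set (t := (PI * Cmod u)%R).
  apply (Clim_le_real _ _ (fun h => (2 * (t ^ 2 * exp t)) * / INR (S h))%R).
  { replace (Finite 0) with (Rbar_mult (Finite (2 * (t ^ 2 * exp t))) (Finite 0))
      by (simpl; f_equal; ring).
    apply is_lim_seq_scal_l, is_lim_seq_inv_INR_S. }
  intros h. specialize (Hf h). set (N := f h) in *.
  assert (HN : (0 < INR N)%R) by (apply lt_0_INR; lia).
  assert (HN1 : (1 <= INR N)%R) by (apply (le_INR 1); lia).
  assert (N0 : RtoC (INR N) <> 0) by (intros E; apply RtoC_inj in E; lra).
  set (w := two_pi_i * (u / RtoC (INR N) / 2)).
  assert (Ew : Cmod w = (t / INR N)%R).
  { unfold w, Cdiv. rewrite !Cmod_mult, Cmod_two_pi_i, !Cmod_inv by (auto; apply C2_neq0).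
    rewrite !Cmod_R, !Rabs_right by lra. unfold t. field. lra. }
  replace (RtoC (INR N) * sin2i (u / RtoC (INR N)) - two_pi_i * u)
    with (RtoC (INR N) * ((cexp w - 1 - w) - (cexp (- w) - 1 - - w))).
  2:{ unfold sin2i. rewrite !e2pi_cexp. fold w.
      replace (two_pi_i * - (u / RtoC (INR N) / 2)) with (- w) by (unfold w; ring).
      replace (two_pi_i * u) with (RtoC (INR N) * (w + w)); [ring|].
      unfold w. field. auto. }
  rewrite Cmod_mult, Cmod_R, Rabs_right by lra.
  assert (Q : (Cmod ((cexp w - 1 - w) - (cexp (- w) - 1 - - w)) <= 2 * (Cmod w ^ 2 * exp (Cmod w)))%R).
  { unfold Cminus at 1. eapply Rle_trans; [apply Cmod_triangle|]. rewrite Cmod_opp.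
    pose proof (cexp_sub_1_sub_le w). pose proof (cexp_sub_1_sub_le (- w)).
    rewrite Cmod_opp in H0. lra. }
  apply Rle_trans with (INR N * (2 * (Cmod w ^ 2 * exp (Cmod w))))%R.
  { apply Rmult_le_compat_l; lra. }
  rewrite Ew. assert (Ht : (0 <= t)%R) by (unfold t; nra).
  assert (E1 : (exp (t / INR N) <= exp t)%R).
  { apply exp_le_compat. apply Rmult_le_reg_r with (INR N); [lra|].
    unfold Rdiv. rewrite Rmult_assoc, Rinv_l by lra. nra. }
  replace (INR N * (2 * ((t / INR N) ^ 2 * exp (t / INR N))))%R
    with (2 * (t ^ 2 * exp (t / INR N)) * / INR N)%R by (field; lra).
  apply Rmult_le_compat.
  - apply Rmult_le_pos; [lra|]. apply Rmult_le_pos; [nra|left; apply exp_pos].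
  - left; now apply Rinv_0_lt_compat.
  - apply Rmult_le_compat_l; [lra|]. apply Rmult_le_compat_l; [nra|exact E1].
  - apply Rinv_le_contravar; [apply lt_0_INR; lia|apply le_INR; lia].
Qed.

(** * Factorisation at roots of unity and the finite product of the sine *)

Definition peval (c : nat -> C) (n : nat) (X : C) : C := Csum (fun i => c i * X ^ i) n.

Lemma peval_S (c : nat -> C) (n : nat) (X : C) :
  peval c (S n) X = c O + X * peval (fun i => c (S i)) n X.
Proof.
  unfold peval. rewrite Csum_shift, <- Csum_scal. simpl. f_equal; [ring|].
  apply Csum_ext. intros; ring.
Qed.

(** Synthetic division. The leading coefficient is carried along because [peval_roots] has to end
    with the exact constant in front of the linear factors. *)
Lemma peval_divide (n : nat) (c : nat -> C) (r : C) :
  exists c', c' n = c (S n) /\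
    forall X, peval c (S (S n)) X - peval c (S (S n)) r = (X - r) * peval c' (S n) X.
Proof.
  revert c. induction n as [|n IH]; intros c.
  - exists (fun _ => c 1%nat). split; [reflexivity|]. intros X. unfold peval; simpl. ring.
  - destruct (IH (fun i => c (S i))) as [d [Hd H]].
    exists (fun i => match i with O => peval (fun i => c (S i)) (S (S n)) r | S j => d j end).
    split; [exact Hd|]. intros X.
    rewrite (peval_S c _ X), (peval_S c _ r). specialize (H X).
    set (A := peval (fun i => c (S i)) (S (S n)) X) in *.
    set (B := peval (fun i => c (S i)) (S (S n)) r) in *.
    rewrite (peval_S (fun i => match i with O => B | S j => d j end)).
    change (fun i => d i) with d.
    replace A with (B + (X - r) * peval d (S n) X) by (rewrite <- H; ring). ring.
Qed.

Lemma peval_roots (n : nat) (c r : nat -> C) :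
  (forall i j, (i < j < n)%nat -> r i <> r j) ->
  (forall i, (i < n)%nat -> peval c (S n) (r i) = 0) ->
  forall X, peval c (S n) X = c n * Cprod (fun i => X - r i) n.
Proof.
  revert c r. induction n as [|n IH]; intros c r Hd Hr X.
  - unfold peval; simpl. ring.
  - destruct (peval_divide n c (r O)) as [d [Ed H]].
    rewrite (Hr O ltac:(lia)) in H.
    assert (Q : forall X, peval d (S n) X = d n * Cprod (fun i => X - r (S i)) n).
    { apply IH.
      - intros i j Hij. apply Hd. lia.
      - intros i Hi. specialize (H (r (S i))). rewrite (Hr (S i) ltac:(lia)) in H.
        assert (N : r (S i) - r O <> 0).
        { apply Cminus_eq_contra. intros E. apply (Hd O (S i)); [lia|auto]. }
        destruct (Ceq_dec (peval d (S n) (r (S i))) 0) as [|D]; [assumption|].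
        exfalso. apply (Cmult_neq_0 _ _ N D). rewrite <- H. ring. }
    specialize (H X). replace (peval c (S (S n)) X) with (peval c (S (S n)) X - 0) by ring.
    rewrite H, Q, Ed, Cprod_shift. ring.
Qed.

Lemma geom_sum (X : C) (n : nat) : (1 - X) * Csum (fun i => X ^ i) n = 1 - X ^ n.
Proof. induction n as [|n IH]; simpl; [ring|]. rewrite Cmult_plus_distr_l, IH. ring. Qed.

(** The powers [w, ..., w^(2h)] are distinct roots of the monic polynomial on the left, hence all of
    them. Pairing [w^k] with its inverse [w^(2h+1-k)] turns the linear factors into the symmetric
    form. It serves the sine product and, later, the part of the Klein quotient that yields the eta
    product. *)
Lemma geom_sum_factor (w : C) (h : nat) (X : C) :
  w ^ (2 * h + 1) = 1 -> (forall k, (0 < k < 2 * h + 1)%nat -> w ^ k <> 1) ->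
  Csum (fun i => X ^ i) (2 * h + 1) =
  Cprod (fun k => (1 - w ^ S k * X) * (1 - / w ^ S k * X)) h.
Proof.
  intros H1 Hk.
  assert (Hw : w <> 0).
  { intros E. rewrite E in H1. rewrite Nat.add_1_r, Cpow_S, Cmult_0_l in H1. now apply C1_nz. }
  replace (2 * h + 1)%nat with (S (2 * h)) in * by lia.
  assert (E : peval (fun _ => 1) (S (2 * h)) X = 1 * Cprod (fun i => X - w ^ S i) (2 * h)).
  { apply (peval_roots (2 * h) (fun _ => 1) (fun i => w ^ S i)).
    - intros i j Hij E. apply (Hk (j - i)%nat); [lia|].
      replace (S j) with (S i + (j - i))%nat in E by lia. rewrite Cpow_add_r in E.
      assert (P : w ^ S i <> 0) by now apply Cpow_nz.
      transitivity (/ w ^ S i * (w ^ S i * w ^ (j - i))).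
      + field. exact P.
      + rewrite <- E. field. exact P.
    - intros i Hi. set (Y := w ^ S i).
      assert (A : (1 - Y) * peval (fun _ => 1) (S (2 * h)) Y = 0).
      { unfold peval. rewrite (Csum_ext _ (fun i => Y ^ i)) by (intros; ring).
        rewrite geom_sum. unfold Y. rewrite <- Cpow_mult_r, Nat.mul_comm, Cpow_mult_r, H1.
        rewrite Cpow_1_l. ring. }
      destruct (Ceq_dec (peval (fun _ => 1) (S (2 * h)) Y) 0) as [|D]; [assumption|].
      exfalso. apply (Cmult_neq_0 (1 - Y) _) with (2 := D) in A; [assumption|].
      apply Cminus_eq_contra. intros F. apply (Hk (S i)); [lia|]. now symmetry. }
  unfold peval in E. rewrite (Csum_ext _ (fun i => X ^ i)) in E by (intros; ring).
  rewrite E, Cmult_1_l. replace (2 * h)%nat with (h + h)%nat by lia.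
  (* The upper half is reversed so that [w^(i+1)] meets [w^(2h-i)], its inverse. *)
  rewrite Cprod_add, (Cprod_rev (fun i => X - w ^ S (h + i))), <- Cprod_mult.
  apply Cprod_ext. intros i Hi.
  assert (P : w ^ S i <> 0) by now apply Cpow_nz.
  replace (w ^ S (h + (h - 1 - i))) with (/ w ^ S i).
  - field. exact P.
  - transitivity (/ w ^ S i * (w ^ S i * w ^ S (h + (h - 1 - i)))).
    + rewrite <- Cpow_add_r. replace (S i + S (h + (h - 1 - i)))%nat with (S (2 * h)) by lia.
      rewrite H1. ring.
    + field. exact P.
Qed.

Lemma root_unity_pow (N k j : nat) :
  (0 < N)%nat -> e2pi (RtoC (INR k / INR N)) ^ j = e2pi (RtoC (INR (k * j) / INR N)).
Proof.
  intros HN. rewrite e2pi_pow, <- RtoC_mult. f_equal. f_equal. rewrite mult_INR.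
  field. apply not_0_INR. lia.
Qed.

Lemma INR_C_neq0 (n : nat) : (0 < n)%nat -> RtoC (INR n) <> 0.
Proof. intros H E. apply RtoC_inj in E. revert E. apply not_0_INR. lia. Qed.

Lemma sin2i_R_neq0 (t : R) : (0 < t < 1)%R -> sin2i (RtoC t) <> 0.
Proof.
  intros Ht. apply Cmod_neq0. rewrite sin2i_R.
  assert (P : (0 < sin (PI * t))%R) by (apply sin_gt_0; pose proof PI_RGT_0; nra).
  rewrite Rabs_right; lra.
Qed.

(** The quotient of [1 - e(N v)] by [1 - e(v)] is a geometric sum; its factors at the [N]-th roots
    of unity pair up to [sin2i v ^ 2 - sin2i (k/N) ^ 2]. An odd [N] leaves no unpaired root. *)
Lemma sin2i_finite_product (v : C) (h : nat) :
  let N := (2 * h + 1)%nat in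
  sin2i (RtoC (INR N) * v) =
  RtoC (INR N) * sin2i v *
  Cprod (fun k => 1 + - (sin2i v ^ 2 / sin2i (RtoC (INR (S k) / INR N)) ^ 2)) h.
Proof.
  intros N. set (w := e2pi (RtoC (INR 1 / INR N))).
  assert (HN : (0 < INR N)%R) by (apply lt_0_INR; unfold N; lia).
  assert (Hpow : forall j, w ^ j = e2pi (RtoC (INR j / INR N))).
  { intros j. unfold w. rewrite root_unity_pow by (unfold N; lia).
    now rewrite Nat.mul_1_l. }
  assert (HwN : w ^ (2 * h + 1) = 1).
  { rewrite Hpow. fold N. replace (INR N / INR N)%R with (INR 1) by (simpl; field; lra).
    apply e2pi_INR. }
  assert (Hwk : forall k, (0 < k < 2 * h + 1)%nat -> w ^ k <> 1).
  { intros k Hk. rewrite Hpow. apply e2pi_R_neq1.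
    assert (0 < INR k)%R by (apply lt_0_INR; lia).
    assert (INR k < INR N)%R by (apply lt_INR; unfold N; lia).
    split; [now apply Rdiv_lt_0_compat|]. apply Rmult_lt_reg_r with (INR N); [lra|].
    unfold Rdiv. rewrite Rmult_assoc, Rinv_l by lra. lra. }
  set (sk := fun k => sin2i (RtoC (INR (S k) / INR N))).
  assert (Hfac : forall x k, (1 - w ^ S k * e2pi x) * (1 - / w ^ S k * e2pi x)
                   = e2pi x * (sin2i x ^ 2 - sk k ^ 2)).
  { intros x k. unfold sk. rewrite <- sin2i_mul, !sin2i_alt, (Hpow (S k)).
    set (t := RtoC (INR (S k) / INR N)).
    rewrite (e2pi_plus x t), (e2pi_minus x t).
    replace (- e2pi (- ((x + t) / 2)) * (1 - e2pi x * e2pi t) *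
       (- e2pi (- ((x - t) / 2)) * (1 - e2pi x / e2pi t)))
     with (e2pi (- ((x + t) / 2)) * e2pi (- ((x - t) / 2))
           * ((1 - e2pi x * e2pi t) * (1 - e2pi x / e2pi t))) by ring.
    replace (e2pi (- ((x + t) / 2)) * e2pi (- ((x - t) / 2))) with (/ e2pi x)
      by (rewrite <- e2pi_plus, <- e2pi_opp; f_equal; field).
    field. split; apply e2pi_neq0. }
  assert (Hsum : forall x, Csum (fun i => e2pi x ^ i) N
                   = e2pi x ^ h * Cprod (fun k => sin2i x ^ 2 - sk k ^ 2) h).
  { intros x. unfold N. rewrite (geom_sum_factor w h _ HwN Hwk).
    rewrite <- Cprod_const, <- Cprod_mult. apply Cprod_ext. intros; apply Hfac. }
  (* At [x = 0] the geometric sum has the value [N], which evaluates the constant that normalises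
     the product. *)
  assert (HC : RtoC (INR N) = Cprod (fun k => - sk k ^ 2) h).
  { specialize (Hsum 0). rewrite e2pi_0, Cpow_1_l, sin2i_0, Cmult_1_l in Hsum.
    rewrite (Csum_ext _ (fun _ => 1)) in Hsum by (intros; apply Cpow_1_l).
    replace (Csum (fun _ => 1) N) with (RtoC (INR N)) in Hsum.
    - rewrite Hsum. apply Cprod_ext. intros; ring.
    - clear. induction N as [|N IH]; [reflexivity|].
      rewrite S_INR, RtoC_plus, IH. reflexivity. }
  assert (Hsk : forall k, (k < h)%nat -> sk k <> 0).
  { intros k Hk. apply sin2i_R_neq0.
    assert (0 < INR (S k))%R by (apply lt_0_INR; lia).
    assert (INR (S k) < INR N)%R by (apply lt_INR; unfold N; lia).
    split; [now apply Rdiv_lt_0_compat|]. apply Rmult_lt_reg_r with (INR N); [lra|].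
    unfold Rdiv. rewrite Rmult_assoc, Rinv_l by lra. lra. }
  transitivity (sin2i v * Cprod (fun k => sin2i v ^ 2 - sk k ^ 2) h).
  - rewrite !sin2i_alt. rewrite <- e2pi_pow, <- geom_sum, Hsum.
    rewrite <- !sin2i_alt. rewrite e2pi_pow.
    replace (- e2pi (- (RtoC (INR N) * v / 2)) *
      ((1 - e2pi v) * (e2pi (RtoC (INR h) * v) * Cprod (fun k => sin2i v ^ 2 - sk k ^ 2) h)))
     with (- (e2pi (- (RtoC (INR N) * v / 2)) * e2pi (RtoC (INR h) * v)) * (1 - e2pi v)
           * Cprod (fun k => sin2i v ^ 2 - sk k ^ 2) h) by ring.
    rewrite <- e2pi_plus.
    replace (- (RtoC (INR N) * v / 2) + RtoC (INR h) * v) with (- (v / 2)); [now rewrite <- sin2i_alt|].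
    unfold N. rewrite plus_INR, mult_INR, RtoC_plus, RtoC_mult. change (INR 2) with 2%R. change (INR 1) with 1%R. field.
  - rewrite HC. rewrite (Cmult_comm (Cprod _ h) (sin2i v)), <- Cmult_assoc, <- Cprod_mult.
    f_equal. apply Cprod_ext. intros k Hk. fold (sk k). field. now apply Hsk.
Qed.

Lemma Rsum_inv_sq_le (n : nat) : (Rsum (fun k => / INR (S k) ^ 2) n <= 2)%R.
Proof.
  assert (H : forall n, (Rsum (fun k => / INR (S k) ^ 2) (S n) <= 2 - / INR (S n))%R).
  { clear n. intros n. induction n as [|n IH]; [simpl; lra|].
    set (F := fun k => (/ INR (S k) ^ 2)%R) in *.
    change (Rsum F (S (S n))) with (Rsum F (S n) + / INR (S (S n)) ^ 2)%R.
    assert (P : (0 < INR (S n))%R) by (apply lt_0_INR; lia).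
    rewrite (S_INR (S n)) in *. set (x := INR (S n)) in *.
    assert (Q : (/ (x + 1) ^ 2 <= / x - / (x + 1))%R); [|lra].
    replace (/ x - / (x + 1))%R with (/ (x * (x + 1)))%R by (field; lra).
    apply Rinv_le_contravar; nra. }
  destruct n as [|n]; [simpl; lra|]. specialize (H n).
  assert (P : (0 < / INR (S n))%R) by (apply Rinv_0_lt_compat, lt_0_INR; lia). lra.
Qed.

(** From [sin x >= x - x^3/6], where [x <= 2] makes the cubic term at most [2x/3]. *)
Lemma sin_ge_third (x : R) : (0 <= x <= PI / 2)%R -> (x / 3 <= sin x)%R.
Proof.
  intros Hx. pose proof PI_4 as P4. pose proof PI_RGT_0.
  destruct (sin_bound x 0 ltac:(lra) ltac:(lra)) as [L _].
  eapply Rle_trans; [|exact L]. unfold sin_approx, sin_term; simpl.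
  assert (x <= 2)%R by lra.
  replace (1 * (x * 1 / 1) + -1 * 1 * (x * (x * (x * 1)) / (1 + 1 + 1 + 1 + 1 + 1)))%R
    with (x - x * (x * x) / 6)%R by field.
  nra.
Qed.

(** Euler's product: the finite product at [u/N] with [N = 2h+1] tending to infinity, justified by
    [Clim_Cprod_dominated]. The majorant [A^2/k^2] comes from an upper bound [A/N] on the numerators
    and a lower bound [k/N] on the denominators. *)
Lemma sin2i_product (u : C) :
  Clim (fun n => two_pi_i * u * Cprod (fun k => 1 - u ^ 2 / RtoC (INR (S k)) ^ 2) n) (sin2i u).
Proof.
  destruct (Ceq_dec u 0) as [->|Hu].
  { apply (Clim_ext (fun _ => 0)); [intros; ring|]. rewrite sin2i_0. apply Clim_const. }
  set (f := fun h => (2 * h + 1)%nat).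
  assert (Hf : forall h, (h < f h)%nat) by (unfold f; lia).
  pose proof (Clim_scaled_sin2i u f Hf) as HL.
  assert (Pu : two_pi_i * u <> 0) by (apply Cmult_neq_0; [apply two_pi_i_neq0|exact Hu]).
  set (v := fun h k => - (sin2i (u / RtoC (INR (f h))) ^ 2 / sin2i (RtoC (INR (S k) / INR (f h))) ^ 2)).
  assert (H1 : Clim (fun h => Cprod (fun k => 1 + v h k) h) (sin2i u / (two_pi_i * u))).
  { pose proof (Clim_div _ _ _ _ Pu (Clim_const (sin2i u)) HL) as HD.
    (* Once [N sin2i(u/N)] is closer to its nonzero limit than the modulus of that limit, it is
       nonzero and may be divided out. *)
    destruct (HL (Cmod (two_pi_i * u))) as [N HN]; [now apply Cmod_pos|].
    apply (Clim_ext_ev _ _ _ N) with (2 := HD). intros h Hh. specialize (HN h Hh).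
    pose proof (sin2i_finite_product (u / RtoC (INR (f h))) h) as E. fold (f h) in E. cbv zeta in E.
    assert (F0 : RtoC (INR (f h)) <> 0) by (apply INR_C_neq0; specialize (Hf h); lia).
    replace (RtoC (INR (f h)) * (u / RtoC (INR (f h)))) with u in E by (field; exact F0).
    fold (v h) in E. rewrite E. unfold v.
    set (P := Cprod _ h). set (Q := RtoC (INR (f h)) * sin2i (u / RtoC (INR (f h)))) in *.
    assert (Q <> 0).
    { intros Z. rewrite Z in HN. replace (0 - two_pi_i * u) with (- (two_pi_i * u)) in HN by ring.
      rewrite Cmod_opp in HN. lra. }
    field. now apply Cmult_neq0_r in H as H'. }
  set (A := (2 * PI * Cmod u * exp (3 * PI * Cmod u))%R).
  pose proof PI_RGT_0 as HP. pose proof (Cmod_ge_0 u) as Hu0.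
  assert (HA : (0 <= A)%R).
  { unfold A. apply Rmult_le_pos; [nra|left; apply exp_pos]. }
  assert (H2 : Clim (Cprod (fun k => 1 + - (u ^ 2 / RtoC (INR (S k)) ^ 2))) (sin2i u / (two_pi_i * u))).
  { apply (Clim_Cprod_dominated v _ (fun k => A ^ 2 * / INR (S k) ^ 2)%R (A ^ 2 * 2)%R).
    - intros h k Hk. unfold v.
      assert (HN : (0 < INR (f h))%R) by (apply lt_0_INR; specialize (Hf h); lia).
      assert (HN1 : (1 <= INR (f h))%R) by (apply (le_INR 1); specialize (Hf h); lia).
      assert (Hk0 : (0 < INR (S k))%R) by (apply lt_0_INR; lia).
      assert (Hk2 : (2 * INR (S k) <= INR (f h))%R).
      { change 2%R with (INR 2). rewrite <- mult_INR. apply le_INR. unfold f. lia. }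
      set (N := INR (f h)) in *. set (K := INR (S k)) in *.
      assert (Ht : (0 < K / N <= 1 / 2)%R).
      { split; [now apply Rdiv_lt_0_compat|]. apply Rmult_le_reg_r with N; [lra|].
        unfold Rdiv. rewrite Rmult_assoc, Rinv_l by lra. lra. }
      assert (B1 : (Cmod (sin2i (u / RtoC N)) <= A / N)%R).
      { eapply Rle_trans; [apply sin2i_le|].
        rewrite Cmod_div by (intros E; apply RtoC_inj in E; lra).
        rewrite Cmod_R, Rabs_right by lra. unfold A.
        replace (2 * PI * Cmod u * exp (3 * PI * Cmod u) / N)%R
          with (2 * PI * (Cmod u / N) * exp (3 * PI * Cmod u))%R by (field; lra).
        assert (D : (Cmod u / N <= Cmod u)%R).
        { apply Rmult_le_reg_r with N; [lra|].
          unfold Rdiv. rewrite Rmult_assoc, Rinv_l by lra. nra. }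
        assert (0 <= Cmod u / N)%R by (apply Rdiv_le_0_compat; lra).
        apply Rmult_le_compat_l; [apply Rmult_le_pos; nra|].
        apply exp_le_compat. apply Rmult_le_compat_l; lra. }
      (* Since [k <= h], the angle [pi k/N] stays below [pi/2], where the sine is at least a third
         of its argument; and [2 pi/3 > 1]. *)
      assert (B2 : (K / N <= Cmod (sin2i (RtoC (K / N))))%R).
      { rewrite sin2i_R.
        pose proof (sin_ge_third (PI * (K / N)) ltac:(split; nra)) as S3.
        assert (3 < PI)%R by (pose proof PI2_3_2; lra).
        rewrite Rabs_right by nra. nra. }
      assert (Ns : sin2i (RtoC (K / N)) <> 0) by (apply Cmod_neq0; lra).
      rewrite Cmod_opp, Cmod_div by now apply Cpow_nz.
      rewrite !Cmod_pow.
      apply Rle_trans with ((A / N) ^ 2 / (K / N) ^ 2)%R.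
      + unfold Rdiv at 1 2. apply Rmult_le_compat.
        * apply pow2_ge_0.
        * left. apply Rinv_0_lt_compat, pow_lt. lra.
        * apply pow_incr. split; [apply Cmod_ge_0|exact B1].
        * apply Rinv_le_contravar; [apply pow_lt; lra|]. apply pow_incr. lra.
      + right. field. lra.
    - intros n. rewrite Rsum_scal. apply Rmult_le_compat_l; [apply pow2_ge_0|apply Rsum_inv_sq_le].
    - intros k. apply Rmult_le_pos; [apply pow2_ge_0|].
      left. apply Rinv_0_lt_compat, pow_lt, lt_0_INR. lia.
    - intros k. unfold v. apply Clim_opp.
      assert (K0 : RtoC (INR (S k)) <> 0) by (apply INR_C_neq0; lia).
      pose proof (Clim_scaled_sin2i (RtoC (INR (S k))) f Hf) as HK.
      assert (HKn : two_pi_i * RtoC (INR (S k)) <> 0)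
        by (apply Cmult_neq_0; [apply two_pi_i_neq0|exact K0]).
      assert (HQ : Clim (fun h => sin2i (u / RtoC (INR (f h))) / sin2i (RtoC (INR (S k) / INR (f h))))
                     (u / RtoC (INR (S k)))).
      { replace (u / RtoC (INR (S k))) with (two_pi_i * u / (two_pi_i * RtoC (INR (S k))))
          by (field; split; [exact K0|apply two_pi_i_neq0]).
        apply (Clim_ext_ev _ _ _ (S k)) with (2 := Clim_div _ _ _ _ HKn HL HK).
        intros h Hh. assert (HN : (0 < INR (f h))%R) by (apply lt_0_INR; specialize (Hf h); lia).
        rewrite <- RtoC_div by lra. field. split.
        - apply sin2i_R_neq0. assert (0 < INR (S k))%R by (apply lt_0_INR; lia).
          assert (INR (S k) < INR (f h))%R by (apply lt_INR; unfold f; lia).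
          split; [now apply Rdiv_lt_0_compat|]. apply Rmult_lt_reg_r with (INR (f h)); [lra|].
          unfold Rdiv. rewrite Rmult_assoc, Rinv_l by lra. lra.
        - apply INR_C_neq0. specialize (Hf h); lia. }
      pose proof (Clim_mult _ _ _ _ HQ HQ) as HQ2.
      replace (u ^ 2 / RtoC (INR (S k)) ^ 2) with (u / RtoC (INR (S k)) * (u / RtoC (INR (S k))))
        by (field; exact K0).
      refine (Clim_ext_ev _ _ _ (S k) _ HQ2). intros h Hh. cbv beta.
      assert (HN : (0 < INR (f h))%R) by (apply lt_0_INR; specialize (Hf h); lia).
      field. apply sin2i_R_neq0. assert (0 < INR (S k))%R by (apply lt_0_INR; lia).
      assert (INR (S k) < INR (f h))%R by (apply lt_INR; unfold f; lia).
      split; [now apply Rdiv_lt_0_compat|]. apply Rmult_lt_reg_r with (INR (f h)); [lra|].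
      unfold Rdiv. rewrite Rmult_assoc, Rinv_l by lra. lra.
    - exact H1. }
  apply (Clim_scal (two_pi_i * u)) in H2.
  replace (two_pi_i * u * (sin2i u / (two_pi_i * u))) with (sin2i u) in H2
    by (field; split; [exact Hu|apply two_pi_i_neq0]).
  exact H2.
Qed.

(** * The theta function as a product over a lattice *)

Lemma Cprod_cexp (f : nat -> C) (n : nat) : Cprod (fun i => cexp (f i)) n = cexp (Csum f n).
Proof.
  induction n as [|n IH]; simpl; [now rewrite cexp_0|]. now rewrite IH, cexp_plus.
Qed.

Lemma Clim_cexp (u : nat -> C) (l : C) : Clim u l -> Clim (fun n => cexp (u n)) (cexp l).
Proof.
  intros H eps He.
  pose proof (exp_pos 1) as E1. pose proof (Cmod_pos _ (cexp_neq0 l)) as El.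
  set (d := Rmin 1 (eps / (2 * Cmod (cexp l) * exp 1))).
  assert (Hd : (0 < d)%R).
  { apply Rmin_glb_lt; [lra|]. apply Rdiv_lt_0_compat; [lra|]. apply Rmult_lt_0_compat; lra. }
  destruct (H d Hd) as [N HN]. exists N. intros n Hn. specialize (HN n Hn).
  replace (cexp (u n) - cexp l) with (cexp l * (cexp (u n - l) - 1)).
  2:{ replace (cexp (u n)) with (cexp l * cexp (u n - l)); [ring|].
      rewrite <- cexp_plus. f_equal. ring. }
  rewrite Cmod_mult. set (x := Cmod (u n - l)) in *.
  assert (x0 : (0 <= x)%R) by apply Cmod_ge_0.
  assert (x1 : (x < 1)%R) by (eapply Rlt_le_trans; [exact HN|apply Rmin_l]).
  assert (x2 : (x < eps / (2 * Cmod (cexp l) * exp 1))%R)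
    by (eapply Rlt_le_trans; [exact HN|apply Rmin_r]).
  pose proof (cexp_sub_1_le (u n - l)) as B. fold x in B.
  assert (B' : (x * exp x <= x * exp 1)%R)
    by (apply Rmult_le_compat_l; [lra|apply exp_le_compat; lra]).
  apply Rle_lt_trans with (Cmod (cexp l) * (x * exp 1))%R.
  { apply Rmult_le_compat_l; lra. }
  apply (Rmult_lt_compat_r (Cmod (cexp l) * exp 1)) in x2; [|nra].
  replace (eps / (2 * Cmod (cexp l) * exp 1) * (Cmod (cexp l) * exp 1))%R with (eps / 2)%R in x2
    by (field; lra).
  lra.
Qed.

Lemma Clim_Cprod (f : nat -> nat -> C) (g : nat -> C) (n : nat) :
  (forall i, Clim (fun k => f k i) (g i)) -> Clim (fun k => Cprod (f k) n) (Cprod g n).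
Proof.
  intros H. induction n as [|n IH]; simpl; [apply Clim_const|]. now apply Clim_mult.
Qed.

(** The separated majorant [A a_m a_n] treats rows and columns alike, so the product of the row
    limits agrees with the limit over square boxes. The latter is symmetric under transposition,
    which is what the inversion of [tau] needs. The final estimate makes [theta] nonzero near 0. *)
Lemma double_product (u : nat -> nat -> C) (a : nat -> R) (S A : R) :
  (forall i, (0 <= a i)%R) -> (forall n, (Rsum a n <= S)%R) -> (0 <= A)%R ->
  (forall m n, (Cmod (u m n) <= A * (a m * a n))%R) ->
  let A2 := (exp (A * (S * S)) * (A * S))%R in
  exists r R,
    (forall m, Clim (Cprod (fun n => 1 + u m n)) (r m)) /\
    Clim (Cprod r) R /\
    Clim (fun K => Cprod (fun m => Cprod (fun n => 1 + u m n) K) K) R /\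
    (Cmod (R - 1) <= exp (A2 * S) * (A2 * S))%R.
Proof.
  intros Ha HS HA Hu A2.
  assert (S0 : (0 <= S)%R) by (specialize (HS O); simpl in HS; lra).
  assert (aS : forall i, (a i <= S)%R).
  { intros i. specialize (HS (Datatypes.S i)). simpl in HS.
    pose proof (Rsum_ge0 a i (fun j _ => Ha j)). lra. }
  assert (A20 : (0 <= A2)%R).
  { unfold A2. apply Rmult_le_pos; [left; apply exp_pos|nra]. }
  (* Here [c] is the weight of a fixed row or column: the whole line deviates from 1 by at most a
     constant times [c], so the lines again form a convergent product. *)
  assert (line : forall (v : nat -> C) (c : R), (0 <= c <= S)%R ->
     (forall i, (Cmod (v i) <= A * (a i * c))%R) ->
     forall N, (Cmod (Cprod (fun i => 1 + v i)%C N - 1) <= A2 * c)%R).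
  { intros v c Hc Hv N.
    pose proof (Cprod_diff_le v (fun i => A * c * a i)%R (A * (S * S))%R 0 N) as L.
    simpl Cprod in L. simpl (Rsum _ 0) in L.
    eapply Rle_trans; [apply L|].
    - intros i _. specialize (Hv i). lra.
    - intros k _. rewrite Rsum_scal. specialize (HS k).
      pose proof (Rsum_ge0 a k (fun j _ => Ha j)).
      assert (c * Rsum a k <= S * S)%R by (apply Rmult_le_compat; lra). nra.
    - lia.
    - rewrite Rsum_scal, Rminus_0_r. unfold A2. rewrite !Rmult_assoc.
      apply Rmult_le_compat_l; [left; apply exp_pos|]. apply Rmult_le_compat_l; [exact HA|].
      specialize (HS N). pose proof (Rsum_ge0 a N (fun j _ => Ha j)). nra. }
  set (P := fun M N => Cprod (fun m => Cprod (fun n => 1 + u m n) N) M).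
  assert (D : forall (f : nat -> C), (forall i, (Cmod (f i - 1) <= A2 * a i)%R) ->
    forall m n, (m <= n)%nat ->
     (Cmod (Cprod f n - Cprod f m) <= exp (A2 * S) * A2 * (Rsum a n - Rsum a m))%R).
  { intros f Hf m n Hmn.
    pose proof (Cprod_diff_le (fun i => f i - 1) (fun i => A2 * a i)%R (A2 * S)%R m n) as L.
    cbv beta in L. rewrite (Cprod_ext (fun i => 1 + (f i - 1)) f n) in L by (intros; ring).
    rewrite (Cprod_ext (fun i => 1 + (f i - 1)) f m) in L by (intros; ring).
    eapply Rle_trans; [apply L; auto|].
    - intros k _. rewrite Rsum_scal. apply Rmult_le_compat_l; auto.
    - rewrite !Rsum_scal. right. ring. }
  assert (Drow : forall N M M', (M <= M')%nat ->
     (Cmod (P M' N - P M N) <= exp (A2 * S) * A2 * (Rsum a M' - Rsum a M))%R).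
  { intros N M M' HM. unfold P. apply D; [|exact HM]. intros m.
    apply line; [split; auto|]. intros n. rewrite (Rmult_comm (a n)). apply Hu. }
  assert (Dcol : forall M N N', (N <= N')%nat ->
     (Cmod (P M N' - P M N) <= exp (A2 * S) * A2 * (Rsum a N' - Rsum a N))%R).
  { intros M N N' HN. unfold P. rewrite (Cprod_swap _ M N'), (Cprod_swap _ M N).
    apply D; [|exact HN]. intros n. apply line; [split; auto|]. intros m. apply Hu. }
  set (E := (exp (A2 * S) * A2)%R).
  assert (E0 : (0 <= E)%R) by (unfold E; apply Rmult_le_pos; [left; apply exp_pos|exact A20]).
  (* The box [K x K] grows to [M x N] by adding rows first and columns afterwards; each move costs
     at most [E] times a tail of the series of [a]. *)
  assert (tail : forall eps : R, (0 < eps)%R -> exists K, forall M N, (K <= M)%nat -> (K <= N)%nat ->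
     (Cmod (P M N - P K K) < eps)%R).
  { intros eps He.
    destruct (Rsum_bounded_Cauchy a S Ha HS (eps / (2 * E + 1))%R) as [K HK].
    { apply Rdiv_lt_0_compat; lra. }
    exists K. intros M N HM HN.
    pose proof (Drow K K M HM) as R1. pose proof (Dcol M K N HN) as R2. fold E in R1, R2.
    pose proof (Cmod_sub_triangle (P M N) (P M K) (P K K)) as T.
    pose proof (HK M HM) as K1. pose proof (HK N HN) as K2.
    assert (K3 : (E * (Rsum a M - Rsum a K) <= E * (eps / (2 * E + 1)))%R)
      by (apply Rmult_le_compat_l; lra).
    assert (K4 : (E * (Rsum a N - Rsum a K) <= E * (eps / (2 * E + 1)))%R)
      by (apply Rmult_le_compat_l; lra).
    assert (K5 : (2 * (E * (eps / (2 * E + 1))) < eps)%R).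
    { replace (2 * (E * (eps / (2 * E + 1))))%R with (eps * (2 * E / (2 * E + 1)))%R by (field; lra).
      assert (2 * E / (2 * E + 1) < 1)%R.
      { apply Rmult_lt_reg_r with (2 * E + 1)%R; [lra|].
        unfold Rdiv. rewrite Rmult_assoc, Rinv_l by lra. lra. }
      nra. }
    lra. }
  assert (Hr : forall m, exists l, Clim (Cprod (fun n => 1 + u m n)) l).
  { intros m. destruct (Clim_Cprod_abs (u m) (fun n => A * a m * a n)%R (A * a m * S)%R) as [l [Hl _]].
    - intros n. specialize (Hu m n). lra.
    - intros n. rewrite Rsum_scal. apply Rmult_le_compat_l; [|apply HS].
      apply Rmult_le_pos; auto.
    - exists l; exact Hl. }
  assert (Hr' : forall m, Clim (Cprod (fun n => 1 + u m n)) (limC (Cprod (fun n => 1 + u m n)))).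
  { intros m. destruct (Hr m) as [l Hl]. exact (Clim_limC _ _ Hl). }
  set (r := fun m => limC (Cprod (fun n => 1 + u m n))).
  assert (HP : forall M, Clim (fun N => P M N) (Cprod r M)).
  { intros M. unfold P. apply (Clim_Cprod (fun N m => Cprod (fun n => 1 + u m n) N)). exact Hr'. }
  destruct (Clim_of_Cauchy (fun K => P K K)) as [R HR].
  { intros eps He. destruct (tail (eps / 2)%R) as [K HK]; [lra|]. exists K. intros m n Hm Hn.
    pose proof (HK m m Hm Hm). pose proof (HK n n Hn Hn).
    pose proof (Cmod_sub_triangle (P m m) (P K K) (P n n)).
    rewrite (Cmod_minus_sym (P K K)) in H1. lra. }
  exists r, R. split; [exact Hr'|]. split; [|split; [exact HR|]].
  - intros eps He. destruct (tail (eps / 4)%R) as [K HK]; [lra|]. exists K. intros M HM.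
    assert (B1 : (Cmod (Cprod r M - P K K) <= eps / 4)%R).
    { apply (Clim_Cmod_le (fun N => P M N - P K K) _ _ K).
      - apply Clim_minus; [apply HP|apply Clim_const].
      - intros N HN. left. now apply HK. }
    assert (B2 : (Cmod (R - P K K) <= eps / 4)%R).
    { apply (Clim_Cmod_le (fun N => P N N - P K K) _ _ K).
      - apply Clim_minus; [apply HR|apply Clim_const].
      - intros N HN. left. now apply HK. }
    pose proof (Cmod_sub_triangle (Cprod r M) (P K K) R).
    rewrite (Cmod_minus_sym (P K K)) in H. lra.
  - apply (Clim_Cmod_le (fun N => P N N - 1) _ _ O).
    + apply Clim_minus; [apply HR|apply Clim_const].
    + intros N _. pose proof (Drow N 0%nat N ltac:(lia)) as B. fold E in B.
      change (P 0%nat N) with (RtoC 1) in B. simpl (Rsum a 0) in B.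
      eapply Rle_trans; [exact B|]. unfold E. rewrite Rmult_assoc.
      apply Rmult_le_compat_l; [left; apply exp_pos|]. apply Rmult_le_compat_l; [exact A20|].
      specialize (HS N). lra.
Qed.

(** * Lattice points and Weierstrass factors *)

Definition cweight (m : nat) : R := match m with O => 1 | S _ => / INR m ^ 2 end.

Lemma cweight_bounds (m : nat) : (0 <= cweight m <= 1)%R.
Proof.
  destruct m as [|m]; unfold cweight; [lra|].
  assert (1 <= INR (S m))%R by (apply (le_INR 1); lia).
  assert (1 <= INR (S m) ^ 2)%R by nra.
  split; [left; apply Rinv_0_lt_compat; lra|]. rewrite <- Rinv_1. apply Rinv_le_contravar; lra.
Qed.

Lemma Rsum_cweight_le (n : nat) : (Rsum cweight n <= 3)%R.
Proof.
  destruct n as [|n]; [simpl; lra|]. rewrite Rsum_shift. change (cweight 0) with 1%R.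
  pose proof (Rsum_inv_sq_le n). unfold cweight. lra.
Qed.

Definition lat (tau : C) (x y : R) : C := RtoC x * tau + RtoC y.

(** With [s] and [t] the real and imaginary parts of [tau], this is what
    [y^2 <= 2 (x s + y)^2 + 2 x^2 s^2], multiplied by [t^2], yields in [lat_lower]. *)
Definition lat_const (tau : C) : R := (Im tau ^ 2 / (2 * Im tau ^ 2 + 1 + 2 * Re tau ^ 2))%R.

Lemma lat_const_pos (tau : C) : upper_half tau -> (0 < lat_const tau)%R.
Proof. unfold upper_half, lat_const. intros H. apply Rdiv_lt_0_compat; nra. Qed.

Lemma lat_lower (tau : C) (x y : R) : upper_half tau ->
  (lat_const tau * (x ^ 2 + y ^ 2) <= Cmod (lat tau x y) ^ 2)%R.
Proof.
  unfold upper_half. intros Ht. rewrite Cmod2_alt. unfold lat.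
  rewrite re_plus, im_plus, re_scal_l, im_scal_l, re_RtoC, im_RtoC.
  unfold lat_const. set (t := Im tau) in *. set (s := Re tau).
  set (D := (2 * t ^ 2 + 1 + 2 * s ^ 2)%R).
  assert (HD : (0 < D)%R) by (unfold D; nra).
  apply Rmult_le_reg_r with D; [exact HD|].
  replace (t ^ 2 / D * (x ^ 2 + y ^ 2) * D)%R with (t ^ 2 * (x ^ 2 + y ^ 2))%R by (field; lra).
  unfold D.
  assert (H1 : (y ^ 2 <= 2 * (x * s + y) ^ 2 + 2 * x ^ 2 * s ^ 2)%R).
  { assert (0 <= (y + 2 * (x * s)) ^ 2)%R by apply pow2_ge_0. nra. }
  assert (H2 : (t ^ 2 * y ^ 2 <= t ^ 2 * (2 * (x * s + y) ^ 2 + 2 * x ^ 2 * s ^ 2))%R)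
    by (apply Rmult_le_compat_l; [apply pow2_ge_0|exact H1]).
  assert (0 <= (x * s + y) ^ 2 * (1 + 2 * s ^ 2))%R by (apply Rmult_le_pos; [apply pow2_ge_0|nra]).
  assert (0 <= (x * t * t) ^ 2)%R by apply pow2_ge_0.
  replace (x * t + 0)%R with (x * t)%R by ring.
  replace (((x * s + y) ^ 2 + (x * t) ^ 2) * (2 * t ^ 2 + 1 + 2 * s ^ 2))%R
    with (t ^ 2 * x ^ 2 + t ^ 2 * (2 * (x * s + y) ^ 2 + 2 * x ^ 2 * s ^ 2)
          + (x * s + y) ^ 2 * (1 + 2 * s ^ 2) + 2 * (x * t * t) ^ 2)%R by ring.
  lra.
Qed.

Lemma lat_neq0 (tau : C) (x y : R) : upper_half tau -> (0 < x ^ 2 + y ^ 2)%R -> lat tau x y <> 0.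
Proof.
  intros Ht H E. pose proof (lat_lower tau x y Ht) as L. rewrite E, Cmod_0 in L.
  pose proof (lat_const_pos tau Ht). nra.
Qed.

(** Brings the decay [w^(-4)] into the separated form that [double_product] asks for. The value 1 of
    [cweight] at 0 accounts for the two axes. *)
Lemma inv_sq_le_cweight (m n : nat) : (m + n <> 0)%nat ->
  (/ (INR m ^ 2 + INR n ^ 2) ^ 2 <= cweight m * cweight n)%R.
Proof.
  intros H. destruct m as [|m], n as [|n]; [lia| | |]; unfold cweight;
    rewrite ?INR_0; try assert (1 <= INR (S m))%R by (apply (le_INR 1); lia);
    try assert (1 <= INR (S n))%R by (apply (le_INR 1); lia);
    try set (x := INR (S m)) in *; try set (y := INR (S n)) in *.
  - rewrite Rmult_1_l. replace (0 ^ 2 + y ^ 2)%R with (y ^ 2)%R by ring.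
    assert (1 <= y ^ 2)%R by nra. apply Rinv_le_contravar; [lra|]. nra.
  - rewrite Rmult_1_r. replace (x ^ 2 + 0 ^ 2)%R with (x ^ 2)%R by ring.
    assert (1 <= x ^ 2)%R by nra. apply Rinv_le_contravar; [lra|]. nra.
  - rewrite <- Rinv_mult. assert (0 < x ^ 2)%R by nra. assert (0 < y ^ 2)%R by nra.
    apply Rinv_le_contravar; [nra|]. nra.
Qed.

(* One representative of each pair +-(m tau + n), +-(m tau - n); the quadrant indexing makes the
   exchange of m and n, i.e. tau -> -1/tau, a transposition. *)
Definition cell_prod (g : C -> C) (tau : C) (m n : nat) : C :=
  match m, n with
  | O, O => 1
  | O, S _ => g (lat tau 0 (INR n))
  | S _, O => g (lat tau (INR m) 0)
  | S _, S _ => g (lat tau (INR m) (INR n)) * g (lat tau (INR m) (- INR n))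
  end.

Definition cell_sum (g : C -> C) (tau : C) (m n : nat) : C :=
  match m, n with
  | O, O => 0
  | O, S _ => g (lat tau 0 (INR n))
  | S _, O => g (lat tau (INR m) 0)
  | S _, S _ => g (lat tau (INR m) (INR n)) + g (lat tau (INR m) (- INR n))
  end.

(** The Weierstrass factor of the pair [w, -w]: odd powers cancel in the pair, so a single
    exponential removes the term of order [w^(-2)]. *)
Definition wfac (z w : C) : C := (1 - z ^ 2 / w ^ 2) * cexp (z ^ 2 / w ^ 2).

Lemma wfac_bound (tau z : C) (m n : nat) (y : R) : upper_half tau -> (m + n <> 0)%nat ->
  (y = INR n \/ y = - INR n)%R ->
  (Cmod (wfac z (lat tau (INR m) y) - 1) <=
   Cmod z ^ 4 / lat_const tau ^ 2 * exp (Cmod z ^ 2 / lat_const tau)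
   * (cweight m * cweight n))%R.
Proof.
  intros Ht H Hy.
  assert (Ey : (y ^ 2 = INR n ^ 2)%R) by (destruct Hy as [->| ->]; ring).
  pose proof (lat_lower tau (INR m) y Ht) as L. rewrite Ey in L.
  pose proof (lat_const_pos tau Ht) as Hd. set (d := lat_const tau) in *.
  set (q := (INR m ^ 2 + INR n ^ 2)%R) in *.
  assert (Hq : (1 <= q)%R).
  { unfold q. destruct m as [|m].
    - assert (1 <= INR n)%R by (apply (le_INR 1); lia). simpl. nra.
    - assert (1 <= INR (S m))%R by (apply (le_INR 1); lia).
      assert (0 <= INR n ^ 2)%R by apply pow2_ge_0. nra. }
  set (w := lat tau (INR m) y) in *.
  assert (W : w <> 0).
  { apply lat_neq0; [exact Ht|]. rewrite Ey. fold q. lra. }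
  set (t := z ^ 2 / w ^ 2).
  assert (Et : Cmod t = (Cmod z ^ 2 / Cmod w ^ 2)%R).
  { unfold t. rewrite Cmod_div by now apply Cpow_nz. now rewrite !Cmod_pow. }
  assert (Bt : (Cmod t <= Cmod z ^ 2 / (d * q))%R).
  { rewrite Et. unfold Rdiv. apply Rmult_le_compat_l; [apply pow2_ge_0|].
    apply Rinv_le_contravar; [nra|exact L]. }
  assert (Z2 : (0 <= Cmod z ^ 2)%R) by apply pow2_ge_0.
  assert (Bt' : (Cmod t <= Cmod z ^ 2 / d)%R).
  { eapply Rle_trans; [exact Bt|]. unfold Rdiv. apply Rmult_le_compat_l; [exact Z2|].
    apply Rinv_le_contravar; nra. }
  unfold wfac. fold t. eapply Rle_trans; [apply weierstrass_factor_le|].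
  pose proof (inv_sq_le_cweight m n H) as C0. fold q in C0.
  apply Rle_trans with ((Cmod z ^ 2 / (d * q)) ^ 2 * exp (Cmod z ^ 2 / d))%R.
  - apply Rmult_le_compat; [apply pow2_ge_0|left; apply exp_pos| |now apply exp_le_compat].
    apply pow_incr. split; [apply Cmod_ge_0|exact Bt].
  - replace ((Cmod z ^ 2 / (d * q)) ^ 2 * exp (Cmod z ^ 2 / d))%R
      with (Cmod z ^ 4 / d ^ 2 * exp (Cmod z ^ 2 / d) * / q ^ 2)%R by (field; lra).
    apply Rmult_le_compat_l; [|exact C0].
    apply Rmult_le_pos; [|left; apply exp_pos].
    apply Rdiv_le_0_compat; [apply pow_le, Cmod_ge_0|nra].
Qed.

(** A cell holds up to two factors, each within [A] times the weight of 1, and [(1 + a)(1 + b) - 1]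
    is at most [2A + A^2] in size. *)
Definition cell_const (tau z : C) : R :=
  let A := (Cmod z ^ 4 / lat_const tau ^ 2 * exp (Cmod z ^ 2 / lat_const tau))%R in
  (2 * A + A ^ 2)%R.

Lemma cell_const_ge0 (tau z : C) : upper_half tau -> (0 <= cell_const tau z)%R.
Proof.
  intros Ht. unfold cell_const. pose proof (lat_const_pos tau Ht).
  assert (0 <= Cmod z ^ 4 / lat_const tau ^ 2 * exp (Cmod z ^ 2 / lat_const tau))%R; [|nra].
  apply Rmult_le_pos; [|left; apply exp_pos].
  apply Rdiv_le_0_compat; [apply pow_le, Cmod_ge_0|nra].
Qed.

Lemma cell_wfac_bound (tau z : C) (m n : nat) : upper_half tau ->
  (Cmod (cell_prod (wfac z) tau m n - 1) <= cell_const tau z * (cweight m * cweight n))%R.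
Proof.
  intros Ht. pose proof (lat_const_pos tau Ht) as Hd.
  pose proof (cweight_bounds m) as Hm. pose proof (cweight_bounds n) as Hn.
  unfold cell_const.
  set (A := (Cmod z ^ 4 / lat_const tau ^ 2 * exp (Cmod z ^ 2 / lat_const tau))%R).
  assert (HA : (0 <= A)%R).
  { unfold A. apply Rmult_le_pos; [|left; apply exp_pos].
    apply Rdiv_le_0_compat; [apply pow_le, Cmod_ge_0|nra]. }
  set (c := (cweight m * cweight n)%R).
  assert (Hc : (0 <= c <= 1)%R) by (unfold c; nra).
  assert (B : forall y, (m + n <> 0)%nat -> (y = INR n \/ y = - INR n)%R ->
     (Cmod (wfac z (lat tau (INR m) y) - 1) <= A * c)%R).
  { intros y H Hy. now apply wfac_bound. }
  assert (Q : (A * c <= (2 * A + A ^ 2) * c)%R) by (apply Rmult_le_compat_r; nra).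
  destruct m as [|m], n as [|n]; unfold cell_prod.
  - replace (1 - 1) with (RtoC 0) by ring. rewrite Cmod_0. nra.
  - eapply Rle_trans; [apply (B (INR (S n))); [lia|auto]|exact Q].
  - eapply Rle_trans; [apply (B (INR 0)); [lia|auto]|exact Q].
  - pose proof (B (INR (S n)) ltac:(lia) ltac:(auto)) as B1.
    pose proof (B (- INR (S n))%R ltac:(lia) ltac:(auto)) as B2.
    set (p := wfac z (lat tau (INR (S m)) (INR (S n)))) in *.
    set (p' := wfac z (lat tau (INR (S m)) (- INR (S n)))) in *.
    replace (p * p' - 1) with ((p - 1) + (p' - 1) + (p - 1) * (p' - 1)) by ring.
    eapply Rle_trans; [apply Cmod_triangle|].
    eapply Rle_trans; [apply Rplus_le_compat_r, Cmod_triangle|]. rewrite Cmod_mult.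
    pose proof (Cmod_ge_0 (p - 1)). pose proof (Cmod_ge_0 (p' - 1)).
    assert (Cmod (p - 1) * Cmod (p' - 1) <= A * c * (A * c))%R by (apply Rmult_le_compat; lra).
    assert (A * c * (A * c) <= A ^ 2 * c)%R.
    { replace (A * c * (A * c))%R with (A ^ 2 * c * c)%R by ring.
      assert (0 <= A ^ 2 * c)%R by (apply Rmult_le_pos; [apply pow2_ge_0|lra]). nra. }
    lra.
Qed.

Lemma Clim_0_of_inv (u : nat -> C) (c : R) :
  (0 <= c)%R -> (forall n, (Cmod (u n) <= c / INR (S n))%R) -> Clim u 0.
Proof.
  intros Hc H. apply (Clim_le_real _ _ (fun n => c * / INR (S n))%R).
  - replace (Finite 0) with (Rbar_mult (Finite c) (Finite 0)) by (simpl; f_equal; ring).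
    apply is_lim_seq_scal_l, is_lim_seq_inv_INR_S.
  - intros n. replace (u n - 0) with (u n) by ring. apply H.
Qed.

(* [1/(w^2 - 1/4)], which telescopes along a row and differs from [1/w^2] by O(w^-4). *)
Definition tel (w : C) : C := / (w - 1 / 2) - / (w + 1 / 2).

Lemma RtoC_half : RtoC (1 / 2) = 1 / 2.
Proof. rewrite RtoC_div by lra. reflexivity. Qed.

Lemma lat_minus_half (tau : C) (x y : R) : lat tau x y - 1 / 2 = lat tau x (y - 1 / 2).
Proof. unfold lat. rewrite RtoC_minus, RtoC_half. ring. Qed.

Lemma lat_plus_half (tau : C) (x y : R) : lat tau x y + 1 / 2 = lat tau x (y + 1 / 2).
Proof. unfold lat. rewrite RtoC_plus, RtoC_half. ring. Qed.

Lemma tel_row_sum (tau : C) (m N : nat) : upper_half tau ->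
  Csum (cell_sum tel tau (S m)) (S N) =
  / lat tau (INR (S m)) (- (INR N + 1 / 2)) - / lat tau (INR (S m)) (INR N + 1 / 2).
Proof.
  intros Ht. induction N as [|N IH].
  - unfold Csum, cell_sum, tel. rewrite lat_minus_half, lat_plus_half.
    rewrite INR_0. replace (0 - 1 / 2)%R with (- (0 + 1 / 2))%R by ring. ring.
  - change (Csum (cell_sum tel tau (S m)) (S (S N)))
      with (Csum (cell_sum tel tau (S m)) (S N) + cell_sum tel tau (S m) (S N)).
    rewrite IH. unfold cell_sum, tel. rewrite !lat_minus_half, !lat_plus_half.
    rewrite (S_INR N).
    replace (INR N + 1 - 1 / 2)%R with (INR N + 1 / 2)%R by field.
    replace (- (INR N + 1) + 1 / 2)%R with (- (INR N + 1 / 2))%R by field.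
    replace (- (INR N + 1) - 1 / 2)%R with (- (INR N + 1 + 1 / 2))%R by field.
    ring.
Qed.

Lemma le_of_sq_le (a b : R) : (0 <= b)%R -> (a ^ 2 <= b ^ 2)%R -> (a <= b)%R.
Proof. intros Hb H. destruct (Rle_lt_dec a b); [assumption|]. nra. Qed.

Lemma lat_inv_le (tau : C) (x y : R) : upper_half tau -> (0 < Rabs y)%R ->
  (Cmod (/ lat tau x y) <= / sqrt (lat_const tau) / Rabs y)%R.
Proof.
  intros Ht Hy. pose proof (lat_const_pos tau Ht) as Hd.
  assert (Y2 : (Rabs y ^ 2 = y ^ 2)%R) by apply pow2_abs.
  assert (x2 : (0 <= x ^ 2)%R) by apply pow2_ge_0.
  assert (W : lat tau x y <> 0) by (apply lat_neq0; [exact Ht|nra]).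
  rewrite Cmod_inv by exact W.
  pose proof (sqrt_lt_R0 _ Hd) as Hs. unfold Rdiv. rewrite <- Rinv_mult.
  apply Rinv_le_contravar; [nra|]. apply le_of_sq_le; [apply Cmod_ge_0|].
  eapply Rle_trans; [|apply (lat_lower tau x y Ht)].
  replace ((sqrt (lat_const tau) * Rabs y) ^ 2)%R
    with (sqrt (lat_const tau) * sqrt (lat_const tau) * Rabs y ^ 2)%R by ring.
  rewrite sqrt_sqrt, Y2 by lra. nra.
Qed.

(** The difference is exactly [- (1/4) / (w^2 (w^2 - 1/4))], and moving [y] by a half costs at most
    a factor 4 in the lower bound for the squared modulus. *)
Lemma tel_diff_bound (tau : C) (m n : nat) (y : R) : upper_half tau ->
  (y = INR n \/ y = - INR n)%R ->
  (Cmod (/ lat tau (INR (S m)) y ^ 2 - tel (lat tau (INR (S m)) y))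
   <= / lat_const tau ^ 2 * (cweight (S m) * cweight n))%R.
Proof.
  intros Ht Hy. pose proof (lat_const_pos tau Ht) as Hd.
  assert (Ey : (y ^ 2 = INR n ^ 2)%R) by (destruct Hy as [->| ->]; ring).
  assert (Hn : (forall c, c = 1 / 2 \/ c = - (1 / 2) -> INR n ^ 2 / 4 <= (y + c) ^ 2)%R).
  { intros c Hc.
    assert (Hnn : (n = 0%nat \/ (1 <= n)%nat)%R) by lia.
    destruct Hnn as [->|Hnn].
    - rewrite INR_0. pose proof (pow2_ge_0 (y + c)). lra.
    - apply (le_INR 1) in Hnn. simpl in Hnn.
      destruct Hy as [->| ->]; destruct Hc as [->| ->]; nra. }
  assert (HM : (1 <= INR (S m))%R) by (apply (le_INR 1); lia).
  set (M := INR (S m)) in *.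
  assert (n2 : (0 <= INR n ^ 2)%R) by apply pow2_ge_0.
  set (q := (M ^ 2 + INR n ^ 2)%R). assert (Hq : (1 <= q)%R) by (unfold q; nra).
  set (w := lat tau M y).
  assert (Lw : (lat_const tau * q <= Cmod w ^ 2)%R).
  { unfold q. rewrite <- Ey. now apply lat_lower. }
  assert (L1 : (lat_const tau * (q / 4) <= Cmod (w - 1 / 2)%C ^ 2)%R).
  { unfold w. rewrite lat_minus_half. eapply Rle_trans; [|now apply lat_lower].
    apply Rmult_le_compat_l; [lra|]. specialize (Hn (- (1 / 2))%R ltac:(auto)).
    unfold q. unfold Rminus. nra. }
  assert (L2 : (lat_const tau * (q / 4) <= Cmod (w + 1 / 2)%C ^ 2)%R).
  { unfold w. rewrite lat_plus_half. eapply Rle_trans; [|now apply lat_lower].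
    apply Rmult_le_compat_l; [lra|]. specialize (Hn (1 / 2)%R ltac:(auto)). unfold q. nra. }
  assert (W : w <> 0) by (apply Cmod_neq0; destruct (Cmod_ge_0 w) as [|E]; [assumption|rewrite <- E in Lw; nra]).
  assert (W1 : w - 1 / 2 <> 0).
  { apply Cmod_neq0; destruct (Cmod_ge_0 (w - 1 / 2)) as [|E]; [assumption|rewrite <- E in L1; nra]. }
  assert (W2 : w + 1 / 2 <> 0).
  { apply Cmod_neq0; destruct (Cmod_ge_0 (w + 1 / 2)) as [|E]; [assumption|rewrite <- E in L2; nra]. }
  assert (L12 : (lat_const tau * (q / 4) <= Cmod (w - 1 / 2)%C * Cmod (w + 1 / 2)%C)%R).
  { apply le_of_sq_le; [apply Rmult_le_pos; apply Cmod_ge_0|].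
    rewrite (Rpow_mult_distr (Cmod _)). replace ((lat_const tau * (q / 4)) ^ 2)%R
      with (lat_const tau * (q / 4) * (lat_const tau * (q / 4)))%R by ring.
    apply Rmult_le_compat; try assumption; nra. }
  replace (/ w ^ 2 - tel w) with (- (1 / 4) / (w ^ 2 * ((w - 1 / 2) * (w + 1 / 2)))).
  2:{ unfold tel. field. repeat split; auto.
      - intros E. apply W2. replace (w + 1 / 2) with ((w * 2 + 1) / 2) by field. rewrite E. field.
      - intros E. apply W1. replace (w - 1 / 2) with ((w * 2 - 1) / 2) by field. rewrite E. field. }
  rewrite Cmod_div by (apply Cmult_neq_0; [now apply Cpow_nz|now apply Cmult_neq_0]).
  rewrite Cmod_opp, !Cmod_mult, Cmod_pow.
  replace (Cmod (1 / 4)) with (1 / 4)%R.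
  2:{ replace (1 / 4) with (RtoC (1 / 4)) by (rewrite RtoC_div by lra; reflexivity).
      rewrite Cmod_R, Rabs_right; lra. }
  pose proof (inv_sq_le_cweight (S m) n ltac:(lia)) as C0. fold M q in C0.
  apply Rle_trans with (/ lat_const tau ^ 2 * / q ^ 2)%R.
  - replace (/ lat_const tau ^ 2 * / q ^ 2)%R
      with (1 / 4 / ((lat_const tau * q) * (lat_const tau * (q / 4))))%R by (field; lra).
    unfold Rdiv at 1 3. apply Rmult_le_compat_l; [lra|]. apply Rinv_le_contravar.
    + apply Rmult_lt_0_compat; apply Rmult_lt_0_compat; lra.
    + apply Rmult_le_compat; try assumption; nra.
  - apply Rmult_le_compat_l; [|exact C0]. left. apply Rinv_0_lt_compat. nra.
Qed.

(** This is the weight 2 Eisenstein series summed in Eisenstein's order. In a row with [m > 0] the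
    terms [tel w] have total 0; subtracting them leaves absolutely convergent terms of order
    [w^(-4)] and bounds the row sum by a multiple of [cweight m]. Row 0 is a convergent series of
    inverse squares. *)
Lemma eisenstein_rows (tau : C) : upper_half tau ->
  exists sigma G, (forall m, Clim (Csum (cell_sum (fun w => / w ^ 2) tau m)) (sigma m))
    /\ Clim (Csum sigma) G.
Proof.
  intros Ht. pose proof (lat_const_pos tau Ht) as Hd.
  set (A := (2 * / lat_const tau ^ 2)%R).
  assert (HA : (0 <= A)%R) by (unfold A; assert (0 < / lat_const tau ^ 2)%R by (apply Rinv_0_lt_compat; nra); lra).
  set (f := fun m => Csum (cell_sum (fun w => / w ^ 2) tau m)).
  assert (H0 : exists l, Clim (f 0%nat) l).
  { destruct (Clim_Csum_abs (cell_sum (fun w => / w ^ 2) tau 0) cweight 3) as [l [Hl _]].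
    - intros [|n]; unfold cell_sum; [rewrite Cmod_0; apply cweight_bounds|].
      unfold cweight, lat. rewrite Cmult_0_l, Cplus_0_l.
      rewrite Cmod_inv by (apply Cpow_nz, INR_C_neq0; lia).
      rewrite Cmod_pow, Cmod_R, pow2_abs. lra.
    - apply Rsum_cweight_le.
    - now exists l. }
  assert (HS : forall m, exists l, Clim (f (S m)) l /\ (Cmod l <= A * 3 * cweight (S m))%R).
  { intros m. set (d := fun n => cell_sum (fun w => / w ^ 2) tau (S m) n - cell_sum tel tau (S m) n).
    destruct (Clim_Csum_abs d (fun n => A * cweight (S m) * cweight n)%R (A * cweight (S m) * 3)%R)
      as [l [Hl Bl]].
    - intros n. unfold d. pose proof (cweight_bounds (S m)). pose proof (cweight_bounds n).
      destruct n as [|n]; unfold cell_sum.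
      + pose proof (tel_diff_bound tau m 0 0 Ht ltac:(auto)).
        unfold A. assert (0 < / lat_const tau ^ 2)%R by (apply Rinv_0_lt_compat; nra).
        assert (0 <= / lat_const tau ^ 2 * (cweight (S m) * cweight 0))%R
          by (apply Rmult_le_pos; [lra|apply Rmult_le_pos; lra]).
        lra.
      + pose proof (tel_diff_bound tau m (S n) (INR (S n)) Ht ltac:(auto)) as B1.
        pose proof (tel_diff_bound tau m (S n) (- INR (S n))%R Ht ltac:(auto)) as B2.
        set (w1 := lat tau (INR (S m)) (INR (S n))) in *.
        set (w2 := lat tau (INR (S m)) (- INR (S n))) in *.
        replace (/ w1 ^ 2 + / w2 ^ 2 - (tel w1 + tel w2))
          with ((/ w1 ^ 2 - tel w1) + (/ w2 ^ 2 - tel w2)) by ring.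
        eapply Rle_trans; [apply Cmod_triangle|]. unfold A. lra.
    - intros n. rewrite Rsum_scal. apply Rmult_le_compat_l; [|apply Rsum_cweight_le].
      pose proof (cweight_bounds (S m)). nra.
    - exists l. split; [|lra].
      (* The telescoped row consists of its two ends, which decay like [1/N]. *)
      assert (HT : Clim (Csum (cell_sum tel tau (S m))) 0).
      { assert (HT : Clim (fun N => Csum (cell_sum tel tau (S m)) (S N)) 0).
        { pose proof (sqrt_lt_R0 _ Hd) as Hs.
          assert (Is : (0 < / sqrt (lat_const tau))%R) by now apply Rinv_0_lt_compat.
          apply (Clim_0_of_inv _ (4 * / sqrt (lat_const tau))%R); [lra|].
          intros N. rewrite tel_row_sum by exact Ht.
          unfold Cminus. eapply Rle_trans; [apply Cmod_triangle|]. rewrite Cmod_opp.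
          assert (HN : (0 <= INR N)%R) by apply pos_INR.
          assert (P : (0 < INR N + 1 / 2)%R) by lra.
          pose proof (lat_inv_le tau (INR (S m)) (INR N + 1 / 2) Ht) as B1.
          pose proof (lat_inv_le tau (INR (S m)) (- (INR N + 1 / 2)) Ht) as B2.
          rewrite Rabs_Ropp in B2. rewrite Rabs_right in B1, B2 by lra.
          specialize (B1 P). specialize (B2 P).
          assert (E : (/ sqrt (lat_const tau) / (INR N + 1 / 2) <= 2 * / sqrt (lat_const tau) / INR (S N))%R).
          { unfold Rdiv. rewrite (Rmult_comm 2), Rmult_assoc. apply Rmult_le_compat_l; [lra|].
            replace (2 * / INR (S N))%R with (/ (INR (S N) / 2))%R.
            - apply Rinv_le_contravar; rewrite S_INR; lra.
            - field. rewrite S_INR. lra. }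
          lra. }
        intros eps He. destruct (HT eps He) as [N HN]. exists (S N). intros n Hn.
        destruct n as [|n]; [lia|]. apply HN. lia. }
      pose proof (Clim_plus _ _ _ _ Hl HT) as HH. rewrite Cplus_0_r in HH.
      apply (Clim_ext (fun n => Csum d n + Csum (cell_sum tel tau (S m)) n)); [|exact HH].
      intros n. rewrite <- Csum_plus. apply Csum_ext. intros i _. unfold d. ring. }
  exists (fun m => limC (f m)).
  assert (HL : forall m, Clim (f m) (limC (f m))).
  { intros [|m].
    - destruct H0 as [l Hl]. exact (Clim_limC _ _ Hl).
    - destruct (HS m) as [l [Hl _]]. exact (Clim_limC _ _ Hl). }
  set (c0 := Cmod (limC (f 0%nat))). assert (Hc0 : (0 <= c0)%R) by apply Cmod_ge_0.
  destruct (Clim_Csum_abs (fun m => limC (f m)) (fun m => (c0 + A * 3) * cweight m)%R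
              ((c0 + A * 3) * 3)%R) as [G [HG _]].
  - intros [|m].
    + simpl cweight. fold c0. lra.
    + destruct (HS m) as [l [Hl Bl]]. rewrite (limC_eq _ _ Hl).
      pose proof (cweight_bounds (S m)). eapply Rle_trans; [exact Bl|].
      apply Rmult_le_compat_r; lra.
  - intros n. rewrite Rsum_scal. apply Rmult_le_compat_l; [lra|apply Rsum_cweight_le].
  - exists G. split; [exact HL|exact HG].
Qed.

(** By the sine product this is the product of [1 - z^2/(m tau + n)^2] over all integers [n], that
    is, one row of the lattice together with its negative. *)
Definition theta_row (z tau : C) (m : nat) : C :=
  let w := RtoC (INR m) * tau in
  sin2i (w + z) * sin2i (w - z) / sin2i w ^ 2.

Definition theta_partial (z tau : C) (M : nat) : C :=
  sin2i z / two_pi_i * Cprod (fun m => theta_row z tau (S m)) M.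

(* The odd Jacobi theta function of [z] normalised to have derivative 1 at 0. *)
Definition theta (z tau : C) : C := limC (theta_partial z tau).

Lemma e2pi_Cmod_lt1 (w : C) : upper_half w -> (Cmod (e2pi w) < 1)%R.
Proof.
  unfold upper_half. intros H. rewrite Cmod_e2pi, <- exp_0. apply exp_increasing.
  pose proof PI_RGT_0. nra.
Qed.

Lemma one_minus_neq0 (x : C) : (Cmod x < 1)%R -> 1 - x <> 0.
Proof.
  intros H E. assert (x = 1) by (replace x with (1 - (1 - x)) by ring; rewrite E; ring).
  rewrite H0, Cmod_1 in H. lra.
Qed.

Lemma sin2i_upper_neq0 (w : C) : upper_half w -> sin2i w <> 0.
Proof.
  intros H. rewrite sin2i_alt. apply Cmult_neq_0.
  - intros E. apply (e2pi_neq0 (- (w / 2))).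
    replace (e2pi (- (w / 2))) with (- - e2pi (- (w / 2))) by ring. rewrite E. ring.
  - apply one_minus_neq0, e2pi_Cmod_lt1, H.
Qed.

Lemma upper_half_scal (tau : C) (x : R) : upper_half tau -> (0 < x)%R -> upper_half (RtoC x * tau).
Proof. unfold upper_half. intros H Hx. rewrite im_scal_l. nra. Qed.

Definition sine_partial (u : C) (N : nat) : C := u * Cprod (fun k => 1 - u ^ 2 / RtoC (INR (S k)) ^ 2) N.

Lemma sine_partial_lim (u : C) : Clim (sine_partial u) (sin2i u / two_pi_i).
Proof.
  pose proof (Clim_scal (/ two_pi_i) _ _ (sin2i_product u)) as H.
  replace (sin2i u / two_pi_i) with (/ two_pi_i * sin2i u) by (unfold Cdiv; ring).
  refine (Clim_ext _ _ _ _ H). intros n. unfold sine_partial. field. apply two_pi_i_neq0.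
Qed.

Definition sine_factor (z w : C) : C := 1 - z ^ 2 / w ^ 2.

Lemma row0_lim (z tau : C) :
  Clim (fun N => z * Cprod (cell_prod (sine_factor z) tau 0) N) (sin2i z / two_pi_i).
Proof.
  assert (H : Clim (fun N => z * Cprod (cell_prod (sine_factor z) tau 0) (S N)) (sin2i z / two_pi_i)).
  { refine (Clim_ext _ _ _ _ (sine_partial_lim z)). intros N. unfold sine_partial. rewrite Cprod_shift.
    unfold cell_prod at 1. rewrite Cmult_1_l. f_equal. apply Cprod_ext. intros k _.
    unfold cell_prod, sine_factor, lat. now rewrite Cmult_0_l, Cplus_0_l. }
  intros eps He. destruct (H eps He) as [N HN]. exists (S N). intros n Hn.
  destruct n as [|n]; [lia|]. apply HN. lia.
Qed.

(** The sine products at [w + z], [w - z] and [w] are combined factor by factor: the factors at [k]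
    give [(1 - z^2/(w+k)^2) (1 - z^2/(w-k)^2)], and the leading factors give the cell [n = 0]. *)
Lemma rowS_lim (z tau : C) (m : nat) : upper_half tau ->
  Clim (Cprod (cell_prod (sine_factor z) tau (S m))) (theta_row z tau (S m)).
Proof.
  intros Ht. set (w := RtoC (INR (S m)) * tau).
  assert (HM : (0 < INR (S m))%R) by (apply lt_0_INR; lia).
  assert (Hw : upper_half w) by now apply upper_half_scal.
  assert (Hsw : sin2i w <> 0) by now apply sin2i_upper_neq0.
  assert (Hwr : forall r : R, w + RtoC r <> 0).
  { intros r E. apply (f_equal Im) in E. rewrite im_plus, !im_RtoC in E.
    unfold upper_half in Hw. lra. }
  assert (Hw0 : w <> 0) by (specialize (Hwr 0%R); now rewrite Cplus_0_r in Hwr).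
  pose proof two_pi_i_neq0 as Hpi.
  assert (Hk : forall k : nat, 1 - w ^ 2 / RtoC (INR (S k)) ^ 2 <> 0).
  { intros k E. assert (K0 : RtoC (INR (S k)) <> 0) by (apply INR_C_neq0; lia).
    pose proof (Hwr (INR (S k))) as H1. pose proof (Hwr (- INR (S k))%R) as H2.
    rewrite RtoC_opp in H2. apply (Cmult_neq_0 _ _ H1 H2).
    transitivity (- RtoC (INR (S k)) ^ 2 * (1 - w ^ 2 / RtoC (INR (S k)) ^ 2)).
    - field. exact K0.
    - rewrite E. ring. }
  assert (H : Clim (fun N => Cprod (cell_prod (sine_factor z) tau (S m)) (S N)) (theta_row z tau (S m))).
  { pose proof (sine_partial_lim (w + z)) as P1. pose proof (sine_partial_lim (w - z)) as P2.
    pose proof (sine_partial_lim w) as P3.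
    assert (N3 : sin2i w / two_pi_i * (sin2i w / two_pi_i) <> 0).
    { assert (sin2i w / two_pi_i <> 0); [|now apply Cmult_neq_0].
      unfold Cdiv. apply Cmult_neq_0; [exact Hsw|]. intros E. apply C1_nz.
      rewrite <- (Cinv_r two_pi_i Hpi), E. ring. }
    pose proof (Clim_div _ _ _ _ N3 (Clim_mult _ _ _ _ P1 P2) (Clim_mult _ _ _ _ P3 P3)) as P.
    unfold theta_row. fold w.
    replace (sin2i (w + z) * sin2i (w - z) / sin2i w ^ 2) with
      (sin2i (w + z) / two_pi_i * (sin2i (w - z) / two_pi_i) / (sin2i w / two_pi_i * (sin2i w / two_pi_i)))
      by (field; auto).
    refine (Clim_ext _ _ _ _ P). intros N. unfold sine_partial.
    rewrite Cprod_shift.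
    rewrite (Cprod_ext (fun i => cell_prod (sine_factor z) tau (S m) (S i))
      (fun k => (1 - (w + z) ^ 2 / RtoC (INR (S k)) ^ 2) * (1 - (w - z) ^ 2 / RtoC (INR (S k)) ^ 2) *
         (/ (1 - w ^ 2 / RtoC (INR (S k)) ^ 2) * / (1 - w ^ 2 / RtoC (INR (S k)) ^ 2)))).
    - rewrite !Cprod_mult, Cprod_inv by (intros; apply Hk).
      unfold cell_prod, sine_factor, lat. fold w.
      set (D := Cprod (fun k => 1 - w ^ 2 / RtoC (INR (S k)) ^ 2) N).
      assert (D <> 0) by (apply Cprod_neq0; intros; apply Hk).
      rewrite Cplus_0_r. field. auto.
    - intros k _. unfold cell_prod, sine_factor, lat. fold w.
      assert (K0 : RtoC (INR (S k)) <> 0) by (apply INR_C_neq0; lia).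
      pose proof (Hwr (INR (S k))) as H1. pose proof (Hwr (- INR (S k))%R) as H2.
      specialize (Hk k). rewrite RtoC_opp in *. set (K := RtoC (INR (S k))) in *.
      assert (Hk' : K ^ 2 - w ^ 2 <> 0).
      { intros E. apply Hk. replace (1 - w ^ 2 / K ^ 2) with ((K ^ 2 - w ^ 2) / K ^ 2) by (field; auto).
        rewrite E. field. auto. }
      field. repeat split; auto. }
  intros eps He. destruct (H eps He) as [N HN]. exists (S N). intros n Hn.
  destruct n as [|n]; [lia|]. apply HN. lia.
Qed.

Lemma sine_factor_wfac (z w : C) : sine_factor z w = wfac z w * cexp (- z ^ 2 * / w ^ 2).
Proof.
  unfold sine_factor, wfac. rewrite <- Cmult_assoc, <- cexp_plus.
  replace (z ^ 2 / w ^ 2 + - z ^ 2 * / w ^ 2) with (RtoC 0) by (unfold Cdiv; ring).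
  rewrite cexp_0. ring.
Qed.

Lemma cell_sine_factor (z tau : C) (m n : nat) :
  cell_prod (sine_factor z) tau m n =
  cell_prod (wfac z) tau m n * cexp (- z ^ 2 * cell_sum (fun w => / w ^ 2) tau m n).
Proof.
  unfold cell_prod, cell_sum. destruct m as [|m], n as [|n].
  - rewrite Cmult_0_r, cexp_0. ring.
  - apply sine_factor_wfac.
  - apply sine_factor_wfac.
  - rewrite !sine_factor_wfac, Cmult_plus_distr_l, cexp_plus. ring.
Qed.

Definition box (z tau : C) (K : nat) : C :=
  Cprod (fun m => Cprod (fun n => cell_prod (wfac z) tau m n) K) K.

(** Each [1 - z^2/w^2] is a Weierstrass factor times [exp(- z^2/w^2)]. In the row order the
    exponents add up to [- z^2 G], while the Weierstrass factors converge to a limit [R] that no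
    longer depends on the order. The number [G] is chosen before [z], which lets quasi-periods be
    compared later. *)
Lemma theta_weierstrass (tau : C) : upper_half tau ->
  exists G, forall z, exists R,
    Clim (theta_partial z tau) (z * cexp (- z ^ 2 * G) * R) /\ Clim (box z tau) R /\
    (let A2 := (exp (cell_const tau z * (3 * 3)) * (cell_const tau z * 3))%R in
     Cmod (R - 1) <= exp (A2 * 3) * (A2 * 3))%R.
Proof.
  intros Ht. destruct (eisenstein_rows tau Ht) as [sg [G [Hsg HG]]].
  exists G. intros z.
  destruct (double_product (fun m n => cell_prod (wfac z) tau m n - 1) cweight 3 (cell_const tau z))
    as [r [R [Hr [HR [Hbox HB]]]]].
  - intros i. apply cweight_bounds.
  - apply Rsum_cweight_le.
  - now apply cell_const_ge0.
  - intros m n. now apply cell_wfac_bound.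
  - exists R. split; [|split; [|exact HB]].
    2:{ refine (Clim_ext _ _ _ _ Hbox). intros K. unfold box. apply Cprod_ext. intros m _.
        apply Cprod_ext. intros n _. ring. }
    assert (Hrow : forall m, Clim (Cprod (cell_prod (sine_factor z) tau m)) (r m * cexp (- z ^ 2 * sg m))).
    { intros m.
      pose proof (Clim_mult _ _ _ _ (Hr m) (Clim_cexp _ _ (Clim_scal (- z ^ 2) _ _ (Hsg m)))) as H.
      refine (Clim_ext _ _ _ _ H). intros N. cbv beta.
      rewrite <- Csum_scal, <- Cprod_cexp, <- Cprod_mult. apply Cprod_ext. intros n _.
      rewrite cell_sine_factor. ring. }
    assert (E0 : sin2i z / two_pi_i = z * (r 0%nat * cexp (- z ^ 2 * sg 0%nat))).
    { apply (Clim_unique _ _ _ (row0_lim z tau)). apply Clim_scal, Hrow. }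
    assert (ES : forall m, theta_row z tau (S m) = r (S m) * cexp (- z ^ 2 * sg (S m))).
    { intros m. apply (Clim_unique _ _ _ (rowS_lim z tau m Ht)). apply Hrow. }
    assert (EP : forall M, theta_partial z tau M
                   = z * cexp (- z ^ 2 * Csum sg (S M)) * Cprod r (S M)).
    { intros M. unfold theta_partial.
      rewrite (Cprod_ext _ (fun m => r (S m) * cexp (- z ^ 2 * sg (S m)))) by (intros; apply ES).
      rewrite E0, Cprod_mult, Cprod_cexp, Csum_scal, Csum_shift, (Cprod_shift r).
      rewrite Cmult_plus_distr_l, cexp_plus. ring. }
    refine (Clim_ext _ _ _ (fun M => eq_sym (EP M)) _).
    assert (Sh : forall (u : nat -> C) l, Clim u l -> Clim (fun n => u (S n)) l).
    { intros u l H. apply (Clim_subseq u l S); auto. }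
    apply (Sh (fun M => z * cexp (- z ^ 2 * Csum sg M) * Cprod r M)).
    apply Clim_mult; [|exact HR]. apply Clim_scal, Clim_cexp, Clim_scal, HG.
Qed.

Lemma theta_lim (z tau : C) : upper_half tau -> Clim (theta_partial z tau) (theta z tau).
Proof.
  intros Ht. destruct (theta_weierstrass tau Ht) as [G H]. destruct (H z) as [R [HR _]].
  exact (Clim_limC _ _ HR).
Qed.

Lemma theta_plus_1 (z tau : C) : upper_half tau -> theta (z + 1) tau = - theta z tau.
Proof.
  intros Ht. apply (Clim_unique _ _ _ (theta_lim (z + 1) tau Ht)).
  refine (Clim_ext _ _ _ _ (Clim_opp _ _ (theta_lim z tau Ht))). intros M.
  unfold theta_partial. rewrite sin2i_plus_1.
  replace (- (sin2i z / two_pi_i * Cprod (fun m => theta_row z tau (S m)) M))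
    with (- sin2i z / two_pi_i * Cprod (fun m => theta_row z tau (S m)) M)
    by (field; apply two_pi_i_neq0).
  f_equal. apply Cprod_ext. intros m _. unfold theta_row.
  set (w := RtoC (INR (S m)) * tau).
  replace (w + (z + 1)) with ((w + z) + 1) by ring. rewrite sin2i_plus_1.
  replace (sin2i (w - z)) with (- sin2i (w - (z + 1))).
  - unfold Cdiv. ring.
  - rewrite <- sin2i_plus_1. f_equal. ring.
Qed.

Lemma theta_opp (z tau : C) : upper_half tau -> theta (- z) tau = - theta z tau.
Proof.
  intros Ht. apply (Clim_unique _ _ _ (theta_lim (- z) tau Ht)).
  refine (Clim_ext _ _ _ _ (Clim_opp _ _ (theta_lim z tau Ht))). intros M.
  unfold theta_partial. rewrite sin2i_opp.
  replace (- (sin2i z / two_pi_i * Cprod (fun m => theta_row z tau (S m)) M))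
    with (- sin2i z / two_pi_i * Cprod (fun m => theta_row z tau (S m)) M)
    by (field; apply two_pi_i_neq0).
  f_equal. apply Cprod_ext. intros m _. unfold theta_row.
  set (w := RtoC (INR (S m)) * tau).
  replace (w - - z) with (w + z) by ring. replace (w + - z) with (w - z) by ring.
  unfold Cdiv. ring.
Qed.

Lemma Clim_geom (x : C) : (Cmod x < 1)%R -> Clim (fun n => x ^ n) 0.
Proof.
  intros H. apply (Clim_le_real _ _ (fun n => Cmod x ^ n)%R).
  - apply is_lim_seq_geom. rewrite Rabs_right; [exact H|]. apply Rle_ge, Cmod_ge_0.
  - intros n. replace (x ^ n - 0) with (x ^ n) by ring. rewrite Cmod_pow. lra.
Qed.

Lemma sin2i_asymp (tau c : C) : upper_half tau ->
  Clim (fun M => e2pi (RtoC (INR M) * tau / 2) * sin2i (RtoC (INR M) * tau + c)) (- e2pi (- (c / 2))).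
Proof.
  intros Ht. pose proof (Clim_geom _ (e2pi_Cmod_lt1 tau Ht)) as H.
  pose proof (Clim_minus _ _ _ _ (Clim_scal (e2pi (c / 2)) _ _ H)
                (Clim_const (e2pi (- (c / 2))))) as H2.
  replace (e2pi (c / 2) * 0 - e2pi (- (c / 2))) with (- e2pi (- (c / 2))) in H2 by ring.
  refine (Clim_ext _ _ _ _ H2). intros M. cbv beta. rewrite e2pi_pow. unfold sin2i.
  set (w := RtoC (INR M) * tau).
  rewrite <- e2pi_plus.
  replace (e2pi (w / 2) * (e2pi ((w + c) / 2) - e2pi (- ((w + c) / 2))))
    with (e2pi (w / 2) * e2pi ((w + c) / 2) - e2pi (w / 2) * e2pi (- ((w + c) / 2))) by ring.
  rewrite <- !e2pi_plus. f_equal; [f_equal; field|f_equal; f_equal; field].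
Qed.

(** Adding [tau] moves the sine factor of each row to the next row, so the partial products
    telescope. Only two boundary factors remain, and [sin2i_asymp] gives the limit of their
    ratio. *)
Lemma theta_partial_plus_tau (z tau : C) (M : nat) : upper_half tau ->
  theta_partial (z + tau) tau M * sin2i (RtoC (INR M) * tau + - z) =
  - theta_partial z tau M * sin2i (RtoC (INR M) * tau + (tau + z)).
Proof.
  intros Ht. induction M as [|M IH].
  - unfold theta_partial. simpl Cprod. rewrite INR_0, Cmult_0_l, !Cplus_0_l, sin2i_opp.
    rewrite (Cplus_comm tau z). field. apply two_pi_i_neq0.
  - assert (step : forall z, theta_partial z tau (S M) = theta_partial z tau M * theta_row z tau (S M)).
    { intros z'. unfold theta_partial. simpl Cprod. ring. }
    rewrite !step. unfold theta_row.
    rewrite S_INR, RtoC_plus. set (w := RtoC (INR M) * tau) in *.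
    replace ((RtoC (INR M) + 1) * tau) with (w + tau) by (unfold w; ring).
    replace (w + tau + (z + tau)) with (w + tau + (tau + z)) by ring.
    replace (w + tau - (z + tau)) with (w + - z) by ring.
    replace (w + tau - z) with (w + tau + - z) by ring.
    replace (w + tau + z) with (w + (tau + z)) by ring.
    set (s1 := sin2i (w + - z)) in *. set (s2 := sin2i (w + (tau + z))) in *.
    set (D := sin2i (w + tau)).
    transitivity (theta_partial (z + tau) tau M * s1 * (sin2i (w + tau + (tau + z)) * sin2i (w + tau + - z) / D ^ 2)).
    + unfold Cdiv. ring.
    + rewrite IH. unfold Cdiv. ring.
Qed.

Lemma theta_plus_tau (z tau : C) : upper_half tau ->
  theta (z + tau) tau = - e2pi (- (tau / 2) - z) * theta z tau.
Proof.
  intros Ht.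
  pose proof (Clim_mult _ _ _ _ (theta_lim (z + tau) tau Ht) (sin2i_asymp tau (- z) Ht)) as H1.
  pose proof (Clim_mult _ _ _ _ (Clim_opp _ _ (theta_lim z tau Ht)) (sin2i_asymp tau (tau + z) Ht)) as H2.
  assert (E : theta (z + tau) tau * - e2pi (- (- z / 2)) = - theta z tau * - e2pi (- ((tau + z) / 2))).
  { refine (Clim_unique _ _ _ H1 (Clim_ext _ _ _ _ H2)). intros M.
    pose proof (theta_partial_plus_tau z tau M Ht) as E.
    set (e := e2pi (RtoC (INR M) * tau / 2)).
    transitivity (e * (- theta_partial z tau M * sin2i (RtoC (INR M) * tau + (tau + z)))); [ring|].
    rewrite <- E. ring. }
  replace (- (- z / 2)) with (z / 2) in E by field.
  transitivity (- (theta (z + tau) tau * - e2pi (z / 2)) * e2pi (- (z / 2))).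
  - rewrite e2pi_opp. field. apply e2pi_neq0.
  - rewrite E.
    replace (- (tau / 2) - z) with (- ((tau + z) / 2) + - (z / 2)) by field.
    rewrite (e2pi_plus (- ((tau + z) / 2))). ring.
Qed.

(** In the Weierstrass form the factors [z] and [exp] do not vanish for [z <> 0], and the remaining
    factor lies within [C3 Cmod z] of 1. *)
Lemma theta_small_neq0 (tau : C) : upper_half tau ->
  exists eps : R, (0 < eps)%R /\ forall z : C, z <> 0 -> (Cmod z < eps)%R -> theta z tau <> 0.
Proof.
  intros Ht. destruct (theta_weierstrass tau Ht) as [G H].
  pose proof (lat_const_pos tau Ht) as Hd. set (d := lat_const tau) in *.
  (* [A1], [C1], [C2], [C3] are the successive bounds at [Cmod z = 1]. Each of them carries at least
     one factor [Cmod z], so below radius 1 it is at most [Cmod z] times its value there. *)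
  set (A1 := (exp (1 / d) / d ^ 2)%R).
  assert (HA1 : (0 < A1)%R) by (unfold A1; apply Rdiv_lt_0_compat; [apply exp_pos|nra]).
  set (C1 := (2 * A1 + A1 ^ 2)%R). assert (HC1 : (0 < C1)%R) by (unfold C1; nra).
  set (C2 := (exp (C1 * (3 * 3)) * (C1 * 3))%R).
  assert (HC2 : (0 < C2)%R) by (unfold C2; apply Rmult_lt_0_compat; [apply exp_pos|lra]).
  set (C3 := (exp (C2 * 3) * (C2 * 3))%R).
  assert (HC3 : (0 < C3)%R) by (unfold C3; apply Rmult_lt_0_compat; [apply exp_pos|lra]).
  exists (/ (1 + C3))%R. split; [apply Rinv_0_lt_compat; lra|]. intros z Hz Hs.
  destruct (H z) as [Rz [HR [_ HB]]]. unfold theta. rewrite (limC_eq _ _ HR).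
  set (x := Cmod z) in *. assert (Hx : (0 < x)%R) by now apply Cmod_pos.
  assert (Hx1 : (x < 1)%R).
  { eapply Rlt_trans; [exact Hs|]. rewrite <- Rinv_1. apply Rinv_lt_contravar; lra. }
  assert (Bc : (0 <= cell_const tau z <= x * C1)%R).
  { split; [now apply cell_const_ge0|]. unfold cell_const. fold d. fold x.
    assert (HA : (0 <= x ^ 4 / d ^ 2 * exp (x ^ 2 / d) <= x * A1)%R).
    { split.
      - apply Rmult_le_pos; [|left; apply exp_pos]. apply Rdiv_le_0_compat; [apply pow_le; lra|nra].
      - replace (x * A1)%R with (x / d ^ 2 * exp (1 / d))%R by (unfold A1; field; lra).
        apply Rmult_le_compat.
        + apply Rdiv_le_0_compat; [apply pow_le; lra|nra].
        + left; apply exp_pos.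
        + unfold Rdiv. apply Rmult_le_compat_r; [left; apply Rinv_0_lt_compat; nra|].
          assert (x ^ 2 <= x)%R by nra. assert (0 <= x ^ 2)%R by nra.
          replace (x ^ 4)%R with (x ^ 2 * x ^ 2)%R by ring. nra.
        + apply exp_le_compat. unfold Rdiv. apply Rmult_le_compat_r; [|nra].
          left; now apply Rinv_0_lt_compat. }
    set (A := (x ^ 4 / d ^ 2 * exp (x ^ 2 / d))%R) in *. unfold C1.
    assert (A ^ 2 <= x * A1 ^ 2)%R.
    { apply Rle_trans with ((x * A1) ^ 2)%R; [apply pow_incr; lra|].
      rewrite Rpow_mult_distr. apply Rmult_le_compat_r; nra. }
    nra. }
  set (cc := cell_const tau z) in *.
  assert (BC1 : (cc <= C1)%R) by nra.
  set (A2 := (exp (cc * (3 * 3)) * (cc * 3))%R) in HB. cbv zeta in HB.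
  assert (BA2 : (0 <= A2 <= x * C2)%R).
  { unfold A2. split; [apply Rmult_le_pos; [left; apply exp_pos|lra]|].
    replace (x * C2)%R with (exp (C1 * (3 * 3)) * (x * C1 * 3))%R by (unfold C2; ring).
    apply Rmult_le_compat; [left; apply exp_pos|lra|apply exp_le_compat; lra|lra]. }
  assert (BA2' : (A2 <= C2)%R) by nra.
  assert (HB' : (Cmod (Rz - 1) <= x * C3)%R).
  { eapply Rle_trans; [exact HB|]. fold A2.
    replace (x * C3)%R with (exp (C2 * 3) * (x * C2 * 3))%R by (unfold C3; ring).
    apply Rmult_le_compat; [left; apply exp_pos|lra|apply exp_le_compat; lra|lra]. }
  assert (HxC : (x * C3 < 1)%R).
  { apply (Rmult_lt_compat_r (1 + C3)) in Hs; [|lra]. rewrite Rinv_l in Hs by lra. nra. }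
  apply Cmult_neq_0; [apply Cmult_neq_0; [exact Hz|apply cexp_neq0]|].
  intros E. rewrite E in HB'. replace (0 - 1) with (- (1)) in HB' by ring.
  rewrite Cmod_opp, Cmod_1 in HB'. lra.
Qed.

(** * The inversion [tau -> -1/tau] *)

Lemma upper_half_neq0 (tau : C) : upper_half tau -> tau <> 0.
Proof. unfold upper_half. intros H E. rewrite E in H. simpl in H. lra. Qed.

Lemma Cmod_sq (c : C) : (Cmod c ^ 2 = Re c * Re c + Im c * Im c)%R.
Proof. rewrite Cmod2_alt. ring. Qed.

Lemma Im_Cinv (c : C) : c <> 0 -> Im (/ c) = (- Im c / Cmod c ^ 2)%R.
Proof.
  intros H. rewrite Cmod_sq. destruct c as [a b]. simpl.
  replace (a * (a * 1) + b * (b * 1))%R with (a * a + b * b)%R by ring. reflexivity.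
Qed.

Lemma upper_half_S (tau : C) : upper_half tau -> upper_half (- / tau).
Proof.
  intros H. pose proof (upper_half_neq0 tau H) as H0. unfold upper_half in *.
  rewrite im_opp, Im_Cinv by exact H0. pose proof (Cmod_pos tau H0).
  replace (- (- Im tau / Cmod tau ^ 2))%R with (Im tau / Cmod tau ^ 2)%R by (field; lra).
  apply Rdiv_lt_0_compat; [exact H|nra].
Qed.

Lemma wfac_scale (z w t : C) : t <> 0 -> w <> 0 -> wfac (z / t) (w / t) = wfac z w.
Proof.
  intros Ht Hw. unfold wfac.
  replace ((z / t) ^ 2 / (w / t) ^ 2) with (z ^ 2 / w ^ 2) by (field; auto). reflexivity.
Qed.

Lemma wfac_opp (z w : C) : wfac z (- w) = wfac z w.
Proof. unfold wfac. replace ((- w) ^ 2) with (w ^ 2) by ring. reflexivity. Qed.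

(** Multiplication by [tau] sends [x (-1/tau) + y] to [y tau - x], and [wfac] is unchanged when [z]
    and [w] are scaled together or [w] changes sign. Hence the cells are transposed. *)
Lemma cell_S (z tau : C) (m n : nat) : upper_half tau ->
  cell_prod (wfac (z / tau)) (- / tau) m n = cell_prod (wfac z) tau n m.
Proof.
  intros Ht. pose proof (upper_half_neq0 tau Ht) as H0.
  assert (E : forall x y : R, (0 < x ^ 2 + y ^ 2)%R ->
     wfac (z / tau) (lat (- / tau) x y) = wfac z (lat tau y (- x))).
  { intros x y Hxy. rewrite <- (wfac_scale z (lat tau y (- x)) tau H0).
    - f_equal. unfold lat. rewrite RtoC_opp. field. exact H0.
    - apply lat_neq0; [exact Ht|nra]. }
  assert (F : forall x y : R, wfac z (lat tau x y) = wfac z (lat tau (- x) (- y))).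
  { intros x y. rewrite <- wfac_opp. f_equal. unfold lat. rewrite !RtoC_opp. ring. }
  unfold cell_prod. destruct m as [|m], n as [|n]; [reflexivity| | |];
    try assert (HM : (0 < INR (S m))%R) by (apply lt_0_INR; lia);
    try assert (HN : (0 < INR (S n))%R) by (apply lt_0_INR; lia).
  - rewrite E by nra. now rewrite Ropp_0.
  - rewrite E by nra. rewrite F. now rewrite Ropp_0, Ropp_involutive.
  - rewrite !E by nra. rewrite Cmult_comm. f_equal.
    rewrite F. now rewrite !Ropp_involutive.
Qed.

(** By transposition the boxes for [tau] and [-1/tau] have the same limit, so only the two Gaussian
    factors differ. Comparing the period 1 of one side with the quasi-period [tau] of the other
    fixes their quotient. *)
Lemma theta_S (z tau : C) : upper_half tau ->
  theta (z / tau) (- / tau) = / tau * e2pi (z ^ 2 / (2 * tau)) * theta z tau.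
Proof.
  intros Ht. pose proof (upper_half_neq0 tau Ht) as H0. pose proof (upper_half_S tau Ht) as Ht'.
  destruct (theta_weierstrass tau Ht) as [G HG].
  destruct (theta_weierstrass (- / tau) Ht') as [G' HG'].
  set (k := G - G' / tau ^ 2).
  assert (K : forall z, theta (z / tau) (- / tau) * tau = cexp (k * z ^ 2) * theta z tau).
  { clear z. intros z. destruct (HG z) as [R [HR [HB _]]].
    destruct (HG' (z / tau)) as [R' [HR' [HB' _]]].
    assert (E : R = R').
    { apply (Clim_unique _ _ _ HB). refine (Clim_ext _ _ _ _ HB'). intros N. unfold box.
      rewrite Cprod_swap. apply Cprod_ext. intros m _. apply Cprod_ext. intros n _.
      now apply cell_S. }
    unfold theta. rewrite (limC_eq _ _ HR), (limC_eq _ _ HR'), <- E.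
    replace (- (z / tau) ^ 2 * G') with (k * z ^ 2 + - z ^ 2 * G) by (unfold k; field; exact H0).
    rewrite cexp_plus. field. exact H0. }
  (* Replacing [z] by [z + tau] changes the exponent [k z^2] by [2 k tau z + k tau^2], and the
     quasi-period takes away [two_pi_i (z + tau/2)]; the difference is [lam z + tau lam/2]. *)
  set (lam := 2 * k * tau - two_pi_i).
  assert (L : forall z, theta z tau <> 0 -> cexp (lam * z + tau / 2 * lam) = 1).
  { clear z. intros z Hz.
    assert (E : cexp (k * (z + tau) ^ 2) * theta (z + tau) tau = - (cexp (k * z ^ 2) * theta z tau)).
    { rewrite <- !K. replace ((z + tau) / tau) with (z / tau + 1) by (field; exact H0).
      rewrite theta_plus_1 by exact Ht'. ring. }
    rewrite theta_plus_tau in E by exact Ht.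
    assert (E2 : cexp (k * (z + tau) ^ 2) * e2pi (- (tau / 2) - z) = cexp (k * z ^ 2)).
    { transitivity (- (cexp (k * (z + tau) ^ 2) * (- e2pi (- (tau / 2) - z) * theta z tau)) / theta z tau).
      - field. exact Hz.
      - rewrite E. field. exact Hz. }
    transitivity (cexp (k * (z + tau) ^ 2) * e2pi (- (tau / 2) - z) * cexp (- (k * z ^ 2))).
    - rewrite e2pi_cexp, <- !cexp_plus. f_equal. unfold lam. field.
    - rewrite E2, cexp_opp. field. apply cexp_neq0. }
  assert (Lz : lam = 0).
  { destruct (Ceq_dec lam 0) as [|D]; [assumption|exfalso].
    destruct (theta_small_neq0 tau Ht) as [eps [He Hn]].
    pose proof (Cmod_pos lam D) as PL.
    (* The points [h] and [2h] both lie in the disc where [theta] is nonzero. Dividing the two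
       relations leaves [exp(lam h) = 1], and [h] is such that [lam h] is the positive real number
       [c]. *)
    set (c := (eps * Cmod lam / 4)%R). assert (Hc : (0 < c)%R) by (unfold c; nra).
    assert (C0 : RtoC c <> 0) by (intros E; apply RtoC_inj in E; lra).
    set (h := RtoC c / lam).
    assert (Hh : h <> 0).
    { unfold h, Cdiv. apply Cmult_neq_0; [exact C0|]. intros E. apply C1_nz.
      rewrite <- (Cinv_r lam D), E. ring. }
    assert (Mh : Cmod h = (eps / 4)%R).
    { unfold h. rewrite Cmod_div, Cmod_R, Rabs_right by (auto; lra). unfold c. field. lra. }
    assert (E1 := L h (Hn h Hh ltac:(lra))).
    assert (E2 := L (2 * h) (Hn (2 * h) ltac:(apply Cmult_neq_0; [apply C2_neq0|exact Hh])
                     ltac:(rewrite Cmod_mult, Cmod_R, Rabs_right by lra; lra))).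
    assert (E3 : cexp (RtoC c) = 1).
    { transitivity (cexp (lam * (2 * h) + tau / 2 * lam) / cexp (lam * h + tau / 2 * lam)).
      - unfold Cdiv. rewrite <- cexp_opp, <- cexp_plus. f_equal. unfold h. field. exact D.
      - rewrite E1, E2. field. }
    apply (f_equal Cmod) in E3. rewrite Cmod_cexp, Cmod_1, re_RtoC in E3.
    pose proof (exp_ineq1 c ltac:(lra)). lra. }
  specialize (K z).
  replace (k * z ^ 2) with (two_pi_i * (z ^ 2 / (2 * tau))) in K.
  - rewrite <- e2pi_cexp in K.
    transitivity (/ tau * (theta (z / tau) (- / tau) * tau)); [field; exact H0|].
    rewrite K. ring.
  - replace two_pi_i with (2 * k * tau - lam) by (unfold lam; ring). rewrite Lz. field. exact H0.
Qed.

(** * Klein forms *)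

(** At [Z = a1 tau + a2] the Klein form is [exp(- eta(Z) Z/2) sigma(Z)]. Writing [sigma] through
    [theta], Legendre's relation reduces all the exponentials to [exp(pi i a1 Z)], so no
    quasi-period of [sigma] occurs. *)
Definition klein (a1 a2 : R) (tau : C) : C :=
  e2pi (RtoC a1 * lat tau a1 a2 / 2) * theta (lat tau a1 a2) tau.

Lemma upper_half_plus_R (tau : C) (x : R) : upper_half tau -> upper_half (tau + RtoC x).
Proof. unfold upper_half. intros H. rewrite im_plus, im_RtoC. lra. Qed.

Lemma sin2i_plus_INR (u : C) (m : nat) : sin2i (u + RtoC (INR m)) = (-1) ^ m * sin2i u.
Proof.
  induction m as [|m IH].
  - rewrite INR_0, Cplus_0_r. simpl. ring.
  - rewrite S_INR, RtoC_plus, Cplus_assoc, sin2i_plus_1, IH, Cpow_S. ring.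
Qed.

Lemma theta_T (z tau : C) : upper_half tau -> theta z (tau + 1) = theta z tau.
Proof.
  intros Ht. unfold theta. f_equal.
  assert (E : forall m, theta_row z (tau + 1) m = theta_row z tau m).
  { intros m. unfold theta_row. set (w := RtoC (INR m) * tau).
    replace (RtoC (INR m) * (tau + 1) + z) with (w + z + RtoC (INR m)) by (unfold w; ring).
    replace (RtoC (INR m) * (tau + 1) - z) with (w - z + RtoC (INR m)) by (unfold w; ring).
    replace (RtoC (INR m) * (tau + 1)) with (w + RtoC (INR m)) by (unfold w; ring).
    rewrite !sin2i_plus_INR. set (e := (-1) ^ m).
    assert (Ee : e * e = 1).
    { unfold e. rewrite <- Cpow_mult_l. replace (-1 * -1) with (RtoC 1) by ring. apply Cpow_1_l. }
    replace (e * sin2i (w + z) * (e * sin2i (w - z))) with (e * e * (sin2i (w + z) * sin2i (w - z))) by ring.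
    replace ((e * sin2i w) ^ 2) with (e * e * sin2i w ^ 2) by ring.
    rewrite Ee. now rewrite !Cmult_1_l. }
  assert (F : forall M, theta_partial z (tau + 1) M = theta_partial z tau M).
  { intros M. unfold theta_partial. f_equal. apply Cprod_ext. intros; apply E. }
  apply FunctionalExtensionality.functional_extensionality. exact F.
Qed.

Lemma klein_T (a1 a2 : R) (tau : C) : upper_half tau ->
  klein a1 a2 (tau + 1) = klein a1 (a1 + a2) tau.
Proof.
  intros Ht. unfold klein. rewrite theta_T by exact Ht.
  replace (lat (tau + 1) a1 a2) with (lat tau a1 (a1 + a2)); [reflexivity|].
  unfold lat. rewrite RtoC_plus. ring.
Qed.

Lemma IZR_pred (b : Z) : IZR (Z.pred b) = (IZR b - 1)%R.
Proof. unfold Z.pred. rewrite plus_IZR. reflexivity. Qed.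

Lemma klein_T_Z (b : Z) (a1 a2 : R) (tau : C) : upper_half tau ->
  klein a1 a2 (tau + RtoC (IZR b)) = klein a1 (a1 * IZR b + a2) tau.
Proof.
  revert a2. induction b using Z.peano_ind; intros a2 Ht.
  - rewrite Cplus_0_r. f_equal. ring.
  - rewrite succ_IZR, RtoC_plus, Cplus_assoc.
    rewrite klein_T by now apply upper_half_plus_R. rewrite IHb by exact Ht. f_equal. ring.
  - rewrite IZR_pred. set (t := tau + RtoC (IZR b - 1)).
    assert (Hu : upper_half t) by now apply upper_half_plus_R.
    pose proof (klein_T a1 (a2 - a1) t Hu) as E.
    replace (a1 + (a2 - a1))%R with a2 in E by ring. rewrite <- E.
    replace (t + 1) with (tau + RtoC (IZR b)) by (unfold t; rewrite RtoC_minus; ring).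
    rewrite IHb by exact Ht. f_equal. ring.
Qed.

(** The Gaussian factor of [theta_S] is absorbed by the prefactors: with [Z = a2 tau - a1] one has
    [a1 Z/tau + Z^2/tau = a2 Z]. *)
Lemma klein_S (a1 a2 : R) (tau : C) : upper_half tau ->
  klein a1 a2 (- / tau) = / tau * klein a2 (- a1) tau.
Proof.
  intros Ht. pose proof (upper_half_neq0 tau Ht) as H0. unfold klein.
  set (Z := lat tau a2 (- a1)).
  replace (lat (- / tau) a1 a2) with (Z / tau)
    by (unfold Z, lat; rewrite RtoC_opp; field; exact H0).
  rewrite theta_S by exact Ht.
  replace (e2pi (RtoC a2 * Z / 2)) with (e2pi (RtoC a1 * (Z / tau) / 2) * e2pi (Z ^ 2 / (2 * tau))).
  - ring.
  - rewrite <- e2pi_plus. f_equal. unfold Z, lat. rewrite RtoC_opp. field. exact H0.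
Qed.

Lemma klein_opp (a1 a2 : R) (tau : C) : upper_half tau ->
  klein (- a1) (- a2) tau = - klein a1 a2 tau.
Proof.
  intros Ht. unfold klein.
  replace (lat tau (- a1) (- a2)) with (- lat tau a1 a2) by (unfold lat; rewrite !RtoC_opp; ring).
  rewrite theta_opp by exact Ht. rewrite RtoC_opp.
  replace (- RtoC a1 * - lat tau a1 a2 / 2) with (RtoC a1 * lat tau a1 a2 / 2) by field. ring.
Qed.

(** * The action of SL2(Z) and the covariance of Klein forms *)

Definition jfac (A : mat2) (z : C) : C := RtoC (IZR (mc A)) * z + RtoC (IZR (md A)).

Definition mob (A : mat2) (z : C) : C :=
  (RtoC (IZR (ma A)) * z + RtoC (IZR (mb A))) / jfac A z.

Definition mmul (A B : mat2) : mat2 :=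
  Mat2 (ma A * ma B + mb A * mc B) (ma A * mb B + mb A * md B)
       (mc A * ma B + md A * mc B) (mc A * mb B + md A * md B).

Lemma slash_1 (F : C -> C) (A : mat2) (z : C) : slash 1 F A z = / jfac A z * F (mob A z).
Proof.
  unfold slash, mob, jfac. cbv zeta. f_equal. f_equal. simpl. ring.
Qed.

Lemma jfac_neq0 (A : mat2) (z : C) : in_SL2Z A -> upper_half z -> jfac A z <> 0.
Proof.
  unfold in_SL2Z, upper_half, jfac. intros HA Hz E.
  assert (Ei := f_equal Im E). rewrite im_plus, im_scal_l, !im_RtoC in Ei.
  assert (Er := f_equal Re E). rewrite re_plus, re_scal_l, !re_RtoC in Er.
  assert (C0 : IZR (mc A) = 0%R) by nra. rewrite C0 in Er.
  assert (D0 : IZR (md A) = 0%R) by lra.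
  apply eq_IZR in C0, D0. rewrite C0, D0 in HA. lia.
Qed.

Lemma Im_mob (A : mat2) (z : C) : in_SL2Z A -> upper_half z ->
  Im (mob A z) = (Im z / Cmod (jfac A z) ^ 2)%R.
Proof.
  intros HA Hz. pose proof (jfac_neq0 A z HA Hz) as J.
  pose proof (Cmod_pos _ J) as PJ. unfold mob.
  set (j := jfac A z) in *.
  unfold Cdiv. rewrite im_mult, Im_Cinv by exact J.
  assert (Rj : Re (/ j) = (Re j / Cmod j ^ 2)%R).
  { rewrite Cmod_sq. destruct j as [a b]. simpl.
    replace (a * (a * 1) + b * (b * 1))%R with (a * a + b * b)%R by ring. reflexivity. }
  rewrite Rj.
  rewrite re_plus, im_plus, re_scal_l, im_scal_l, !re_RtoC, !im_RtoC.
  replace (Re j) with (IZR (mc A) * Re z + IZR (md A))%R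
    by (unfold j, jfac; rewrite re_plus, re_scal_l, re_RtoC; reflexivity).
  replace (Im j) with (IZR (mc A) * Im z)%R
    by (unfold j, jfac; rewrite im_plus, im_scal_l, im_RtoC; ring).
  assert (D : (IZR (ma A) * IZR (md A) - IZR (mb A) * IZR (mc A) = 1)%R).
  { unfold in_SL2Z in HA. rewrite <- !mult_IZR, <- minus_IZR, HA. reflexivity. }
  transitivity (Im z * (IZR (ma A) * IZR (md A) - IZR (mb A) * IZR (mc A)) / Cmod j ^ 2)%R.
  - field. lra.
  - rewrite D. field. lra.
Qed.

Lemma upper_half_mob (A : mat2) (z : C) : in_SL2Z A -> upper_half z -> upper_half (mob A z).
Proof.
  intros HA Hz. unfold upper_half. rewrite Im_mob by assumption.
  pose proof (Cmod_pos _ (jfac_neq0 A z HA Hz)). apply Rdiv_lt_0_compat; [exact Hz|nra].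
Qed.

Lemma in_SL2Z_mmul (A B : mat2) : in_SL2Z A -> in_SL2Z B -> in_SL2Z (mmul A B).
Proof.
  unfold in_SL2Z, mmul; simpl. intros HA HB.
  transitivity ((ma A * md A - mb A * mc A) * (ma B * md B - mb B * mc B))%Z; [ring|].
  now rewrite HA, HB.
Qed.

Lemma jfac_mmul (A B : mat2) (z : C) : in_SL2Z B -> upper_half z ->
  jfac (mmul A B) z = jfac A (mob B z) * jfac B z.
Proof.
  intros HB Hz. pose proof (jfac_neq0 B z HB Hz) as J. unfold mob. unfold jfac at 2.
  replace ((RtoC (IZR (mc A)) * ((RtoC (IZR (ma B)) * z + RtoC (IZR (mb B))) / jfac B z)
            + RtoC (IZR (md A))) * jfac B z)
    with (RtoC (IZR (mc A)) * (RtoC (IZR (ma B)) * z + RtoC (IZR (mb B))) + RtoC (IZR (md A)) * jfac B z)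
    by (field; exact J).
  unfold jfac, mmul; simpl. rewrite !plus_IZR, !mult_IZR, !RtoC_plus, !RtoC_mult. ring.
Qed.

Lemma mob_mmul (A B : mat2) (z : C) : in_SL2Z A -> in_SL2Z B -> upper_half z ->
  mob (mmul A B) z = mob A (mob B z).
Proof.
  intros HA HB Hz. pose proof (jfac_neq0 B z HB Hz) as J.
  pose proof (jfac_neq0 A _ HA (upper_half_mob B z HB Hz)) as J2.
  unfold mob at 1 2. rewrite jfac_mmul by assumption.
  replace ((RtoC (IZR (ma A)) * mob B z + RtoC (IZR (mb A))) / jfac A (mob B z))
    with ((RtoC (IZR (ma A)) * mob B z + RtoC (IZR (mb A))) * jfac B z / (jfac A (mob B z) * jfac B z))
    by (field; auto).
  f_equal. unfold mob.
  replace ((RtoC (IZR (ma A)) * ((RtoC (IZR (ma B)) * z + RtoC (IZR (mb B))) / jfac B z)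
            + RtoC (IZR (mb A))) * jfac B z)
    with (RtoC (IZR (ma A)) * (RtoC (IZR (ma B)) * z + RtoC (IZR (mb B))) + RtoC (IZR (mb A)) * jfac B z)
    by (field; exact J).
  unfold jfac, mmul; simpl. rewrite !plus_IZR, !mult_IZR, !RtoC_plus, !RtoC_mult. ring.
Qed.

Definition klein_covariant (A : mat2) : Prop :=
  forall (a1 a2 : R) (tau : C), upper_half tau ->
    klein a1 a2 (mob A tau) =
    / jfac A tau * klein (a1 * IZR (ma A) + a2 * IZR (mc A)) (a1 * IZR (mb A) + a2 * IZR (md A)) tau.

Lemma klein_covariant_mmul (A B : mat2) : in_SL2Z A -> in_SL2Z B ->
  klein_covariant A -> klein_covariant B -> klein_covariant (mmul A B).
Proof.
  intros HA HB KA KB a1 a2 tau Ht. rewrite mob_mmul, jfac_mmul by assumption.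
  rewrite KA by now apply upper_half_mob. rewrite KB by exact Ht.
  unfold mmul; simpl. rewrite !plus_IZR, !mult_IZR.
  replace (a1 * (IZR (ma A) * IZR (ma B) + IZR (mb A) * IZR (mc B)) +
           a2 * (IZR (mc A) * IZR (ma B) + IZR (md A) * IZR (mc B)))%R
    with ((a1 * IZR (ma A) + a2 * IZR (mc A)) * IZR (ma B)
          + (a1 * IZR (mb A) + a2 * IZR (md A)) * IZR (mc B))%R by ring.
  replace (a1 * (IZR (ma A) * IZR (mb B) + IZR (mb A) * IZR (md B)) +
           a2 * (IZR (mc A) * IZR (mb B) + IZR (md A) * IZR (md B)))%R
    with ((a1 * IZR (ma A) + a2 * IZR (mc A)) * IZR (mb B)
          + (a1 * IZR (mb A) + a2 * IZR (md A)) * IZR (md B))%R by ring.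
  field. split.
  - now apply jfac_neq0.
  - apply jfac_neq0; [exact HA|now apply upper_half_mob].
Qed.

Lemma klein_covariant_ST (k : Z) : klein_covariant (Mat2 0 (-1) 1 k).
Proof.
  intros a1 a2 tau Ht. unfold mob, jfac; simpl.
  assert (Hu : upper_half (tau + RtoC (IZR k))) by now apply upper_half_plus_R.
  pose proof (upper_half_neq0 _ Hu) as H0.
  replace ((0 * tau + -1) / (1 * tau + RtoC (IZR k))) with (- / (tau + RtoC (IZR k)))
    by (rewrite Cmult_0_l, Cmult_1_l; field; exact H0).
  rewrite klein_S by exact Hu. rewrite klein_T_Z by exact Ht. rewrite Cmult_1_l.
  f_equal. f_equal; ring.
Qed.

(** Euclid's algorithm on the bottom row: splitting off inversion and a translation on the right
    replaces the lower left entry [c] by [- (d mod c)]. When [c = 0] a translation up to sign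
    remains, and the oddness of Klein forms matches the sign of the automorphy factor. *)
Lemma klein_covariant_SL2Z (A : mat2) : in_SL2Z A -> klein_covariant A.
Proof.
  assert (H : forall n A, (Z.abs_nat (mc A) < n)%nat -> in_SL2Z A -> klein_covariant A).
  { induction n as [|n IH]; intros B Hn HB; [lia|].
    destruct (Z.eq_dec (mc B) 0) as [C0|C0].
    - destruct B as [a b c d]. unfold in_SL2Z in HB. simpl in *. subst c.
      assert (Hd : (a = 1 /\ d = 1 \/ a = -1 /\ d = -1)%Z).
      { rewrite Z.mul_0_r, Z.sub_0_r in HB.
        destruct (Z.mul_eq_1 a d HB) as [-> | ->]; lia. }
      intros a1 a2 tau Ht. unfold mob, jfac; simpl.
      destruct Hd as [[-> ->]|[-> ->]].
      + replace ((1 * tau + RtoC (IZR b)) / (0 * tau + 1)) with (tau + RtoC (IZR b))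
          by (rewrite Cmult_0_l, Cplus_0_l; field).
        rewrite klein_T_Z by exact Ht. rewrite Cmult_0_l, Cplus_0_l.
        replace (/ 1) with (RtoC 1) by field. rewrite Cmult_1_l. f_equal; ring.
      + replace ((-1 * tau + RtoC (IZR b)) / (0 * tau + -1)) with (tau + RtoC (IZR (- b)))
          by (rewrite Cmult_0_l, Cplus_0_l, opp_IZR, RtoC_opp; field).
        rewrite klein_T_Z by exact Ht. rewrite Cmult_0_l, Cplus_0_l.
        replace (a1 * -1 + a2 * 0)%R with (- a1)%R by ring.
        replace (a1 * IZR b + a2 * -1)%R with (- (a1 * IZR (- b) + a2))%R by (rewrite opp_IZR; ring).
        rewrite klein_opp by exact Ht. field.
    - set (k := (md B / mc B)%Z). set (r := (md B mod mc B)%Z).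
      assert (Er : (md B = k * mc B + r)%Z) by (unfold k, r; rewrite (Z.mul_comm _ (mc B)); now apply Z.div_mod).
      assert (Hr : (Z.abs r < Z.abs (mc B))%Z) by (unfold r; now apply Z.mod_bound_abs).
      set (B' := Mat2 (k * ma B - mb B) (ma B) (- r) (mc B)).
      assert (HB' : in_SL2Z B').
      { unfold in_SL2Z, B' in *; simpl. rewrite <- HB, Er. ring. }
      assert (E : B = mmul B' (Mat2 0 (-1) 1 k)).
      { destruct B as [a b c d]. unfold mmul, B'; simpl in *. f_equal; lia. }
      rewrite E. apply klein_covariant_mmul.
      + exact HB'.
      + unfold in_SL2Z; simpl. ring.
      + apply IH; [|exact HB']. unfold B'; simpl. lia.
      + apply klein_covariant_ST. }
  apply (H (S (Z.abs_nat (mc A)))). lia.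
Qed.

(** * Integral shifts of the index vector *)

Lemma klein_shift_1 (a1 a2 : R) (tau : C) : upper_half tau ->
  klein (a1 + 1) a2 tau = - e2pi (- (RtoC a2 / 2)) * klein a1 a2 tau.
Proof.
  intros Ht. unfold klein. set (Z := lat tau a1 a2).
  replace (lat tau (a1 + 1) a2) with (Z + tau) by (unfold Z, lat; rewrite RtoC_plus; ring).
  rewrite theta_plus_tau by exact Ht.
  transitivity (- (e2pi (RtoC (a1 + 1) * (Z + tau) / 2) * e2pi (- (tau / 2) - Z)) * theta Z tau); [ring|].
  transitivity (- (e2pi (- (RtoC a2 / 2)) * e2pi (RtoC a1 * Z / 2)) * theta Z tau); [|ring].
  rewrite <- !e2pi_plus. f_equal. f_equal. f_equal. unfold Z, lat. rewrite RtoC_plus. field.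
Qed.

Lemma klein_shift_2 (a1 a2 : R) (tau : C) : upper_half tau ->
  klein a1 (a2 + 1) tau = - e2pi (RtoC a1 / 2) * klein a1 a2 tau.
Proof.
  intros Ht. unfold klein. set (Z := lat tau a1 a2).
  replace (lat tau a1 (a2 + 1)) with (Z + 1) by (unfold Z, lat; rewrite RtoC_plus; ring).
  rewrite theta_plus_1 by exact Ht.
  replace (RtoC a1 * (Z + 1) / 2) with (RtoC a1 / 2 + RtoC a1 * Z / 2) by field.
  rewrite e2pi_plus. ring.
Qed.

Lemma neg_e2pi_sq (w : C) : - e2pi (w / 2) * - e2pi (w / 2) = e2pi w.
Proof.
  transitivity (e2pi (w / 2) * e2pi (w / 2)); [ring|]. rewrite <- e2pi_plus. f_equal. field.
Qed.

Lemma klein_even_shift_1 (b : Z) (a1 a2 : R) (tau : C) : upper_half tau ->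
  klein (a1 + 2 * IZR b) a2 tau = e2pi (- RtoC (IZR b * a2)) * klein a1 a2 tau.
Proof.
  intros Ht.
  assert (step : forall x, klein (x + 2) a2 tau = e2pi (- RtoC a2) * klein x a2 tau).
  { intros x. replace (x + 2)%R with (x + 1 + 1)%R by ring.
    rewrite !klein_shift_1, Cmult_assoc by exact Ht. f_equal.
    replace (- (RtoC a2 / 2)) with (- RtoC a2 / 2) by field. apply neg_e2pi_sq. }
  induction b using Z.peano_ind.
  - rewrite !Rmult_0_l, Rmult_0_r, Rplus_0_r, Copp_0, e2pi_0. ring.
  - rewrite succ_IZR. replace (a1 + 2 * (IZR b + 1))%R with (a1 + 2 * IZR b + 2)%R by ring.
    rewrite step, IHb, Cmult_assoc, <- e2pi_plus. f_equal. f_equal.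
    rewrite Rmult_plus_distr_r, Rmult_1_l, RtoC_plus. ring.
  - rewrite IZR_pred. pose proof (step (a1 + 2 * (IZR b - 1))%R) as E.
    replace (a1 + 2 * (IZR b - 1) + 2)%R with (a1 + 2 * IZR b)%R in E by ring.
    rewrite IHb in E.
    transitivity (e2pi (RtoC a2) * (e2pi (- RtoC a2) * klein (a1 + 2 * (IZR b - 1)) a2 tau)).
    + rewrite e2pi_opp. field. apply e2pi_neq0.
    + rewrite <- E, Cmult_assoc, <- e2pi_plus. f_equal. f_equal.
      rewrite Rmult_minus_distr_r, Rmult_1_l, RtoC_minus. ring.
Qed.

Lemma klein_even_shift_2 (b : Z) (a1 a2 : R) (tau : C) : upper_half tau ->
  klein a1 (a2 + 2 * IZR b) tau = e2pi (RtoC (IZR b * a1)) * klein a1 a2 tau.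
Proof.
  intros Ht.
  assert (step : forall x, klein a1 (x + 2) tau = e2pi (RtoC a1) * klein a1 x tau).
  { intros x. replace (x + 2)%R with (x + 1 + 1)%R by ring.
    rewrite !klein_shift_2, Cmult_assoc by exact Ht. f_equal. apply neg_e2pi_sq. }
  induction b using Z.peano_ind.
  - rewrite !Rmult_0_l, Rmult_0_r, Rplus_0_r, e2pi_0. ring.
  - rewrite succ_IZR. replace (a2 + 2 * (IZR b + 1))%R with (a2 + 2 * IZR b + 2)%R by ring.
    rewrite step, IHb, Cmult_assoc, <- e2pi_plus. f_equal. f_equal.
    rewrite Rmult_plus_distr_r, Rmult_1_l, RtoC_plus. ring.
  - rewrite IZR_pred. pose proof (step (a2 + 2 * (IZR b - 1))%R) as E.
    replace (a2 + 2 * (IZR b - 1) + 2)%R with (a2 + 2 * IZR b)%R in E by ring.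
    rewrite IHb in E.
    transitivity (e2pi (- RtoC a1) * (e2pi (RtoC a1) * klein a1 (a2 + 2 * (IZR b - 1)) tau)).
    + rewrite e2pi_opp. field. apply e2pi_neq0.
    + rewrite <- E, Cmult_assoc, <- e2pi_plus. f_equal. f_equal.
      rewrite Rmult_minus_distr_r, Rmult_1_l, RtoC_minus. ring.
Qed.

(** For even shifts the signs of the unit shifts cancel in pairs, and the cross term of the two
    directions is [e(-2 b1 b2) = 1]. What remains is a phase linear in the index. *)
Lemma klein_even_shift (b1 b2 : Z) (a1 a2 : R) (tau : C) : upper_half tau ->
  klein (a1 + 2 * IZR b1) (a2 + 2 * IZR b2) tau =
  e2pi (RtoC (IZR b2 * a1 - IZR b1 * a2)) * klein a1 a2 tau.
Proof.
  intros Ht. rewrite klein_even_shift_1, klein_even_shift_2, Cmult_assoc by exact Ht. f_equal.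
  rewrite <- e2pi_plus.
  replace (- RtoC (IZR b1 * (a2 + 2 * IZR b2)) + RtoC (IZR b2 * a1))
    with (RtoC (IZR b2 * a1 - IZR b1 * a2) + RtoC (IZR (- (2 * b1 * b2)))).
  - rewrite e2pi_plus, e2pi_IZR. ring.
  - rewrite <- RtoC_opp, <- !RtoC_plus, opp_IZR, !mult_IZR. f_equal. ring.
Qed.

(** Odd shifts are included here at the price of an unspecified constant. For expansions at the
    cusps it only matters that this constant is nonzero and independent of [tau]. *)
Lemma klein_shift_Z (b1 b2 : Z) (a1 a2 : R) :
  exists c : C, c <> 0 /\ forall tau, upper_half tau ->
    klein (a1 + IZR b1) (a2 + IZR b2) tau = c * klein a1 a2 tau.
Proof.
  assert (N : forall w, - e2pi w <> 0).
  { intros w E. apply (e2pi_neq0 w). replace (e2pi w) with (- - e2pi w) by ring. rewrite E. ring. }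
  assert (par : forall b : Z, exists k e : Z, (b = 2 * k + e /\ (e = 0 \/ e = 1))%Z).
  { intros b. exists (b / 2)%Z, (b mod 2)%Z. pose proof (Z.div_mod b 2 ltac:(lia)).
    pose proof (Z.mod_pos_bound b 2 ltac:(lia)). lia. }
  destruct (par b1) as [k1 [e1 [E1 H1]]]. destruct (par b2) as [k2 [e2 [E2 H2]]].
  assert (base : exists c : C, c <> 0 /\ forall tau, upper_half tau ->
    klein (a1 + IZR e1) (a2 + IZR e2) tau = c * klein a1 a2 tau).
  { destruct H1 as [->| ->], H2 as [->| ->]; rewrite ?Rplus_0_r.
    - exists (RtoC 1). split; [apply C1_nz|]. intros; ring.
    - exists (- e2pi (RtoC a1 / 2)). split; [apply N|]. intros. now apply klein_shift_2.
    - exists (- e2pi (- (RtoC a2 / 2))). split; [apply N|]. intros. now apply klein_shift_1.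
    - exists (- e2pi (- (RtoC (a2 + 1) / 2)) * - e2pi (RtoC a1 / 2)).
      split; [apply Cmult_neq_0; apply N|]. intros.
      rewrite klein_shift_1, klein_shift_2 by assumption. ring. }
  destruct base as [c [Hc Ec]].
  exists (e2pi (RtoC (IZR k2 * (a1 + IZR e1) - IZR k1 * (a2 + IZR e2))) * c).
  split; [apply Cmult_neq_0; [apply e2pi_neq0|exact Hc]|]. intros tau Ht.
  rewrite E1, E2, !plus_IZR, !mult_IZR.
  replace (a1 + (2 * IZR k1 + IZR e1))%R with (a1 + IZR e1 + 2 * IZR k1)%R by ring.
  replace (a2 + (2 * IZR k2 + IZR e2))%R with (a2 + IZR e2 + 2 * IZR k2)%R by ring.
  rewrite klein_even_shift, Ec by exact Ht. ring.
Qed.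

Lemma theta_row_alt (z tau : C) (m : nat) : upper_half tau ->
  let w := RtoC (INR (S m)) * tau in
  theta_row z tau (S m) = (1 - e2pi (w + z)) * (1 - e2pi (w - z)) * / (1 - e2pi w) ^ 2.
Proof.
  intros Ht w. unfold theta_row. fold w. rewrite !sin2i_alt.
  assert (D : 1 - e2pi w <> 0).
  { apply one_minus_neq0, e2pi_Cmod_lt1, upper_half_scal; [exact Ht|apply lt_0_INR; lia]. }
  replace (- e2pi (- ((w + z) / 2)) * (1 - e2pi (w + z)) * (- e2pi (- ((w - z) / 2)) * (1 - e2pi (w - z))))
    with (e2pi (- ((w + z) / 2)) * e2pi (- ((w - z) / 2)) * ((1 - e2pi (w + z)) * (1 - e2pi (w - z)))) by ring.
  replace (e2pi (- ((w + z) / 2)) * e2pi (- ((w - z) / 2))) with (e2pi (- (w / 2)) * e2pi (- (w / 2)))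
    by (rewrite <- !e2pi_plus; f_equal; field).
  field. split; [exact D|apply e2pi_neq0].
Qed.

(** * Power series in the unit disc *)

Definition ps_bound (r : R) (a : nat -> C) (B : R) : Prop :=
  forall L, (Rsum (fun n => Cmod (a n) * r ^ n)%R L <= B)%R.

(** Absolute convergence is recorded as a bound on all partial sums at every radius below 1. In this
    form it passes to products and derivatives by elementary estimates. The function [f] is
    constrained on the open unit disc only. *)
Definition is_ps (a : nat -> C) (f : C -> C) : Prop :=
  (forall r, (0 < r < 1)%R -> exists B, ps_bound r a B) /\
  (forall y, (Cmod y < 1)%R -> Clim (Csum (fun n => a n * y ^ n)) (f y)).

Lemma Csum_triangle (F : nat -> nat -> C) (L : nat) :
  Csum (fun n => Csum (fun i => F i (n - i)%nat) (S n)) L = Csum (fun i => Csum (F i) (L - i)) L.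
Proof.
  induction L as [|L IH]; [reflexivity|].
  change (Csum (fun n => Csum (fun i => F i (n - i)%nat) (S n)) (S L))
    with (Csum (fun n => Csum (fun i => F i (n - i)%nat) (S n)) L + Csum (fun i => F i (L - i)%nat) (S L)).
  rewrite IH.
  transitivity (Csum (fun i => Csum (F i) (L - i)) (S L) + Csum (fun i => F i (L - i)%nat) (S L)).
  - f_equal. simpl. rewrite Nat.sub_diag. simpl. ring.
  - rewrite <- Csum_plus. apply Csum_ext. intros i Hi.
    replace (S L - i)%nat with (S (L - i)) by lia. reflexivity.
Qed.

Lemma Rsum_triangle (F : nat -> nat -> R) (L : nat) :
  Rsum (fun n => Rsum (fun i => F i (n - i)%nat) (S n)) L = Rsum (fun i => Rsum (F i) (L - i)) L.
Proof.
  induction L as [|L IH]; [reflexivity|].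
  change (Rsum (fun n => Rsum (fun i => F i (n - i)%nat) (S n)) (S L))
    with (Rsum (fun n => Rsum (fun i => F i (n - i)%nat) (S n)) L + Rsum (fun i => F i (L - i)%nat) (S L))%R.
  rewrite IH.
  transitivity (Rsum (fun i => Rsum (F i) (L - i)) (S L) + Rsum (fun i => F i (L - i)%nat) (S L))%R.
  - f_equal. simpl. rewrite Nat.sub_diag. simpl. ring.
  - rewrite <- Rsum_plus. apply Rsum_ext. intros i Hi.
    replace (S L - i)%nat with (S (L - i)) by lia. reflexivity.
Qed.

Lemma conv_Csum (a b : nat -> C) (n : nat) :
  conv a b n = Csum (fun i => a i * b (n - i)%nat) (S n).
Proof. unfold conv. apply sum_n_Csum. Qed.

Lemma ps_bound_ge0 (r : R) (a : nat -> C) (B : R) : ps_bound r a B -> (0 <= B)%R.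
Proof. intros H. specialize (H O). simpl in H. exact H. Qed.

Lemma ps_term_ge0 (r : R) (a : nat -> C) (n : nat) : (0 <= r)%R -> (0 <= Cmod (a n) * r ^ n)%R.
Proof. intros H. apply Rmult_le_pos; [apply Cmod_ge_0|now apply pow_le]. Qed.

(** The triangle [i + j < L] lies in a square, so majorants multiply. *)
Lemma ps_bound_conv (r : R) (a b : nat -> C) (A B : R) : (0 <= r)%R ->
  ps_bound r a A -> ps_bound r b B -> ps_bound r (conv a b) (A * B).
Proof.
  intros Hr HA HB L.
  apply Rle_trans with (Rsum (fun n => Rsum (fun i =>
    (fun i j => Cmod (a i) * r ^ i * (Cmod (b j) * r ^ j))%R i (n - i)%nat) (S n)) L).
  - apply Rsum_le. intros n _. rewrite conv_Csum.
    apply Rle_trans with (Rsum (fun i => Cmod (a i * b (n - i)%nat)%C) (S n) * r ^ n)%R.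
    + apply Rmult_le_compat_r; [now apply pow_le|apply Cmod_Csum].
    + rewrite Rmult_comm, <- Rsum_scal. right. apply Rsum_ext. intros i Hi.
      rewrite Cmod_mult. replace n with (i + (n - i))%nat at 1 by lia. rewrite pow_add. ring.
  - rewrite (Rsum_triangle (fun i j => Cmod (a i) * r ^ i * (Cmod (b j) * r ^ j))%R).
    apply Rle_trans with (Rsum (fun i => B * (Cmod (a i) * r ^ i))%R L).
    + apply Rsum_le. intros i _. rewrite Rsum_scal, Rmult_comm.
      apply Rmult_le_compat_r; [now apply ps_term_ge0|apply HB].
    + rewrite Rsum_scal, Rmult_comm.
      apply Rmult_le_compat_r; [now apply (ps_bound_ge0 r b)|apply HA].
Qed.

Lemma ps_bound_le (r : R) (a : nat -> C) (B B' : R) :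
  (B <= B')%R -> ps_bound r a B -> ps_bound r a B'.
Proof. intros H HB L. eapply Rle_trans; [apply HB|exact H]. Qed.

(** A point well inside the disc of radius [r] gains a factor [rho] per degree, so everything from
    degree [m] on is of size [rho^m]. This geometric rate drives the tail estimates below. *)
Lemma ps_segment (a : nat -> C) (r B rho : R) (y : C) (m k : nat) :
  (0 <= r)%R -> (0 <= rho <= 1)%R -> (Cmod y <= rho * r)%R -> ps_bound r a B ->
  (Rsum (fun i => Cmod (a (m + i)%nat * y ^ (m + i))%C) k <= rho ^ m * B)%R.
Proof.
  intros Hr Hrho Hy HB.
  apply Rle_trans with (Rsum (fun i => rho ^ m * (Cmod (a (m + i)%nat) * r ^ (m + i)))%R k).
  - apply Rsum_le. intros i _. rewrite Cmod_mult, Cmod_pow.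
    replace (rho ^ m * (Cmod (a (m + i)%nat) * r ^ (m + i)))%R
      with (Cmod (a (m + i)%nat) * (rho ^ m * r ^ (m + i)))%R by ring.
    apply Rmult_le_compat_l; [apply Cmod_ge_0|].
    apply Rle_trans with ((rho * r) ^ (m + i))%R; [apply pow_incr; split; [apply Cmod_ge_0|exact Hy]|].
    rewrite Rpow_mult_distr. apply Rmult_le_compat_r; [now apply pow_le|].
    rewrite pow_add. rewrite <- (Rmult_1_r (rho ^ m)) at 2.
    apply Rmult_le_compat_l; [apply pow_le; lra|].
    rewrite <- (pow1 i). apply pow_incr. lra.
  - rewrite Rsum_scal. apply Rmult_le_compat_l; [apply pow_le; lra|].
    specialize (HB (m + k)%nat). rewrite Rsum_add in HB.
    pose proof (Rsum_ge0 (fun n => Cmod (a n) * r ^ n)%R m (fun i _ => ps_term_ge0 r a i Hr)). lra.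
Qed.

Lemma ps_tail (a : nat -> C) (l : C) (r B rho : R) (y : C) (L : nat) :
  (0 <= r)%R -> (0 <= rho <= 1)%R -> (Cmod y <= rho * r)%R -> ps_bound r a B ->
  Clim (Csum (fun n => a n * y ^ n)) l ->
  (Cmod (l - Csum (fun n => a n * y ^ n)%C L) <= rho ^ L * B)%R.
Proof.
  intros Hr Hrho Hy HB Hl.
  apply (Clim_Cmod_le (fun K => Csum (fun n => a n * y ^ n) K - Csum (fun n => a n * y ^ n) L) _ _ L).
  - apply Clim_minus; [exact Hl|apply Clim_const].
  - intros K HK. replace K with (L + (K - L))%nat by lia. rewrite Csum_add.
    replace (Csum (fun n => a n * y ^ n) L + Csum (fun i => a (L + i)%nat * y ^ (L + i)) (K - L)
             - Csum (fun n => a n * y ^ n) L)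
      with (Csum (fun i => a (L + i)%nat * y ^ (L + i)) (K - L)) by ring.
    eapply Rle_trans; [apply Cmod_Csum|]. now apply (ps_segment a r).
Qed.

Lemma mid_radius (y : C) : (Cmod y < 1)%R ->
  exists r rho, (0 < r < 1)%R /\ (0 <= rho < 1)%R /\ (Cmod y <= rho * r)%R.
Proof.
  intros H. pose proof (Cmod_ge_0 y). set (t := Cmod y) in *.
  (* The radius halfway between [t = Cmod y] and 1, with [rho] equal to [t/r]. *)
  exists ((1 + t) / 2)%R, (2 * t / (1 + t))%R. split; [lra|]. split.
  - split; [apply Rdiv_le_0_compat; lra|]. apply Rmult_lt_reg_r with (1 + t)%R; [lra|].
    unfold Rdiv. rewrite Rmult_assoc, Rinv_l by lra. lra.
  - right. field. lra.
Qed.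

Lemma is_ps_of_bound (a : nat -> C) :
  (forall r, (0 < r < 1)%R -> exists B, ps_bound r a B) ->
  is_ps a (fun y => limC (Csum (fun n => a n * y ^ n))).
Proof.
  intros H. split; [exact H|]. intros y Hy.
  destruct (mid_radius y Hy) as [r [rho [Hr [Hrho Hyr]]]]. destruct (H r Hr) as [B HB].
  destruct (Clim_Csum_abs (fun n => a n * y ^ n) (fun n => Cmod (a n * y ^ n)%C) B) as [l [Hl _]].
  - intros; lra.
  - intros n. pose proof (ps_segment a r B rho y 0 n ltac:(lra) ltac:(lra) Hyr HB) as E.
    simpl in E. lra.
  - exact (Clim_limC _ _ Hl).
Qed.

Lemma is_ps_ext (a : nat -> C) (f g : C -> C) :
  (forall y, (Cmod y < 1)%R -> f y = g y) -> is_ps a f -> is_ps a g.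
Proof. intros E [H1 H2]. split; [exact H1|]. intros y Hy. rewrite <- E by exact Hy. now apply H2. Qed.

Lemma is_lim_seq_rpow (rho : R) : (0 <= rho < 1)%R -> is_lim_seq (fun n => rho ^ n)%R 0%R.
Proof. intros H. apply is_lim_seq_geom. rewrite Rabs_right; lra. Qed.

(** The product of the partial sums exceeds the partial sum of the Cauchy product by terms [al_i]
    times a stretch of [be] starting at degree [L - i]. These are of size [rho^i] and [rho^(L-i)],
    so the whole excess is of order [rho^L]. *)
Lemma is_ps_mult (a b : nat -> C) (f g : C -> C) :
  is_ps a f -> is_ps b g -> is_ps (conv a b) (fun y => f y * g y).
Proof.
  intros [Ha1 Ha2] [Hb1 Hb2]. split.
  - intros r Hr. destruct (Ha1 r Hr) as [A HA]. destruct (Hb1 r Hr) as [B HB].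
    exists (A * B)%R. apply ps_bound_conv; auto; lra.
  - intros y Hy. destruct (mid_radius y Hy) as [r [rho [Hr [Hrho Hyr]]]].
    destruct (Ha1 r Hr) as [A HA]. destruct (Hb1 r Hr) as [B HB].
    set (al := fun n => a n * y ^ n). set (be := fun n => b n * y ^ n).
    assert (E : forall L, Csum (fun n => conv a b n * y ^ n) L
                  = Csum al L * Csum be L - Csum (fun i => al i * (Csum be L - Csum be (L - i))) L).
    { intros L. transitivity (Csum (fun i => al i * Csum be (L - i)) L).
      - transitivity (Csum (fun n => Csum (fun i => (fun i j => al i * be j) i (n - i)%nat) (S n)) L).
        + apply Csum_ext. intros n _. rewrite conv_Csum, Cmult_comm, <- Csum_scal.
          apply Csum_ext. intros i Hi. unfold al, be.
          replace n with (i + (n - i))%nat at 1 by lia. rewrite Cpow_add_r. ring.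
        + rewrite (Csum_triangle (fun i j => al i * be j)). apply Csum_ext. intros i _.
          apply Csum_scal.
      - rewrite (Cmult_comm (Csum al L)), <- Csum_scal.
        rewrite <- (Csum_ext (fun i => (Csum be L * al i)
                      + - (al i * (Csum be L - Csum be (L - i))))) by (intros; ring).
        rewrite Csum_plus.
        rewrite (Csum_ext (fun i => - (al i * (Csum be L - Csum be (L - i))))
                   (fun i => -1 * (al i * (Csum be L - Csum be (L - i))))) by (intros; ring).
        rewrite !Csum_scal. ring. }
    assert (Z : Clim (fun L => Csum (fun i => al i * (Csum be L - Csum be (L - i))) L) 0).
    { apply (Clim_le_real _ _ (fun L => A * B * rho ^ L)%R).
      - replace (Finite 0) with (Rbar_mult (Finite (A * B)) (Finite 0)) by (simpl; f_equal; ring).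
        apply is_lim_seq_scal_l, is_lim_seq_rpow, Hrho.
      - intros L. replace (Csum (fun i => al i * (Csum be L - Csum be (L - i))) L - 0)
          with (Csum (fun i => al i * (Csum be L - Csum be (L - i))) L) by ring.
        eapply Rle_trans; [apply Cmod_Csum|].
        apply Rle_trans with (Rsum (fun i => (rho ^ L * B) * (Cmod (a i) * r ^ i))%R L).
        + apply Rsum_le. intros i Hi. rewrite Cmod_mult.
          assert (B1 : (Cmod (al i) <= rho ^ i * (Cmod (a i) * r ^ i))%R).
          { unfold al. rewrite Cmod_mult, Cmod_pow.
            replace (rho ^ i * (Cmod (a i) * r ^ i))%R with (Cmod (a i) * (rho * r) ^ i)%R
              by (rewrite Rpow_mult_distr; ring).
            apply Rmult_le_compat_l; [apply Cmod_ge_0|]. apply pow_incr.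
            split; [apply Cmod_ge_0|exact Hyr]. }
          assert (B2 : (Cmod (Csum be L - Csum be (L - i)) <= rho ^ (L - i) * B)%R).
          { replace L with ((L - i) + i)%nat at 1 by lia. rewrite Csum_add.
            replace (Csum be (L - i) + Csum (fun k => be (L - i + k)%nat) i - Csum be (L - i))
              with (Csum (fun k => be (L - i + k)%nat) i) by ring.
            eapply Rle_trans; [apply Cmod_Csum|]. apply (ps_segment b r); auto; lra. }
          replace (rho ^ L * B * (Cmod (a i) * r ^ i))%R
            with (rho ^ i * (Cmod (a i) * r ^ i) * (rho ^ (L - i) * B))%R.
          * apply Rmult_le_compat; try apply Cmod_ge_0; assumption.
          * replace L with (i + (L - i))%nat at 2 by lia. rewrite pow_add. ring.
        + rewrite Rsum_scal. replace (A * B * rho ^ L)%R with (rho ^ L * B * A)%R by ring.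
          apply Rmult_le_compat_l; [|apply HA].
          apply Rmult_le_pos; [apply pow_le; lra|now apply (ps_bound_ge0 r b)]. }
    pose proof (Clim_minus _ _ _ _ (Clim_mult _ _ _ _ (Ha2 y Hy) (Hb2 y Hy)) Z) as H.
    replace (f y * g y - 0) with (f y * g y) in H by ring.
    refine (Clim_ext _ _ _ _ H). intros L. rewrite E. reflexivity.
Qed.

Lemma is_ps_plus (a b : nat -> C) (f g : C -> C) :
  is_ps a f -> is_ps b g -> is_ps (fun n => a n + b n) (fun y => f y + g y).
Proof.
  intros [Ha1 Ha2] [Hb1 Hb2]. split.
  - intros r Hr. destruct (Ha1 r Hr) as [A HA]. destruct (Hb1 r Hr) as [B HB].
    exists (A + B)%R. intros L. specialize (HA L). specialize (HB L).
    eapply Rle_trans; [|apply Rplus_le_compat; [exact HA|exact HB]].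
    rewrite <- Rsum_plus. apply Rsum_le. intros n _. rewrite <- Rmult_plus_distr_r.
    apply Rmult_le_compat_r; [apply pow_le; lra|apply Cmod_triangle].
  - intros y Hy. refine (Clim_ext _ _ _ _ (Clim_plus _ _ _ _ (Ha2 y Hy) (Hb2 y Hy))).
    intros L. rewrite <- Csum_plus. apply Csum_ext. intros; ring.
Qed.

Definition sparse (c : C) (k : nat) (d : C) (n : nat) : C :=
  if Nat.eqb n 0 then c else if Nat.eqb n k then d else 0.

Lemma sparse_k (c d : C) (k : nat) : (0 < k)%nat -> sparse c k d k = d.
Proof.
  intros H. unfold sparse. rewrite Nat.eqb_refl. destruct (Nat.eqb_spec k 0); [lia|reflexivity].
Qed.

Lemma sparse_other (c d : C) (k n : nat) : n <> O -> n <> k -> sparse c k d n = 0.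
Proof.
  intros H H'. unfold sparse. destruct (Nat.eqb_spec n 0); [lia|].
  destruct (Nat.eqb_spec n k); [lia|reflexivity].
Qed.

Lemma Csum_sparse (c d : C) (k L : nat) (y : C) : (0 < k < L)%nat ->
  Csum (fun n => sparse c k d n * y ^ n) L = c + d * y ^ k.
Proof.
  intros H. replace L with (S ((k - 1) + S (L - S k)))%nat by lia.
  rewrite Csum_shift, Csum_add, Csum_shift, !Csum_0.
  - rewrite Nat.add_0_r. replace (S (k - 1)) with k by lia. rewrite sparse_k by lia.
    change (sparse c k d 0) with c. simpl. ring.
  - intros i Hi. rewrite sparse_other by lia. ring.
  - intros i Hi. rewrite sparse_other by lia. ring.
Qed.

Lemma ps_bound_sparse (r : R) (c d : C) (k : nat) : (0 <= r)%R -> (0 < k)%nat ->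
  ps_bound r (sparse c k d) (Cmod c + Cmod d * r ^ k).
Proof.
  intros Hr Hk L.
  assert (E : Rsum (fun n => Cmod (sparse c k d n) * r ^ n)%R (S k + L) = (Cmod c + Cmod d * r ^ k)%R).
  { assert (Q : RtoC (Rsum (fun n => Cmod (sparse c k d n) * r ^ n)%R (S k + L))
             = Csum (fun n => sparse (RtoC (Cmod c)) k (RtoC (Cmod d)) n * RtoC r ^ n) (S k + L)).
    { induction (S k + L)%nat as [|M IH]; [reflexivity|]. simpl. rewrite RtoC_plus, IH, RtoC_mult, RtoC_pow.
      f_equal. f_equal. unfold sparse. destruct (Nat.eqb M 0); [reflexivity|].
      destruct (Nat.eqb M k); [reflexivity|]. now rewrite Cmod_0. }
    rewrite Csum_sparse, <- RtoC_pow, <- RtoC_mult, <- RtoC_plus in Q by lia.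
    now apply RtoC_inj in Q. }
  rewrite <- E. apply Rsum_incr; [|lia]. intros i. now apply ps_term_ge0.
Qed.

Lemma is_ps_sparse (c d : C) (k : nat) : (0 < k)%nat ->
  is_ps (sparse c k d) (fun y => c + d * y ^ k).
Proof.
  intros Hk. split.
  - intros r Hr. eexists. apply ps_bound_sparse; [lra|exact Hk].
  - intros y Hy. apply (Clim_ext_ev (fun _ => c + d * y ^ k) _ _ (S k)).
    + intros n Hn. symmetry. apply Csum_sparse. lia.
    + apply Clim_const.
Qed.

Lemma is_ps_const (c : C) : is_ps (sparse c 1 0) (fun _ => c).
Proof. refine (is_ps_ext _ _ _ _ (is_ps_sparse c 0 1 ltac:(lia))). intros; ring. Qed.

Lemma pow_n_Cpow (x : C) (n : nat) : pow_n x n = x ^ n.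
Proof. induction n as [|n IH]; [reflexivity|]. simpl. rewrite IH. reflexivity. Qed.

Lemma geom_qk_mul (x : C) (k j : nat) : (0 < k)%nat -> geom_qk x k (k * j) = x ^ j.
Proof.
  intros Hk. unfold geom_qk. rewrite (Nat.mul_comm k j), Nat.Div0.mod_mul, Nat.div_mul by lia.
  apply pow_n_Cpow.
Qed.

Lemma geom_qk_between (x : C) (k j i : nat) : (0 < i < k)%nat -> geom_qk x k (k * j + i) = 0.
Proof.
  intros Hi. unfold geom_qk. rewrite (Nat.mul_comm k j), Nat.add_comm, Nat.Div0.mod_add.
  rewrite Nat.mod_small by lia. destruct (Nat.eqb_spec i 0); [lia|reflexivity].
Qed.

Lemma Csum_geom_qk (x : C) (k J : nat) (y : C) : (0 < k)%nat ->
  Csum (fun n => geom_qk x k n * y ^ n) (k * J) = Csum (fun j => (x * y ^ k) ^ j) J.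
Proof.
  intros Hk. induction J as [|J IH]; [now rewrite Nat.mul_0_r|].
  replace (k * S J)%nat with (k * J + S (k - 1))%nat by lia.
  rewrite Csum_add, IH. simpl. f_equal. 
  change (Csum (fun i => geom_qk x k (k * J + i) * y ^ (k * J + i)) (S (k - 1)) = (x * y ^ k) ^ J).
  rewrite Csum_shift, Csum_0.
  - rewrite Nat.add_0_r, geom_qk_mul, Cpow_mult_l, <- Cpow_mult_r by exact Hk. ring.
  - intros i Hi. rewrite geom_qk_between by lia. ring.
Qed.

Lemma geom_Rsum_le (t : R) (J : nat) : (0 <= t < 1)%R -> (Rsum (fun j => t ^ j)%R J <= / (1 - t))%R.
Proof.
  intros Ht. assert (E : (Rsum (fun j => t ^ j)%R J * (1 - t) = 1 - t ^ J)%R).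
  { induction J as [|J IH]; simpl; [ring|]. rewrite Rmult_plus_distr_r, IH. ring. }
  apply Rmult_le_reg_r with (1 - t)%R; [lra|]. rewrite E, Rinv_l by lra.
  assert (0 <= t ^ J)%R by (apply pow_le; lra). lra.
Qed.

Lemma ps_bound_geom (r : R) (x : C) (k : nat) : (0 < r < 1)%R -> (0 < k)%nat -> (Cmod x <= 1)%R ->
  ps_bound r (geom_qk x k) (/ (1 - r ^ k)).
Proof.
  intros Hr Hk Hx L.
  assert (Hrk : (0 < r ^ k < 1)%R).
  { split; [apply pow_lt; lra|]. destruct k as [|k]; [lia|]. simpl.
    assert (r ^ k <= 1)%R by (rewrite <- (pow1 k); apply pow_incr; lra). 
    assert (0 < r ^ k)%R by (apply pow_lt; lra). nra. }
  apply Rle_trans with (Rsum (fun n => Cmod (geom_qk x k n) * r ^ n)%R (k * L)).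
  { apply Rsum_incr; [|nia]. intros i. apply ps_term_ge0. lra. }
  assert (E : Rsum (fun n => Cmod (geom_qk x k n) * r ^ n)%R (k * L)
              = Rsum (fun j => (Cmod x * r ^ k) ^ j)%R L).
  { assert (Q : RtoC (Rsum (fun n => Cmod (geom_qk x k n) * r ^ n)%R (k * L))
             = Csum (fun n => geom_qk (RtoC (Cmod x)) k n * RtoC r ^ n) (k * L)).
    { induction (k * L)%nat as [|M IH]; [reflexivity|]. simpl. rewrite RtoC_plus, IH, RtoC_mult, RtoC_pow.
      f_equal. f_equal. unfold geom_qk. destruct (Nat.eqb (M mod k) 0); [|now rewrite Cmod_0].
      now rewrite !pow_n_Cpow, Cmod_pow, RtoC_pow. }
    rewrite Csum_geom_qk in Q by exact Hk. rewrite <- RtoC_pow, <- RtoC_mult in Q.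
    apply RtoC_inj. rewrite Q. clear. induction L as [|L IH]; [reflexivity|]. simpl.
    rewrite RtoC_plus, IH, RtoC_pow. reflexivity. }
  rewrite E. pose proof (Cmod_ge_0 x).
  assert (Ht : (0 <= Cmod x * r ^ k <= r ^ k)%R) by nra.
  eapply Rle_trans; [apply geom_Rsum_le; lra|]. apply Rinv_le_contravar; lra.
Qed.

Lemma Cmod_mul_pow_lt1 (x y : C) (k : nat) : (0 < k)%nat -> (Cmod x <= 1)%R -> (Cmod y < 1)%R ->
  (Cmod (x * y ^ k) < 1)%R.
Proof.
  intros Hk Hx Hy. rewrite Cmod_mult, Cmod_pow. destruct k as [|k]; [lia|].
  pose proof (Cmod_ge_0 x). pose proof (Cmod_ge_0 y).
  assert (0 <= Cmod y ^ k <= 1)%R.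
  { split; [now apply pow_le|]. rewrite <- (pow1 k). apply pow_incr. lra. }
  simpl. assert (0 <= Cmod y * Cmod y ^ k < 1)%R by nra. nra.
Qed.

Lemma is_ps_geom (x : C) (k : nat) : (0 < k)%nat -> (Cmod x <= 1)%R ->
  is_ps (geom_qk x k) (fun y => / (1 - x * y ^ k)).
Proof.
  intros Hk Hx.
  assert (Hb : forall r, (0 < r < 1)%R -> exists B, ps_bound r (geom_qk x k) B).
  { intros r Hr. eexists. now apply ps_bound_geom. }
  pose proof (is_ps_of_bound _ Hb) as [_ H]. split; [exact Hb|]. intros y Hy.
  specialize (H y Hy). set (l := limC _) in H.
  replace (/ (1 - x * y ^ k)) with l; [exact H|].
  pose proof (Cmod_mul_pow_lt1 x y k Hk Hx Hy) as Ht. set (t := x * y ^ k) in *.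
  assert (T1 : 1 - t <> 0) by now apply one_minus_neq0.
  apply (Clim_subseq _ _ (fun J => k * J)%nat) in H; [|intros; nia].
  refine (Clim_unique _ _ _ H _).
  pose proof (Clim_scal (/ (1 - t)) _ _ (Clim_minus _ _ _ _ (Clim_const 1) (Clim_geom t Ht))) as G.
  replace (/ (1 - t) * (1 - 0)) with (/ (1 - t)) in G by (field; exact T1).
  refine (Clim_ext _ _ _ _ G). intros J. rewrite Csum_geom_qk by exact Hk. fold t.
  rewrite <- geom_sum. field. exact T1.
Qed.

(** * Infinite products as power series *)

Definition one_upto (k : nat) (a : nat -> C) : Prop :=
  a O = 1 /\ forall n, (0 < n < k)%nat -> a n = 0.

(** This is why the coefficient of [y^n] in an infinite product is settled by its first [n]
    factors. *)
Lemma conv_one_upto (k : nat) (a b : nat -> C) (n : nat) : one_upto k b -> (n < k)%nat \/ n = O ->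
  conv a b n = a n.
Proof.
  intros [H0 H1] Hn. rewrite conv_Csum. simpl. rewrite Nat.sub_diag, H0, Csum_0.
  - ring.
  - intros i Hi. rewrite H1 by lia. ring.
Qed.

Lemma one_upto_conv (k : nat) (a b : nat -> C) : one_upto k a -> one_upto k b -> one_upto k (conv a b).
Proof.
  intros [A0 A1] Hb. split.
  - rewrite (conv_one_upto k) by auto. exact A0.
  - intros n Hn. rewrite (conv_one_upto k) by (auto; lia). now apply A1.
Qed.

Lemma one_upto_sparse (k d : nat) (c : C) : (k <= d)%nat -> one_upto k (sparse 1 d c).
Proof.
  intros H. split; [reflexivity|]. intros n Hn. unfold sparse.
  destruct (Nat.eqb_spec n 0); [lia|]. destruct (Nat.eqb_spec n d); [lia|reflexivity].
Qed.

Lemma one_upto_geom (k d : nat) (x : C) : (0 < k <= d)%nat -> one_upto k (geom_qk x d).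
Proof.
  intros H. split.
  - replace O with (d * 0)%nat by lia. rewrite geom_qk_mul by lia. reflexivity.
  - intros n Hn. replace n with (d * 0 + n)%nat by lia. apply geom_qk_between. lia.
Qed.

(* The data of an infinite product of factors
   (1 - u_k y^{d_k}) / ((1 - v_k y^{e_k}) (1 - w_k y^{f_k})), k >= 1. *)
Record block := Block { bu : nat -> C; bd : nat -> nat; bv : nat -> C; be : nat -> nat;
                        bw : nat -> C; bf : nat -> nat }.

(** Exponents of at least [k] make the coefficients stabilise and the product converge; moduli up to
    1 admit roots of unity. A coefficient 0 with exponent [k] fills a place that a product does not
    occupy. *)
Definition block_ok (b : block) : Prop := forall k, (0 < k)%nat ->
  (Cmod (bu b k) <= 1)%R /\ (Cmod (bv b k) <= 1)%R /\ (Cmod (bw b k) <= 1)%R /\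
  (k <= bd b k)%nat /\ (k <= be b k)%nat /\ (k <= bf b k)%nat.

Definition block_factor (b : block) (k : nat) (y : C) : C :=
  (1 + - bu b k * y ^ bd b k) * (/ (1 - bv b k * y ^ be b k) * / (1 - bw b k * y ^ bf b k)).

Definition block_factor_coef (b : block) (k : nat) : nat -> C :=
  conv (sparse 1 (bd b k) (- bu b k)) (conv (geom_qk (bv b k) (be b k)) (geom_qk (bw b k) (bf b k))).

Fixpoint block_partial_coef (b : block) (N : nat) : nat -> C :=
  match N with
  | O => fun n => if Nat.eqb n 0 then 1 else 0
  | S N' => conv (block_partial_coef b N') (block_factor_coef b N)
  end.

Definition block_partial (b : block) (y : C) (N : nat) : C := Cprod (fun i => block_factor b (S i) y) N.

Definition block_coef (b : block) (n : nat) : C := block_partial_coef b n n.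

Definition block_fun (b : block) (y : C) : C := limC (Csum (fun n => block_coef b n * y ^ n)).

Lemma block_factor_one_upto (b : block) (k : nat) : block_ok b -> (0 < k)%nat ->
  one_upto k (block_factor_coef b k).
Proof.
  intros Hb Hk. destruct (Hb k Hk) as [_ [_ [_ [H1 [H2 H3]]]]].
  apply one_upto_conv; [now apply one_upto_sparse|].
  apply one_upto_conv; apply one_upto_geom; lia.
Qed.

Lemma is_ps_block_factor (b : block) (k : nat) : block_ok b -> (0 < k)%nat ->
  is_ps (block_factor_coef b k) (block_factor b k).
Proof.
  intros Hb Hk. destruct (Hb k Hk) as [Hu [Hv [Hw [H1 [H2 H3]]]]].
  apply is_ps_mult; [apply is_ps_sparse; lia|].
  apply is_ps_mult; apply is_ps_geom; auto; lia.
Qed.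

Lemma sparse_0 : (fun n : nat => if Nat.eqb n 0 then RtoC 1 else RtoC 0) = sparse 1 1 0.
Proof.
  apply functional_extensionality. intros n. unfold sparse.
  destruct (Nat.eqb n 0); [reflexivity|]. now destruct (Nat.eqb n 1).
Qed.

Lemma is_ps_block_partial (b : block) (N : nat) : block_ok b ->
  is_ps (block_partial_coef b N) (fun y => block_partial b y N).
Proof.
  intros Hb. induction N as [|N IH].
  - simpl. rewrite sparse_0. apply is_ps_const.
  - simpl. apply (is_ps_mult _ _ _ _ IH). apply is_ps_block_factor; [exact Hb|lia].
Qed.

Lemma block_partial_coef_stable (b : block) (N n : nat) : block_ok b -> (n <= N)%nat ->
  block_partial_coef b N n = block_coef b n.
Proof.
  intros Hb H. induction H as [|N H IH]; [reflexivity|].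
  simpl. rewrite (conv_one_upto (S N)); [exact IH| |lia].
  apply block_factor_one_upto; [exact Hb|lia].
Qed.

(** The [k]-th factor has a majorant [(1 + r^k)/(1 - r^k)^2], at most [exp((1 + 2/(1-r)) r^k)], and
    the powers [r^k] sum to at most [1/(1-r)]. The bound depends neither on the block nor on the
    number of factors. *)
Definition block_bound (r : R) : R := exp ((1 + 2 / (1 - r)) * / (1 - r)).

Lemma ps_bound_block_partial (b : block) (r : R) (N : nat) : block_ok b -> (0 < r < 1)%R ->
  ps_bound r (block_partial_coef b N) (block_bound r).
Proof.
  intros Hb Hr. set (Cr := (1 + 2 / (1 - r))%R).
  assert (HC : (0 < Cr)%R) by (unfold Cr; assert (0 < 2 / (1 - r))%R by (apply Rdiv_lt_0_compat; lra); lra).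
  apply (ps_bound_le r _ (exp (Cr * Rsum (fun j => r ^ j)%R (S N)))).
  { unfold block_bound. fold Cr. apply exp_le_compat, Rmult_le_compat_l; [lra|].
    apply geom_Rsum_le. lra. }
  assert (Hp : forall k, (0 < k)%nat -> (0 < r ^ k <= r)%R).
  { intros k Hk. split; [apply pow_lt; lra|]. destruct k as [|k]; [lia|]. simpl.
    assert (0 < r ^ k)%R by (apply pow_lt; lra).
    assert (r ^ k <= 1)%R by (rewrite <- (pow1 k); apply pow_incr; lra). nra. }
  assert (Hmon : forall k d, (0 < k <= d)%nat -> (0 < r ^ d <= r ^ k)%R).
  { intros k d Hk. split; [apply pow_lt; lra|]. replace d with (k + (d - k))%nat by lia.
    rewrite pow_add. assert (0 < r ^ k)%R by (apply pow_lt; lra).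
    assert (0 <= r ^ (d - k) <= 1)%R
      by (split; [apply pow_le; lra|rewrite <- (pow1 (d - k)); apply pow_incr; lra]). nra. }
  induction N as [|N IH].
  - apply (ps_bound_le r _ (Cmod 1 + Cmod 0 * r ^ 1)).
    + rewrite Cmod_1, Cmod_0, Rmult_0_l, Rplus_0_r. simpl. rewrite Rplus_0_l, Rmult_1_r.
      rewrite <- exp_0. apply exp_le_compat. lra.
    + simpl block_partial_coef. rewrite sparse_0. apply ps_bound_sparse; [lra|lia].
  - change (Rsum (fun j => r ^ j)%R (S (S N))) with (Rsum (fun j => r ^ j)%R (S N) + r ^ S N)%R.
    rewrite Rmult_plus_distr_l, exp_plus. apply ps_bound_conv; [lra|exact IH|].
    destruct (Hb (S N) ltac:(lia)) as [Hu [Hv [Hw [H1 [H2 H3]]]]].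
    destruct (Hp (S N) ltac:(lia)) as [P1 P2]. set (x := (r ^ S N)%R) in *.
    assert (inv_exp : forall d, (S N <= d)%nat -> (/ (1 - r ^ d) <= exp (/ (1 - r) * x))%R).
    { intros d Hd. destruct (Hmon (S N) d ltac:(lia)) as [Q1 Q2]. fold x in Q2.
      apply Rle_trans with (1 + / (1 - r) * x)%R; [|apply exp_ineq1_le].
      apply Rle_trans with (/ (1 - x))%R; [apply Rinv_le_contravar; lra|].
      replace (/ (1 - x))%R with (1 + / (1 - x) * x)%R by (field; lra).
      apply Rplus_le_compat_l. apply Rmult_le_compat_r; [lra|]. apply Rinv_le_contravar; lra. }
    apply (ps_bound_le r _ ((Cmod 1 + Cmod (- bu b (S N)) * r ^ bd b (S N)) *
             (/ (1 - r ^ be b (S N)) * / (1 - r ^ bf b (S N))))%R).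
    + replace (Cr * x)%R with (x + (/ (1 - r) * x + / (1 - r) * x))%R by (unfold Cr; field; lra).
      rewrite !exp_plus.
      destruct (Hmon (S N) (bd b (S N)) ltac:(lia)) as [D1 D2]. fold x in D2.
      destruct (Hmon (S N) (be b (S N)) ltac:(lia)) as [E1 E2]. fold x in E2.
      destruct (Hmon (S N) (bf b (S N)) ltac:(lia)) as [F1 F2]. fold x in F2.
      rewrite Cmod_1, Cmod_opp. pose proof (Cmod_ge_0 (bu b (S N))).
      apply Rmult_le_compat.
      * nra.
      * apply Rmult_le_pos; left; apply Rinv_0_lt_compat; lra.
      * eapply Rle_trans; [|apply exp_ineq1_le]. nra.
      * apply Rmult_le_compat; try (left; apply Rinv_0_lt_compat; lra); now apply inv_exp.
    + apply ps_bound_conv; [lra|apply ps_bound_sparse; [lra|lia]|].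
      apply ps_bound_conv; [lra| |]; apply ps_bound_geom; auto; lia.
Qed.

Lemma is_ps_block (b : block) : block_ok b -> is_ps (block_coef b) (block_fun b).
Proof.
  intros Hb. apply is_ps_of_bound. intros r Hr. exists (block_bound r). intros L.
  pose proof (ps_bound_block_partial b r L Hb Hr L) as H.
  rewrite (Rsum_ext _ (fun n => Cmod (block_coef b n) * r ^ n)%R) in H; [exact H|].
  intros n Hn. rewrite block_partial_coef_stable by (auto; lia). reflexivity.
Qed.

(** The first [N] coefficients of the [N]-th partial product are already the final ones; its
    remaining terms are a tail of order [rho^N], because the majorant is uniform in [N]. *)
Lemma block_lim (b : block) (y : C) : block_ok b -> (Cmod y < 1)%R ->
  Clim (block_partial b y) (block_fun b y).
Proof.
  intros Hb Hy. destruct (mid_radius y Hy) as [r [rho [Hr [Hrho Hyr]]]].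
  pose proof (is_ps_block b Hb) as [_ HF]. specialize (HF y Hy).
  assert (Z : Clim (fun N => block_partial b y N - Csum (fun n => block_coef b n * y ^ n) N) 0).
  { apply (Clim_le_real _ _ (fun N => block_bound r * rho ^ N)%R).
    - replace (Finite 0) with (Rbar_mult (Finite (block_bound r)) (Finite 0)) by (simpl; f_equal; ring).
      apply is_lim_seq_scal_l, is_lim_seq_rpow, Hrho.
    - intros N. replace (block_partial b y N - Csum (fun n => block_coef b n * y ^ n) N - 0)
        with (block_partial b y N - Csum (fun n => block_coef b n * y ^ n) N) by ring.
      pose proof (is_ps_block_partial b N Hb) as [_ HP].
      pose proof (ps_tail _ _ r _ rho y N ltac:(lra) ltac:(lra) Hyr
                    (ps_bound_block_partial b r N Hb Hr) (HP y Hy)) as T.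
      rewrite (Csum_ext _ (fun n => block_coef b n * y ^ n)) in T.
      + lra.
      + intros n Hn. rewrite block_partial_coef_stable by (auto; lia). reflexivity. }
  pose proof (Clim_plus _ _ _ _ Z HF) as H. rewrite Cplus_0_l in H.
  refine (Clim_ext _ _ _ _ H). intros N. cbv beta. ring.
Qed.

Definition crank_block (x : C) : block :=
  Block (fun _ => 1) (fun k => k) (fun _ => x) (fun k => k) (fun _ => / x) (fun k => k).

Lemma crank_partial_block (x : C) (N : nat) : crank_partial x N = block_partial_coef (crank_block x) N.
Proof.
  induction N as [|N IH]; [reflexivity|]. simpl. rewrite IH. f_equal.
  unfold crank_factor, block_factor_coef. f_equal. unfold crank_block; simpl.
  apply functional_extensionality. intros n. unfold one_minus_qk, sparse.
  destruct (Nat.eqb n 0); [reflexivity|]. destruct (Nat.eqb n (S N)); [|reflexivity].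
  ring.
Qed.

Lemma crank_coef_block (x : C) (n : nat) : crank_coef x (Z.of_nat n) = block_coef (crank_block x) n.
Proof.
  unfold crank_coef. destruct (Z.ltb_spec (Z.of_nat n) 0); [lia|]. rewrite Nat2Z.id.
  now rewrite crank_partial_block.
Qed.

Lemma crank_block_ok (x : C) : Cmod x = 1%R -> block_ok (crank_block x).
Proof.
  intros Hx k Hk. unfold crank_block; simpl.
  assert (x <> 0) by (apply Cmod_neq0; lra).
  rewrite Cmod_inv, Hx, Cmod_1, Rinv_1 by assumption. repeat split; auto; lra.
Qed.

(** * Expansions in fractional powers of q *)

(* The quadratic remainder is more than differentiability asks for, but it makes products and
   compositions one-line estimates. *)
Definition Cdiff (f : C -> C) (z : C) : Prop :=
  exists (D : C) (K d : R), (0 < d <= 1)%R /\ (0 <= K)%R /\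
    forall h, (Cmod h <= d)%R -> (Cmod (f (z + h) - f z - h * D)%C <= K * Cmod h ^ 2)%R.

Lemma Cdiff_ex_derive (f : C -> C) (z : C) : Cdiff f z -> @ex_derive C_AbsRing C_NormedModule f z.
Proof.
  intros [D [K [d [Hd [HK H]]]]]. exists D. split; [apply is_linear_scal_l|].
  intros x Hx. apply (@is_filter_lim_locally_unique C_AbsRing (AbsRing_NormedModule C_AbsRing)) in Hx. subst x. intros eps.
  assert (He : (0 < Rmin d (eps / (K + 1)))%R).
  { apply Rmin_glb_lt; [lra|]. apply Rdiv_lt_0_compat; [apply cond_pos|lra]. }
  exists (mkposreal _ He). intros y Hy. change C in y.
  change (Cmod (y - z) < Rmin d (eps / (K + 1)))%R in Hy.
  change (Cmod ((f y - f z) - (y - z) * D) <= eps * Cmod (y - z))%R.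
  assert (Hy1 : (Cmod (y - z) < d)%R) by (eapply Rlt_le_trans; [exact Hy|apply Rmin_l]).
  assert (Hy2 : (Cmod (y - z) < eps / (K + 1))%R) by (eapply Rlt_le_trans; [exact Hy|apply Rmin_r]).
  specialize (H (y - z) ltac:(lra)). replace (z + (y - z)) with y in H by ring.
  eapply Rle_trans; [exact H|]. pose proof (Cmod_ge_0 (y - z)). set (t := Cmod (y - z)) in *.
  apply (Rmult_lt_compat_r (K + 1)) in Hy2; [|lra].
  replace (eps / (K + 1) * (K + 1))%R with (pos eps) in Hy2 by (field; lra). nra.
Qed.

Lemma Cdiff_ext (f g : C -> C) (z : C) (d : R) : (0 < d)%R ->
  (forall h, (Cmod h < d)%R -> f (z + h) = g (z + h)) -> Cdiff f z -> Cdiff g z.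
Proof.
  intros Hd E [D [K [d' [Hd' [HK H]]]]]. exists D, K, (Rmin (d / 2) d').
  assert (Rmin (d / 2) d' <= d')%R by apply Rmin_r.
  assert (Rmin (d / 2) d' <= d / 2)%R by apply Rmin_l.
  split; [split; [apply Rmin_glb_lt; lra|lra]|]. split; [exact HK|]. intros h Hh.
  rewrite <- (E h) by lra. pose proof (E 0 ltac:(rewrite Cmod_0; lra)) as E0.
  rewrite Cplus_0_r in E0. rewrite <- E0. apply H. lra.
Qed.

Lemma Cdiff_mult (f g : C -> C) (z : C) : Cdiff f z -> Cdiff g z -> Cdiff (fun w => f w * g w) z.
Proof.
  intros [D [K [d [Hd [HK H]]]]] [D' [K' [d' [Hd' [HK' H']]]]].
  exists (D * g z + f z * D'), (Cmod D * Cmod D' + K * (Cmod (g z) + Cmod D' + K') + K' * (Cmod (f z) + Cmod D))%R,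
    (Rmin d d').
  assert (Rmin d d' <= d)%R by apply Rmin_l. assert (Rmin d d' <= d')%R by apply Rmin_r.
  pose proof (Cmod_ge_0 D). pose proof (Cmod_ge_0 D'). pose proof (Cmod_ge_0 (f z)). pose proof (Cmod_ge_0 (g z)).
  split; [split; [apply Rmin_glb_lt; lra|lra]|]. split.
  { repeat apply Rplus_le_le_0_compat; apply Rmult_le_pos; lra. }
  intros h Hh. specialize (H h ltac:(lra)). specialize (H' h ltac:(lra)).
  set (rf := f (z + h) - f z - h * D) in *. set (rg := g (z + h) - g z - h * D') in *.
  replace (f (z + h) * g (z + h) - f z * g z - h * (D * g z + f z * D'))
    with (h ^ 2 * (D * D') + rf * (g z + h * D' + rg) + rg * (f z + h * D)) by (unfold rf, rg; ring).
  pose proof (Cmod_ge_0 h) as h0. set (t := Cmod h) in *.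
  assert (t2 : (0 <= t ^ 2 <= 1)%R) by (split; [apply pow2_ge_0|]; nra).
  assert (Q1 : (Cmod (g z + h * D' + rg) <= Cmod (g z) + Cmod D' + K')%R).
  { eapply Rle_trans; [apply Cmod_triangle|]. apply Rplus_le_compat; [|nra].
    eapply Rle_trans; [apply Cmod_triangle|]. rewrite Cmod_mult. fold t. nra. }
  assert (Q2 : (Cmod (f z + h * D) <= Cmod (f z) + Cmod D)%R).
  { eapply Rle_trans; [apply Cmod_triangle|]. rewrite Cmod_mult. fold t. nra. }
  eapply Rle_trans; [apply Cmod_triangle|].
  eapply Rle_trans; [apply Rplus_le_compat_r, Cmod_triangle|].
  rewrite !Cmod_mult, Cmod_pow. fold t.
  assert (S1 : (Cmod rf * Cmod (g z + h * D' + rg) <= K * t ^ 2 * (Cmod (g z) + Cmod D' + K'))%R)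
    by (apply Rmult_le_compat; try apply Cmod_ge_0; assumption).
  assert (S2 : (Cmod rg * Cmod (f z + h * D) <= K' * t ^ 2 * (Cmod (f z) + Cmod D))%R)
    by (apply Rmult_le_compat; try apply Cmod_ge_0; assumption).
  lra.
Qed.

Lemma Cdiff_comp (f g : C -> C) (z : C) : Cdiff g z -> Cdiff f (g z) -> Cdiff (fun w => f (g w)) z.
Proof.
  intros [D [K [d [Hd [HK H]]]]] [D' [K' [d' [Hd' [HK' H']]]]].
  pose proof (Cmod_ge_0 D). pose proof (Cmod_ge_0 D').
  set (L := (Cmod D + K)%R). assert (HL : (0 <= L)%R) by (unfold L; lra).
  exists (D * D'), (K' * L ^ 2 + Cmod D' * K)%R, (Rmin d (d' / (L + 1))).
  assert (Rmin d (d' / (L + 1)) <= d)%R by apply Rmin_l.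
  assert (Rmin d (d' / (L + 1)) <= d' / (L + 1))%R by apply Rmin_r.
  assert (0 < d' / (L + 1))%R by (apply Rdiv_lt_0_compat; lra).
  split; [split; [apply Rmin_glb_lt; lra|lra]|]. split; [assert (0 <= L ^ 2)%R by apply pow2_ge_0; nra|].
  intros h Hh. specialize (H h ltac:(lra)). set (k := g (z + h) - g z) in *.
  pose proof (Cmod_ge_0 h) as h0. set (t := Cmod h) in *.
  assert (Bk : (Cmod k <= L * t)%R).
  { replace k with (h * D + (k - h * D)) by ring. eapply Rle_trans; [apply Cmod_triangle|].
    rewrite Cmod_mult. fold t. unfold L.
    assert (t <= 1)%R by lra. assert (t ^ 2 <= t)%R by nra.
    assert (K * t ^ 2 <= K * t)%R by (apply Rmult_le_compat_l; lra). lra. }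
  assert (Bk2 : (Cmod k <= d')%R).
  { assert (t * (L + 1) <= d')%R; [|nra].
    apply Rle_trans with (d' / (L + 1) * (L + 1))%R; [apply Rmult_le_compat_r; lra|].
    right. field. lra. }
  specialize (H' k Bk2). replace (g z + k) with (g (z + h)) in H' by (unfold k; ring).
  replace (f (g (z + h)) - f (g z) - h * (D * D'))
    with ((f (g (z + h)) - f (g z) - k * D') + D' * (k - h * D)) by ring.
  eapply Rle_trans; [apply Cmod_triangle|]. rewrite Cmod_mult.
  assert (Cmod k ^ 2 <= (L * t) ^ 2)%R by (apply pow_incr; split; [apply Cmod_ge_0|exact Bk]).
  assert (K' * Cmod k ^ 2 <= K' * (L * t) ^ 2)%R by (apply Rmult_le_compat_l; lra).
  assert (Cmod D' * Cmod (k - h * D) <= Cmod D' * (K * t ^ 2))%R by (apply Rmult_le_compat_l; lra).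
  replace ((K' * L ^ 2 + Cmod D' * K) * t ^ 2)%R with (K' * (L * t) ^ 2 + Cmod D' * (K * t ^ 2))%R by ring.
  lra.
Qed.

Lemma Cdiff_e2pi (c z : C) : Cdiff (fun w => e2pi (c * w)) z.
Proof.
  set (k := two_pi_i * c). exists (e2pi (c * z) * k), (Cmod (e2pi (c * z)) * (Cmod k ^ 2 * exp (Cmod k)))%R, 1%R.
  split; [lra|]. split.
  { apply Rmult_le_pos; [apply Cmod_ge_0|]. apply Rmult_le_pos; [apply pow2_ge_0|left; apply exp_pos]. }
  intros h Hh.
  replace (e2pi (c * (z + h)) - e2pi (c * z) - h * (e2pi (c * z) * k))
    with (e2pi (c * z) * (cexp (k * h) - 1 - k * h)).
  2:{ replace (c * (z + h)) with (c * z + c * h) by ring. rewrite e2pi_plus, (e2pi_cexp (c * h)).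
      replace (two_pi_i * (c * h)) with (k * h) by (unfold k; ring). ring. }
  rewrite Cmod_mult, Rmult_assoc. apply Rmult_le_compat_l; [apply Cmod_ge_0|].
  eapply Rle_trans; [apply cexp_sub_1_sub_le|]. rewrite Cmod_mult.
  pose proof (Cmod_ge_0 k). pose proof (Cmod_ge_0 h).
  assert (exp (Cmod k * Cmod h) <= exp (Cmod k))%R by (apply exp_le_compat; nra).
  replace (Cmod k ^ 2 * exp (Cmod k) * Cmod h ^ 2)%R with ((Cmod k * Cmod h) ^ 2 * exp (Cmod k))%R by ring.
  apply Rmult_le_compat_l; [apply pow2_ge_0|assumption].
Qed.

(** Here and in the next two lemmas the binomial expansion of [(Cmod y + d)^n] is the majorant: a
    term of degree [j] in [h] gains [(Cmod h / d)^j], which is at most the power belonging to the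
    lowest surviving degree. *)
Lemma pow_increment_le (y h : C) (d : R) (n : nat) : (0 < d)%R -> (Cmod h <= d)%R ->
  (Cmod ((y + h) ^ n - y ^ n) <= Cmod h / d * (Cmod y + d) ^ n)%R.
Proof.
  intros Hd Hh. pose proof (Cmod_ge_0 y). pose proof (Cmod_ge_0 h).
  induction n as [|n IH].
  - simpl. replace (1 - 1) with (RtoC 0) by ring. rewrite Cmod_0.
    assert (0 <= Cmod h / d)%R by (apply Rdiv_le_0_compat; lra). lra.
  - rewrite !Cpow_S.
    replace ((y + h) * (y + h) ^ n - y * y ^ n) with (y * ((y + h) ^ n - y ^ n) + h * (y + h) ^ n) by ring.
    eapply Rle_trans; [apply Cmod_triangle|]. rewrite !Cmod_mult, Cmod_pow.
    assert (P : (Cmod (y + h) ^ n <= (Cmod y + d) ^ n)%R).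
    { apply pow_incr. split; [apply Cmod_ge_0|]. eapply Rle_trans; [apply Cmod_triangle|]. lra. }
    replace (Cmod h / d * (Cmod y + d) ^ S n)%R
      with (Cmod y * (Cmod h / d * (Cmod y + d) ^ n) + Cmod h * (Cmod y + d) ^ n)%R by (simpl; field; lra).
    apply Rplus_le_compat; apply Rmult_le_compat_l; assumption.
Qed.

Lemma pow_taylor_le (y h : C) (d : R) (n : nat) : (0 < d)%R -> (Cmod h <= d)%R ->
  (Cmod ((y + h) ^ n - y ^ n - h * (RtoC (INR n) * y ^ pred n)) <= (Cmod h / d) ^ 2 * (Cmod y + d) ^ n)%R.
Proof.
  intros Hd Hh. pose proof (Cmod_ge_0 y). pose proof (Cmod_ge_0 h).
  induction n as [|n IH].
  - rewrite INR_0. simpl. replace (1 - 1 - h * (0 * 1)) with (RtoC 0) by ring. rewrite Cmod_0.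
    assert (0 <= Cmod h / d)%R by (apply Rdiv_le_0_compat; lra). nra.
  - assert (E : (y + h) ^ S n - y ^ S n - h * (RtoC (INR (S n)) * y ^ pred (S n))
              = y * ((y + h) ^ n - y ^ n - h * (RtoC (INR n) * y ^ pred n)) + h * ((y + h) ^ n - y ^ n)).
    { rewrite !Cpow_S, S_INR, RtoC_plus. simpl pred. destruct n as [|n].
      - rewrite INR_0. simpl. ring.
      - simpl pred. rewrite !Cpow_S. ring. }
    rewrite E. eapply Rle_trans; [apply Cmod_triangle|]. rewrite !Cmod_mult.
    pose proof (pow_increment_le y h d n Hd Hh) as P.
    replace ((Cmod h / d) ^ 2 * (Cmod y + d) ^ S n)%R
      with (Cmod y * ((Cmod h / d) ^ 2 * (Cmod y + d) ^ n) + Cmod h * (Cmod h / d * (Cmod y + d) ^ n))%R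
      by (simpl; field; lra).
    apply Rplus_le_compat; apply Rmult_le_compat_l; assumption.
Qed.

Lemma pow_deriv_le (y : C) (d : R) (n : nat) : (0 < d)%R ->
  (d * (INR n * Cmod y ^ pred n) <= (Cmod y + d) ^ n)%R.
Proof.
  intros Hd. pose proof (Cmod_ge_0 y) as Hy. set (t := Cmod y) in *.
  destruct n as [|n]; [simpl; lra|]. simpl pred.
  induction n as [|n IH]; [simpl; lra|].
  assert (P : (t ^ S n <= (t + d) ^ S n)%R) by (apply pow_incr; lra).
  rewrite (S_INR (S n)).
  replace (d * ((INR (S n) + 1) * t ^ S n))%R with (t * (d * (INR (S n) * t ^ n)) + d * t ^ S n)%R by (simpl; ring).
  replace ((t + d) ^ S (S n))%R with (t * (t + d) ^ S n + d * (t + d) ^ S n)%R by (simpl; ring).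
  apply Rplus_le_compat; apply Rmult_le_compat_l; lra.
Qed.

(** With [rho = Cmod y + d] still below 1, the majorant at [rho] controls the formal derivative and
    all quadratic remainders at once, so the termwise estimate survives the limit. *)
Lemma is_ps_Cdiff (a : nat -> C) (f : C -> C) (y : C) : is_ps a f -> (Cmod y < 1)%R -> Cdiff f y.
Proof.
  intros [H1 H2] Hy. pose proof (Cmod_ge_0 y) as Hy0.
  set (d := ((1 - Cmod y) / 2)%R). assert (Hd : (0 < d)%R) by (unfold d; lra).
  set (rho := (Cmod y + d)%R). assert (Hrho : (0 < rho < 1)%R) by (unfold rho, d; lra).
  destruct (H1 rho Hrho) as [B HB].
  assert (HB0 : (0 <= B)%R) by now apply (ps_bound_ge0 rho a).
  destruct (Clim_Csum_abs (fun n => a n * (RtoC (INR n) * y ^ pred n))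
              (fun n => / d * (Cmod (a n) * rho ^ n))%R (/ d * B)%R) as [D [HD _]].
  - intros n. rewrite !Cmod_mult, Cmod_pow, Cmod_R, Rabs_right by (apply Rle_ge, pos_INR).
    pose proof (pow_deriv_le y d n Hd) as P. fold rho in P.
    replace (/ d * (Cmod (a n) * rho ^ n))%R with (Cmod (a n) * (/ d * rho ^ n))%R by ring.
    apply Rmult_le_compat_l; [apply Cmod_ge_0|].
    apply (Rmult_le_compat_l (/ d)) in P; [|left; now apply Rinv_0_lt_compat].
    rewrite <- Rmult_assoc, Rinv_l, Rmult_1_l in P by lra. exact P.
  - intros n. rewrite Rsum_scal. apply Rmult_le_compat_l; [left; now apply Rinv_0_lt_compat|apply HB].
  - exists D, (B / d ^ 2)%R, d. split; [unfold d; lra|].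
    split; [apply Rdiv_le_0_compat; [exact HB0|nra]|]. intros h Hh.
    assert (Hyh : (Cmod (y + h) < 1)%R).
    { eapply Rle_lt_trans; [apply Cmod_triangle|]. fold rho in Hrho. unfold rho in Hrho. lra. }
    pose proof (Clim_minus _ _ _ _ (Clim_minus _ _ _ _ (H2 (y + h) Hyh) (H2 y Hy)) (Clim_scal h _ _ HD)) as L.
    apply (Clim_Cmod_le _ _ _ O L). intros n _.
    replace (Csum (fun n => a n * (y + h) ^ n) n - Csum (fun n => a n * y ^ n) n
             - h * Csum (fun n => a n * (RtoC (INR n) * y ^ pred n)) n)
      with (Csum (fun n => a n * ((y + h) ^ n - y ^ n - h * (RtoC (INR n) * y ^ pred n))) n).
    2:{ rewrite <- Csum_scal.
        rewrite (Csum_ext _ (fun n => a n * (y + h) ^ n + (-1 * (a n * y ^ n)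
                  + -1 * (h * (a n * (RtoC (INR n) * y ^ pred n)))))) by (intros; ring).
        rewrite !Csum_plus, !Csum_scal. ring. }
    eapply Rle_trans; [apply Cmod_Csum|].
    apply Rle_trans with (Rsum (fun n => (Cmod h / d) ^ 2 * (Cmod (a n) * rho ^ n))%R n).
    + apply Rsum_le. intros i _. rewrite Cmod_mult.
      pose proof (pow_taylor_le y h d i Hd Hh) as P. fold rho in P.
      replace ((Cmod h / d) ^ 2 * (Cmod (a i) * rho ^ i))%R
        with (Cmod (a i) * ((Cmod h / d) ^ 2 * rho ^ i))%R by ring.
      apply Rmult_le_compat_l; [apply Cmod_ge_0|exact P].
    + rewrite Rsum_scal. replace (B / d ^ 2 * Cmod h ^ 2)%R with ((Cmod h / d) ^ 2 * B)%R by (field; lra).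
      apply Rmult_le_compat_l; [apply pow2_ge_0|apply HB].
Qed.

(** * Functions with a finite principal part at infinity *)

Definition qroot (M : positive) (z : C) : C := e2pi (RtoC (/ IZR (Zpos M)) * z).

(** The class closed under sums and products from which holomorphy ([mero_holomorphic]) and the cusp
    expansions ([mero_expansion]) are both read off. *)
Definition mero (M : positive) (f : C -> C) : Prop :=
  exists (N : nat) (a : nat -> C) (F : C -> C), is_ps a F /\
    forall z, upper_half z -> f z = / qroot M z ^ N * F (qroot M z).

Lemma Zpos_pos (M : positive) : (0 < IZR (Zpos M))%R.
Proof. apply IZR_lt. lia. Qed.

Lemma qroot_lt1 (M : positive) (z : C) : upper_half z -> (Cmod (qroot M z) < 1)%R.
Proof.
  intros H. apply e2pi_Cmod_lt1, upper_half_scal; [exact H|]. apply Rinv_0_lt_compat, Zpos_pos.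
Qed.

Lemma qroot_neq0 (M : positive) (z : C) : qroot M z <> 0.
Proof. apply e2pi_neq0. Qed.

Lemma mero_ext (M : positive) (f g : C -> C) :
  (forall z, upper_half z -> f z = g z) -> mero M f -> mero M g.
Proof.
  intros E [N [a [F [H1 H2]]]]. exists N, a, F. split; [exact H1|]. intros z Hz.
  rewrite <- E by exact Hz. now apply H2.
Qed.

Lemma mero_ps (M : positive) (a : nat -> C) (F : C -> C) : is_ps a F -> mero M (fun z => F (qroot M z)).
Proof.
  intros H. exists O, a, F. split; [exact H|]. intros z _. simpl. field.
Qed.

Lemma mero_const (M : positive) (c : C) : mero M (fun _ => c).
Proof. exact (mero_ps M _ _ (is_ps_const c)). Qed.

Lemma mero_mult (M : positive) (f g : C -> C) : mero M f -> mero M g -> mero M (fun z => f z * g z).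
Proof.
  intros [N [a [F [H1 H2]]]] [N' [b [G [H1' H2']]]].
  exists (N + N')%nat, (conv a b), (fun y => F y * G y). split; [now apply is_ps_mult|].
  intros z Hz. rewrite H2, H2' by exact Hz. rewrite Cpow_add_r.
  field. split; apply Cpow_nz, qroot_neq0.
Qed.

Lemma is_ps_pow (k : nat) : exists a, is_ps a (fun y => y ^ k).
Proof.
  destruct k as [|k].
  - eexists. exact (is_ps_const 1).
  - eexists. refine (is_ps_ext _ _ _ _ (is_ps_sparse 0 1 (S k) ltac:(lia))). intros; ring.
Qed.

Lemma mero_plus (M : positive) (f g : C -> C) : mero M f -> mero M g -> mero M (fun z => f z + g z).
Proof.
  intros [N [a [F [H1 H2]]]] [N' [b [G [H1' H2']]]].
  destruct (is_ps_pow N) as [c Hc]. destruct (is_ps_pow N') as [c' Hc'].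
  exists (N + N')%nat. eexists. exists (fun y => y ^ N' * F y + y ^ N * G y). split.
  - apply is_ps_plus; (apply is_ps_mult; eassumption).
  - intros z Hz. rewrite H2, H2' by exact Hz. rewrite Cpow_add_r.
    field. split; apply Cpow_nz, qroot_neq0.
Qed.

Lemma mero_scal (M : positive) (c : C) (f : C -> C) : mero M f -> mero M (fun z => c * f z).
Proof. apply (mero_mult M (fun _ => c)), mero_const. Qed.

Lemma mero_Csum (M : positive) (f : nat -> C -> C) (n : nat) :
  (forall i, (i < n)%nat -> mero M (f i)) -> mero M (fun z => Csum (fun i => f i z) n).
Proof.
  induction n as [|n IH]; intros H; simpl; [apply mero_const|].
  apply mero_plus; [apply IH; intros; apply H; lia|apply H; lia].
Qed.

Lemma mero_Cprod (M : positive) (f : nat -> C -> C) (n : nat) :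
  (forall i, (i < n)%nat -> mero M (f i)) -> mero M (fun z => Cprod (fun i => f i z) n).
Proof.
  induction n as [|n IH]; intros H; simpl; [apply mero_const|].
  apply mero_mult; [apply IH; intros; apply H; lia|apply H; lia].
Qed.

Lemma qroot_pow (M : positive) (z : C) (k : nat) :
  qroot M z ^ k = e2pi (RtoC (INR k / IZR (Zpos M)) * z).
Proof.
  unfold qroot. rewrite e2pi_pow. f_equal. unfold Rdiv. rewrite RtoC_mult. ring.
Qed.

Lemma mero_e2pi (M : positive) (i : Z) : mero M (fun z => e2pi (RtoC (IZR i / IZR (Zpos M)) * z)).
Proof.
  pose proof (Zpos_pos M) as HM.
  destruct (Z_le_gt_dec 0 i) as [H|H].
  - destruct (is_ps_pow (Z.to_nat i)) as [a Ha].
    refine (mero_ext M _ _ _ (mero_ps M _ _ Ha)). intros z _. rewrite qroot_pow, INR_IZR_INZ.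
    now rewrite Z2Nat.id by exact H.
  - exists (Z.to_nat (- i)). eexists. exists (fun _ => 1). split; [apply is_ps_const|].
    intros z _. rewrite qroot_pow, INR_IZR_INZ, Z2Nat.id by lia. rewrite opp_IZR.
    rewrite <- e2pi_opp, Cmult_1_r. f_equal. rewrite <- Ropp_div_distr_l, RtoC_opp. ring.
Qed.

Lemma mero_block (M : positive) (b : block) : block_ok b -> mero M (fun z => block_fun b (qroot M z)).
Proof. intros H. exact (mero_ps M _ _ (is_ps_block b H)). Qed.

Lemma mero_Cdiff (M : positive) (f : C -> C) (z : C) : mero M f -> upper_half z -> Cdiff f z.
Proof.
  intros [N [a [F [H1 H2]]]] Hz. set (c := RtoC (/ IZR (Zpos M))).
  apply (Cdiff_ext (fun w => e2pi (- (RtoC (INR N) * c) * w) * F (e2pi (c * w))) f z (Im z)); [exact Hz| |].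
  - intros h Hh.
    assert (Hu : upper_half (z + h)).
    { unfold upper_half in *. rewrite im_plus. pose proof (im_le_Cmod h) as B.
      apply Rabs_le_between in B. lra. }
    rewrite (H2 _ Hu). unfold qroot. fold c. f_equal. rewrite e2pi_pow, <- e2pi_opp. f_equal. ring.
  - apply Cdiff_mult; [apply Cdiff_e2pi|]. apply (Cdiff_comp F (fun w => e2pi (c * w))); [apply Cdiff_e2pi|].
    apply (is_ps_Cdiff a); [exact H1|]. exact (qroot_lt1 M z Hz).
Qed.

Lemma mero_holomorphic (M : positive) (f : C -> C) : mero M f -> holomorphic_on_H f.
Proof. intros H z Hz. apply Cdiff_ex_derive. now apply (mero_Cdiff M). Qed.

Lemma Csum_support (f : nat -> C) (m n : nat) : (forall i, (i < m)%nat -> f i = 0) ->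
  Csum f (m + n) = Csum (fun i => f (m + i)%nat) n.
Proof. intros H. rewrite Csum_add, Csum_0 by exact H. ring. Qed.

Lemma mero_expansion (M : positive) (f : C -> C) : mero M f ->
  exists (N0 : Z) (a : Z -> C), (forall n, (n < N0)%Z -> a n = RtoC 0) /\
    forall z, upper_half z ->
      converges_to (fun L => sum_n (fun j =>
          let n := (Z.of_nat j - Z.of_nat L)%Z in
          Cmult (a n) (qpow (IZR n / IZR (Zpos M)) z)) (2 * L)%nat) (f z).
Proof.
  intros [N [a [F [[_ H1] H2]]]]. exists (- Z.of_nat N)%Z.
  exists (fun n => if Z.ltb n (- Z.of_nat N) then RtoC 0 else a (Z.to_nat (n + Z.of_nat N))). split.
  - intros n Hn. destruct (Z.ltb_spec n (- Z.of_nat N)); [reflexivity|lia].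
  - intros z Hz. apply Clim_converges_to. rewrite (H2 z Hz).
    pose proof (qroot_neq0 M z) as Q0. set (q := qroot M z) in *.
    pose proof (Clim_scal (/ q ^ N) _ _ (H1 q (qroot_lt1 M z Hz))) as L.
    (* The symmetric window from [-n] to [n] consists of [n - N] zero terms below the principal part
       and then the first [n + N + 1] terms of the series. *)
    apply (Clim_subseq _ _ (fun n => S (n + N))%nat) in L; [|intros; lia].
    apply (Clim_ext_ev _ _ _ N) with (2 := L). intros n Hn. rewrite sum_n_Csum.
    replace (S (2 * n)) with ((n - N) + S (n + N))%nat by lia.
    rewrite Csum_support.
    + rewrite <- Csum_scal. apply Csum_ext. intros i Hi. cbv zeta.
      replace (Z.of_nat (n - N + i) - Z.of_nat n)%Z with (Z.of_nat i - Z.of_nat N)%Z by lia.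
      destruct (Z.ltb_spec (Z.of_nat i - Z.of_nat N) (- Z.of_nat N)); [lia|].
      replace (Z.to_nat (Z.of_nat i - Z.of_nat N + Z.of_nat N)) with i by lia.
      replace (qpow (IZR (Z.of_nat i - Z.of_nat N) / IZR (Zpos M)) z) with (q ^ i * / q ^ N); [ring|].
      unfold q. rewrite !qroot_pow, <- e2pi_opp, <- e2pi_plus. unfold qpow. f_equal.
      rewrite minus_IZR, <- !INR_IZR_INZ. unfold Rdiv. rewrite Rmult_minus_distr_r, RtoC_minus. ring.
    + intros i Hi. cbv zeta.
      destruct (Z.ltb_spec (Z.of_nat i - Z.of_nat n) (- Z.of_nat N)); [ring|lia].
Qed.

(** A common denominator for all exponents of [q] that occur: a Klein form with first index [i/P]
    starts at [(i^2 - i P)/(2 P^2)] and continues in steps from [(1/P) Z]. *)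
Definition cusp_width (P : nat) : positive := Pos.of_nat (2 * P * P).

Lemma IZR_cusp_width (P : nat) : (0 < P)%nat -> IZR (Zpos (cusp_width P)) = (2 * INR P * INR P)%R.
Proof.
  intros H. unfold cusp_width. rewrite <- positive_nat_Z, Nat2Pos.id by nia.
  rewrite <- INR_IZR_INZ, !mult_INR. reflexivity.
Qed.

Lemma qroot_cusp_width_pow (P k : nat) (z : C) : (0 < P)%nat ->
  qroot (cusp_width P) z ^ (2 * P * k) = e2pi (RtoC (INR k / INR P) * z).
Proof.
  intros H. rewrite qroot_pow, IZR_cusp_width by exact H. f_equal. f_equal. f_equal.
  rewrite !mult_INR. change (INR 2) with 2%R. field. apply not_0_INR. lia.
Qed.

(* The blocks below give the two halves of prod (1 - q^k x)(1 - q^k / x) / (1 - q^k)^2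
   with x = om q^(i/P), in the variable q^(1/(2 P^2)), and of its inverse. *)
Definition kb1 (P i : nat) (om : C) : block :=
  Block (fun _ => om) (fun k => 2 * P * (P * k + i))%nat
        (fun _ => 1) (fun k => 2 * P * (P * k))%nat (fun _ => 1) (fun k => 2 * P * (P * k))%nat.
Definition kb2 (P i : nat) (om : C) : block :=
  Block (fun _ => / om) (fun k => 2 * P * (P * k - i))%nat (fun _ => 0) (fun k => k) (fun _ => 0) (fun k => k).
Definition kb3 (P i : nat) (om : C) : block :=
  Block (fun _ => 1) (fun k => 2 * P * (P * k))%nat
        (fun _ => om) (fun k => 2 * P * (P * k + i))%nat (fun _ => / om) (fun k => 2 * P * (P * k - i))%nat.
Definition kb4 (P : nat) : block :=
  Block (fun _ => 1) (fun k => 2 * P * (P * k))%nat (fun _ => 0) (fun k => k) (fun _ => 0) (fun k => k).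

Lemma kb_ok (P i : nat) (om : C) : (i < P)%nat -> Cmod om = 1%R ->
  block_ok (kb1 P i om) /\ block_ok (kb2 P i om) /\ block_ok (kb3 P i om) /\ block_ok (kb4 P).
Proof.
  intros Hi Ho. assert (om <> 0) by (apply Cmod_neq0; lra).
  assert (A : forall k, (0 < k)%nat -> (k <= 2 * P * (P * k - i))%nat).
  { intros k Hk. assert (1 <= P * k - i)%nat by nia.
    assert (P * k - i >= k)%nat by nia. nia. }
  assert (A' : forall k, (k <= 2 * P * (P * k))%nat).
  { intros k. assert (k <= P * k)%nat by nia. nia. }
  assert (A'' : forall k, (k <= 2 * P * (P * k + i))%nat).
  { intros k. specialize (A' k). nia. }
  repeat split; simpl; rewrite ?Cmod_inv, ?Ho, ?Rinv_1, ?Cmod_1, ?Cmod_0 by assumption;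
    try lra; try (now apply A); try apply A'; try apply A''; lia.
Qed.

(** The factors cancel already at finite level. So the reciprocal of a theta product is a power
    series given outright, and its nonvanishing comes along. *)
Lemma kb_inv (P i : nat) (om y : C) : (i < P)%nat -> Cmod om = 1%R -> (Cmod y < 1)%R ->
  block_fun (kb1 P i om) y * block_fun (kb2 P i om) y *
  (block_fun (kb3 P i om) y * block_fun (kb4 P) y) = 1.
Proof.
  intros Hi Ho Hy. destruct (kb_ok P i om Hi Ho) as [O1 [O2 [O3 O4]]].
  pose proof (Clim_mult _ _ _ _ (Clim_mult _ _ _ _ (block_lim _ y O1 Hy) (block_lim _ y O2 Hy))
                (Clim_mult _ _ _ _ (block_lim _ y O3 Hy) (block_lim _ y O4 Hy))) as L.
  refine (Clim_unique _ _ _ L (Clim_ext (fun _ => 1) _ _ _ (Clim_const 1))).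
  intros N. unfold block_partial. rewrite <- !Cprod_mult.
  rewrite (Cprod_ext _ (fun _ => 1)); [now rewrite Cprod_const, Cpow_1_l|].
  intros k _. unfold block_factor, kb1, kb2, kb3, kb4. cbv beta iota delta [bu bd bv be bw bf].
  assert (om <> 0) by (apply Cmod_neq0; lra).
  assert (Hi' : Cmod (/ om) = 1%R) by (rewrite Cmod_inv, Ho by assumption; lra).
  assert (D1 : 1 - om * y ^ (2 * P * (P * S k + i)) <> 0)
    by (apply one_minus_neq0, Cmod_mul_pow_lt1; [nia|lra|exact Hy]).
  assert (D2 : 1 - / om * y ^ (2 * P * (P * S k - i)) <> 0)
    by (apply one_minus_neq0, Cmod_mul_pow_lt1; [nia|lra|exact Hy]).
  assert (D3 : 1 - 1 * y ^ (2 * P * (P * S k)) <> 0)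
    by (apply one_minus_neq0, Cmod_mul_pow_lt1; [nia|rewrite Cmod_1; lra|exact Hy]).
  rewrite !Cmult_0_l. set (A := om * _) in *. set (B := / om * _) in *.
  replace (- om * y ^ (2 * P * (P * S k + i))) with (- A) by (unfold A; ring).
  replace (- / om * y ^ (2 * P * (P * S k - i))) with (- B) by (unfold B; ring).
  replace (- (1) * y ^ (2 * P * (P * S k))) with (- (1 * y ^ (2 * P * (P * S k)))) by ring.
  set (Q := 1 * y ^ (2 * P * (P * S k))) in *.
  field. repeat split; auto; intros E; apply C1_nz; rewrite <- E; ring.
Qed.

Lemma theta_blocks (P i : nat) (j : Z) (z : C) : (i < P)%nat -> upper_half z ->
  let Z := lat z (INR i / INR P) (IZR j / INR P) in
  let om := e2pi (RtoC (IZR j / INR P)) in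
  let y := qroot (cusp_width P) z in
  theta Z z = sin2i Z / two_pi_i * (block_fun (kb1 P i om) y * block_fun (kb2 P i om) y).
Proof.
  intros Hi Hz Z om y. assert (HP : (0 < P)%nat) by lia.
  assert (Ho : Cmod om = 1%R) by apply Cmod_e2pi_R.
  destruct (kb_ok P i om Hi Ho) as [O1 [O2 _]].
  assert (Hy : (Cmod y < 1)%R) by now apply qroot_lt1.
  pose proof (Clim_scal (sin2i Z / two_pi_i) _ _
     (Clim_mult _ _ _ _ (block_lim _ y O1 Hy) (block_lim _ y O2 Hy))) as L.
  refine (Clim_unique _ _ _ (theta_lim Z z Hz) (Clim_ext _ _ _ _ L)).
  intros N. unfold theta_partial. f_equal. unfold block_partial. rewrite <- Cprod_mult.
  apply Cprod_ext. intros k _. rewrite theta_row_alt by exact Hz.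
  unfold block_factor, kb1, kb2. cbv beta iota delta [bu bd bv be bw bf].
  unfold y. rewrite !qroot_cusp_width_pow by exact HP.
  assert (P0 : INR P <> 0%R) by (apply not_0_INR; lia).
  assert (E3 : e2pi (RtoC (INR (P * S k) / INR P) * z) = e2pi (RtoC (INR (S k)) * z)).
  { f_equal. f_equal. f_equal. rewrite mult_INR. field. exact P0. }
  assert (E1 : om * e2pi (RtoC (INR (P * S k + i) / INR P) * z) = e2pi (RtoC (INR (S k)) * z + Z)).
  { unfold om. rewrite <- e2pi_plus. f_equal. unfold Z, lat.
    replace (INR (P * S k + i) / INR P)%R with (INR (S k) + INR i / INR P)%R
      by (rewrite plus_INR, mult_INR; field; exact P0).
    rewrite RtoC_plus. ring. }
  assert (E2 : / om * e2pi (RtoC (INR (P * S k - i) / INR P) * z) = e2pi (RtoC (INR (S k)) * z - Z)).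
  { unfold om. rewrite <- e2pi_opp, <- e2pi_plus. f_equal. unfold Z, lat.
    replace (INR (P * S k - i) / INR P)%R with (INR (S k) - INR i / INR P)%R
      by (rewrite minus_INR by nia; rewrite mult_INR; field; exact P0).
    rewrite RtoC_minus. ring. }
  rewrite E3, <- E1, <- E2, !Cmult_0_l, !Cmult_1_l.
  set (Q := e2pi (RtoC (INR (S k)) * z)).
  assert (D : 1 - Q <> 0).
  { apply one_minus_neq0, e2pi_Cmod_lt1, upper_half_scal; [exact Hz|apply lt_0_INR; lia]. }
  field. split; [exact D|apply e2pi_neq0].
Qed.

Definition kz (P : nat) (i j : Z) (z : C) : C := klein (IZR i / INR P) (IZR j / INR P) z.

(** For [0 <= i < P] every exponent in the product is positive, and the Klein form is a constant
    times a power of [q], the factor [1 - om q^(i/P)] and a nonvanishing product. The middle factor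
    is identically 0 exactly when [i = 0] and [om = 1], the case that the second half leaves out. *)
Lemma kz_reduced (P i : nat) (j : Z) : (i < P)%nat ->
  mero (cusp_width P) (kz P (Z.of_nat i) j) /\
  ((i <> O \/ e2pi (RtoC (IZR j / INR P)) <> 1) ->
   (forall z, upper_half z -> kz P (Z.of_nat i) j z <> 0) /\
   mero (cusp_width P) (fun z => / kz P (Z.of_nat i) j z)).
Proof.
  intros Hi. assert (HP : (0 < P)%nat) by lia.
  assert (P0 : INR P <> 0%R) by (apply not_0_INR; lia).
  set (om := e2pi (RtoC (IZR j / INR P))).
  assert (Ho : Cmod om = 1%R) by apply Cmod_e2pi_R.
  destruct (kb_ok P i om Hi Ho) as [O1 [O2 [O3 O4]]].
  (* [e/(2 P^2)] equals [a1 (a1 - 1)/2] with [a1 = i/P]: the prefactor of the Klein form supplies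
     [a1^2/2], the leading exponential of the sine [- a1/2]. The constant [c] collects the same two
     contributions for [a2]. *)
  set (e := (Z.of_nat i * Z.of_nat i - Z.of_nat i * Z.of_nat P)%Z).
  set (c := - e2pi (RtoC ((INR i / INR P - 1) * (IZR j / INR P) / 2)) / two_pi_i).
  assert (Hc : c <> 0).
  { intros E. apply (e2pi_neq0 (RtoC ((INR i / INR P - 1) * (IZR j / INR P) / 2))).
    transitivity (- (c * two_pi_i)); [unfold c; field; apply two_pi_i_neq0|]. rewrite E. ring. }
  assert (F : forall z, upper_half z -> kz P (Z.of_nat i) j z =
     c * e2pi (RtoC (IZR e / IZR (Zpos (cusp_width P))) * z) * (1 - om * qroot (cusp_width P) z ^ (2 * P * i)) *
     (block_fun (kb1 P i om) (qroot (cusp_width P) z) * block_fun (kb2 P i om) (qroot (cusp_width P) z))).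
  { intros z Hz. unfold kz, klein. rewrite <- INR_IZR_INZ.
    rewrite (theta_blocks P i j z Hi Hz). fold om. rewrite sin2i_alt.
    set (a1 := (INR i / INR P)%R). set (a2 := (IZR j / INR P)%R). set (Z := lat z a1 a2).
    rewrite qroot_cusp_width_pow by exact HP. fold a1.
    replace (om * e2pi (RtoC a1 * z)) with (e2pi Z)
      by (unfold om; rewrite <- e2pi_plus; f_equal; unfold Z, lat, a2; ring).
    set (B := block_fun (kb1 P i om) _ * _).
    transitivity (- (e2pi (RtoC a1 * Z / 2) * e2pi (- (Z / 2))) / two_pi_i * (1 - e2pi Z) * B);
      [unfold Cdiv; ring|].
    f_equal. f_equal. unfold c. fold a1 a2. 
    transitivity (- (e2pi (RtoC ((a1 - 1) * a2 / 2)) * e2pi (RtoC (IZR e / IZR (Z.pos (cusp_width P))) * z)) / two_pi_i);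
      [|unfold Cdiv; ring].
    f_equal. f_equal. rewrite <- !e2pi_plus. f_equal.
    replace (IZR e / IZR (Z.pos (cusp_width P)))%R with ((a1 - 1) * a1 / 2)%R.
    - unfold Z, lat. unfold Rdiv. rewrite !RtoC_mult, !RtoC_minus, RtoC_inv by lra. field.
    - unfold e, a1. rewrite IZR_cusp_width, minus_IZR, !mult_IZR, <- !INR_IZR_INZ by exact HP. field. exact P0. }
  assert (M12 : mero (cusp_width P) (fun z => block_fun (kb1 P i om) (qroot (cusp_width P) z) * block_fun (kb2 P i om) (qroot (cusp_width P) z)))
    by (apply mero_mult; now apply mero_block).
  assert (Mx : exists a, is_ps a (fun y => 1 - om * y ^ (2 * P * i))).
  { destruct i as [|i].
    - eexists. refine (is_ps_ext _ _ _ _ (is_ps_const (1 - om))). intros y _.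
      rewrite Nat.mul_0_r. simpl. ring.
    - eexists. refine (is_ps_ext _ _ _ _ (is_ps_sparse 1 (- om) (2 * P * S i) ltac:(nia))).
      intros y _. ring. }
  destruct Mx as [ax Hax]. split.
  - apply (mero_ext (cusp_width P)) with (1 := fun z Hz => eq_sym (F z Hz)).
    apply mero_mult; [|exact M12].
    apply mero_mult; [|exact (mero_ps (cusp_width P) _ _ Hax)].
    apply mero_scal, mero_e2pi.
  - intros Hne.
    assert (Nx : forall y, (Cmod y < 1)%R -> 1 - om * y ^ (2 * P * i) <> 0).
    { intros y Hy. destruct i as [|i].
      - destruct Hne as [Hne|Hne]; [lia|]. rewrite Nat.mul_0_r. simpl. rewrite Cmult_1_r.
        apply Cminus_eq_contra. auto.
      - apply one_minus_neq0, Cmod_mul_pow_lt1; [nia|lra|exact Hy]. }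
    assert (Mx' : exists a, is_ps a (fun y => / (1 - om * y ^ (2 * P * i)))).
    { destruct i as [|i].
      - eexists. refine (is_ps_ext _ _ _ _ (is_ps_const (/ (1 - om)))). intros y _.
        rewrite Nat.mul_0_r. simpl. now rewrite Cmult_1_r.
      - eexists. apply is_ps_geom; [nia|lra]. }
    destruct Mx' as [ax' Hax'].
    assert (G : forall z, upper_half z ->
       block_fun (kb1 P i om) (qroot (cusp_width P) z) * block_fun (kb2 P i om) (qroot (cusp_width P) z) <> 0).
    { intros z Hz E. apply C1_nz. rewrite <- (kb_inv P i om _ Hi Ho (qroot_lt1 (cusp_width P) z Hz)), E. ring. }
    assert (Fn : forall z, upper_half z -> kz P (Z.of_nat i) j z <> 0).
    { intros z Hz. rewrite F by exact Hz. apply Cmult_neq_0; [|now apply G].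
      apply Cmult_neq_0; [|now apply Nx, qroot_lt1]. apply Cmult_neq_0; [exact Hc|apply e2pi_neq0]. }
    split; [exact Fn|].
    apply (mero_ext (cusp_width P) (fun z => / c * e2pi (RtoC (IZR (- e) / IZR (Zpos (cusp_width P))) * z)
              * / (1 - om * qroot (cusp_width P) z ^ (2 * P * i)) *
     (block_fun (kb3 P i om) (qroot (cusp_width P) z) * block_fun (kb4 P) (qroot (cusp_width P) z)))).
    + intros z Hz. rewrite F by exact Hz.
      pose proof (kb_inv P i om _ Hi Ho (qroot_lt1 (cusp_width P) z Hz)) as K.
      set (B := block_fun (kb1 P i om) _ * _) in *. set (B' := block_fun (kb3 P i om) _ * _) in *.
      replace B' with (/ B); [|].
      * rewrite opp_IZR, <- Ropp_div_distr_l, RtoC_opp.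
        replace (- RtoC (IZR e / IZR (Zpos (cusp_width P))) * z)
          with (- (RtoC (IZR e / IZR (Zpos (cusp_width P))) * z)) by ring.
        rewrite e2pi_opp.
        field. repeat split; [now apply G|now apply Nx, qroot_lt1|apply e2pi_neq0|exact Hc].
      * assert (B <> 0) by now apply G.
        transitivity (/ B * (B * B')); [rewrite K; ring|field; assumption].
    + apply mero_mult; [|apply mero_mult; now apply mero_block].
      apply mero_mult; [|exact (mero_ps (cusp_width P) _ _ Hax')].
      apply mero_scal, mero_e2pi.
Qed.

Lemma e2pi_frac_neq1 (P : nat) (j : Z) : (0 < P)%nat -> ~ (Z.of_nat P | j)%Z ->
  e2pi (RtoC (IZR j / INR P)) <> 1.
Proof.
  intros HP Hd. assert (P0 : (0 < INR P)%R) by (apply lt_0_INR; lia).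
  set (r := (j mod Z.of_nat P)%Z). set (k := (j / Z.of_nat P)%Z).
  assert (E : (j = Z.of_nat P * k + r)%Z) by (apply Z.div_mod; lia).
  pose proof (Z.mod_pos_bound j (Z.of_nat P) ltac:(lia)) as Hr. fold r in Hr.
  assert (r <> 0)%Z.
  { intros R0. apply Hd. exists k. rewrite E, R0. ring. }
  replace (RtoC (IZR j / INR P)) with (RtoC (IZR k) + RtoC (IZR r / INR P)).
  - rewrite e2pi_plus, e2pi_IZR, Cmult_1_l. apply e2pi_R_neq1.
    assert (0 < IZR r)%R by (apply IZR_lt; lia).
    assert (IZR r < INR P)%R by (rewrite INR_IZR_INZ; apply IZR_lt; lia).
    split; [now apply Rdiv_lt_0_compat|]. apply Rmult_lt_reg_r with (INR P); [lra|].
    unfold Rdiv. rewrite Rmult_assoc, Rinv_l by lra. lra.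
  - rewrite <- RtoC_plus. f_equal. rewrite E, plus_IZR, mult_IZR, <- INR_IZR_INZ. field. lra.
Qed.

(** An integral shift brings the first index into the range of [kz_reduced]. The second index enters
    only through a root of unity and a constant phase, so it may stay as it is. *)
Lemma kz_mero (P : nat) (i j : Z) : (0 < P)%nat ->
  mero (cusp_width P) (kz P i j) /\
  (~ ((Z.of_nat P | i)%Z /\ (Z.of_nat P | j)%Z) ->
   (forall z, upper_half z -> kz P i j z <> 0) /\ mero (cusp_width P) (fun z => / kz P i j z)).
Proof.
  intros HP. assert (P0 : INR P <> 0%R) by (apply not_0_INR; lia).
  set (r := (i mod Z.of_nat P)%Z). set (k := (i / Z.of_nat P)%Z).
  assert (E : (i = Z.of_nat P * k + r)%Z) by (apply Z.div_mod; lia).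
  pose proof (Z.mod_pos_bound i (Z.of_nat P) ltac:(lia)) as Hr. fold r in Hr.
  destruct (klein_shift_Z k 0 (IZR r / INR P) (IZR j / INR P)) as [c [Hc Ec]].
  assert (K : forall z, upper_half z -> kz P i j z = c * kz P (Z.of_nat (Z.to_nat r)) j z).
  { intros z Hz. unfold kz. rewrite Z2Nat.id by lia. rewrite <- Ec by exact Hz. f_equal.
    - rewrite E at 1. rewrite plus_IZR, mult_IZR, <- INR_IZR_INZ. field. exact P0.
    - ring. }
  destruct (kz_reduced P (Z.to_nat r) j ltac:(lia)) as [M1 M2]. split.
  - apply (mero_ext (cusp_width P)) with (1 := fun z Hz => eq_sym (K z Hz)). now apply mero_scal.
  - intros Hd. destruct M2 as [N M2].
    { destruct (Z.eq_dec r 0) as [R0|R0]; [right|left; lia].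
      apply e2pi_frac_neq1; [exact HP|]. intros Hj. apply Hd. split; [|exact Hj].
      exists k. rewrite E, R0. ring. }
    split.
    + intros z Hz. rewrite K by exact Hz. apply Cmult_neq_0; [exact Hc|now apply N].
    + apply (mero_ext (cusp_width P) (fun z => / c * / kz P (Z.of_nat (Z.to_nat r)) j z)); [|now apply mero_scal].
      intros z Hz. rewrite K by exact Hz. field. split; [now apply N|exact Hc].
Qed.

(** * The crank series as a Klein form quotient *)

Lemma Cprod_S (f : nat -> C) (n : nat) : Cprod f (S n) = Cprod f n * f n.
Proof. reflexivity. Qed.

Lemma Rsum_S (f : nat -> R) (n : nat) : Rsum f (S n) = (Rsum f n + f n)%R.
Proof. reflexivity. Qed.

Lemma Cprod_even_odd (g : nat -> C) (h : nat) :
  Cprod (fun j => g (S j)) (2 * h) =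
  Cprod (fun s => g (2 * S s)%nat) h * Cprod (fun s => g (2 * s + 1)%nat) h.
Proof.
  induction h as [|h IH]; [simpl; ring|].
  replace (2 * S h)%nat with (S (S (2 * h))) by lia.
  change (Cprod (fun j => g (S j)) (S (S (2 * h))))
    with (Cprod (fun j => g (S j)) (2 * h) * g (S (2 * h)) * g (S (S (2 * h)))).
  rewrite IH.
  change (Cprod (fun s => g (2 * S s)%nat) (S h))
    with (Cprod (fun s => g (2 * S s)%nat) h * g (2 * S h)%nat).
  change (Cprod (fun s => g (2 * s + 1)%nat) (S h))
    with (Cprod (fun s => g (2 * s + 1)%nat) h * g (2 * h + 1)%nat).
  replace (2 * S h)%nat with (S (S (2 * h))) by lia.
  replace (2 * h + 1)%nat with (S (2 * h)) by lia. ring.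
Qed.

Lemma Cprod_residues (g : nat -> C) (h : nat) :
  let P := (2 * h + 1)%nat in
  Cprod (fun j => g (S j)) P =
  Cprod (fun s => g (2 * S s)%nat) h * Cprod (fun s => g (P - 2 * S s)%nat) h * g P.
Proof.
  intros P. unfold P at 1. rewrite Nat.add_1_r.
  change (Cprod (fun j => g (S j)) (S (2 * h))) with (Cprod (fun j => g (S j)) (2 * h) * g (S (2 * h))).
  rewrite Cprod_even_odd, (Cprod_rev (fun s => g (2 * s + 1)%nat)).
  f_equal; [|f_equal; unfold P; lia]. f_equal. apply Cprod_ext. intros s Hs. f_equal. unfold P. lia.
Qed.

(* The exponents P k and P k +- 2 s with s <= h run once through the positive integers, up to the
   boundary terms at k = M. *)
Lemma Cprod_regroup (f : nat -> C) (h M : nat) :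
  let P := (2 * h + 1)%nat in
  Cprod (fun s => f (2 * S s)%nat) h *
  Cprod (fun k => f (P * S k)%nat *
    Cprod (fun s => f (P * S k + 2 * S s)%nat * f (P * S k - 2 * S s)%nat) h) M =
  Cprod (fun n => f (S n)) (P * M) * Cprod (fun s => f (P * M + 2 * S s)%nat) h.
Proof.
  intros P. induction M as [|M IH].
  - rewrite Nat.mul_0_r. change (Cprod (fun n => f (S n)) 0) with (RtoC 1).
    rewrite Cmult_1_l. apply Cmult_1_r.
  - rewrite Cprod_S, Cmult_assoc, IH. replace (P * S M)%nat with (P * M + P)%nat by lia.
    rewrite Cprod_add.
    pose proof (Cprod_residues (fun j => f (P * M + j)%nat) h) as E. cbv zeta in E. fold P in E.
    rewrite (Cprod_ext (fun i => f (S (P * M + i))) (fun j => f (P * M + S j)%nat))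
      by (intros; f_equal; lia).
    rewrite E, !Cprod_mult.
    rewrite (Cprod_ext (fun i => f (P * M + P - 2 * S i)%nat) (fun s => f (P * M + (P - 2 * S s))%nat))
      by (intros; f_equal; unfold P; lia).
    ring.
Qed.

Lemma Cprod_e2pi (r : nat -> R) (z : C) (n : nat) :
  Cprod (fun s => e2pi (RtoC (r s) * z)) n = e2pi (RtoC (Rsum r n) * z).
Proof.
  induction n as [|n IH]; simpl; [now rewrite Cmult_0_l, e2pi_0|].
  rewrite IH, <- e2pi_plus, RtoC_plus. f_equal. ring.
Qed.

(** The exponent of [q] in the Klein quotient: [s/p] comes from row 0 and [- 2 (s/p)^2] from the
    prefactors. For [p = 2h+1] the total is [h (h+1)/(6 p)], which is [s_p/p]. *)
Lemma Rsum_weights (h : nat) (p : R) : (p <> 0)%R ->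
  Rsum (fun s => (INR (S s) / p - 2 * (INR (S s) / p) ^ 2)%R) h =
  (INR h * (INR h + 1) / 2 / p - INR h * (INR h + 1) * (2 * INR h + 1) / 3 / p ^ 2)%R.
Proof.
  intros Hp. induction h as [|h IH]; [simpl; field; exact Hp|].
  rewrite Rsum_S, IH, !S_INR. field. exact Hp.
Qed.

(** The row vector [(i, j)] is multiplied by [A] from the right, so that covariance becomes
    multiplication of matrices. *)
Definition kact (P : nat) (A : mat2) (i j : Z) (z : C) : C :=
  kz P (i * ma A + j * mc A) (i * mb A + j * md A) z.

Definition mat_id : mat2 := Mat2 1 0 0 1.

Lemma kact_id (P : nat) (i j : Z) (z : C) : kact P mat_id i j z = kz P i j z.
Proof. unfold kact; simpl. f_equal; ring. Qed.

(* [klein_quotient h A] is the weight 1 Klein form quotient of level P = 2 h + 1 slashed by [A].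
   All numerators are even, so that no signs appear in the quasi-periods. *)
Definition klein_quotient (h : nat) (A : mat2) (z : C) : C :=
  let P := (2 * h + 1)%nat in
  Cprod (fun s => let t := (2 * Z.of_nat (S s))%Z in let u := (2 * Z.of_nat (S h))%Z in
    kact P A 0 t z * kact P A t 0 z * / (kact P A t u z * kact P A (- t) u z)) h
  * / kact P A 0 (2 * Z.of_nat (S h)) z.

Definition eta_block (P : nat) : block :=
  Block (fun _ => 1) (fun k => P * k)%nat (fun _ => 0) (fun k => k) (fun _ => 0) (fun k => k).

Lemma eta_block_ok (P : nat) : (0 < P)%nat -> block_ok (eta_block P).
Proof.
  intros HP k Hk. simpl. rewrite Cmod_1, Cmod_0. repeat split; try lra; nia.
Qed.

Definition nzeta (P : nat) : C := e2pi (RtoC (/ INR P)).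

(** The [G] of the overview: [h (h+1)/6] is [s_p] for [p = 2h+1]. *)
Definition crank_form (h : nat) (z : C) : C :=
  let P := (2 * h + 1)%nat in
  e2pi (RtoC (INR h * (INR h + 1) / 6 / INR P) * z) * block_fun (eta_block P) (e2pi z)
  * block_fun (crank_block (nzeta P)) (e2pi (RtoC (/ INR P) * z)).

(** Disposes of the boundary factors that [Cprod_regroup] leaves over. *)
Lemma Clim_crank_factor (x y : C) (f : nat -> nat) : Cmod x = 1%R -> (Cmod y < 1)%R ->
  (forall M, (M <= f M)%nat) -> Clim (fun M => block_factor (crank_block x) (f M) y) 1.
Proof.
  intros Hx Hy Hf. pose proof (Clim_subseq _ _ f Hf (Clim_geom y Hy)) as G.
  assert (x <> 0) by (apply Cmod_neq0; lra).
  unfold block_factor, crank_block; cbv beta iota delta [bu bd bv be bw bf].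
  replace (RtoC 1) with ((1 + - (1) * 0) * (/ (1 - x * 0) * / (1 - / x * 0))) at 1 by (field; assumption).
  assert (A : forall c, Clim (fun M => 1 - c * y ^ f M) (1 - c * 0)).
  { intros c. apply Clim_minus; [apply Clim_const|now apply Clim_scal]. }
  apply Clim_mult.
  - apply Clim_plus; [apply Clim_const|now apply Clim_scal].
  - apply Clim_mult; (apply Clim_inv; [|apply A]); rewrite Cmult_0_r;
      replace (1 - 0) with (RtoC 1) by ring; apply C1_nz.
Qed.

(** All thetas are compared row by row at the same finite level. The indices [(0, 2s/P)] contribute
    roots of unity that combine to the eta product; [(2s/P, 0)] in the numerator and
    [(+-2s/P, (P+1)/P)] in the denominator contribute the crank factors with exponents [P k +- 2s];
    the last denominator contributes those with exponent [P k]. *)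
Lemma crank_form_klein (h : nat) : (0 < h)%nat ->
  exists c : C, c <> 0 /\ forall z, upper_half z ->
    klein_quotient h mat_id z = c * crank_form h z.
Proof.
  intros Hh. set (P := (2 * h + 1)%nat).
  assert (HP : (0 < P)%nat) by (unfold P; lia).
  assert (P1 : (1 < INR P)%R) by (apply (lt_INR 1); unfold P; lia).
  assert (P0 : INR P <> 0%R) by lra.
  assert (EP : INR P = (2 * INR h + 1)%R) by (unfold P; rewrite plus_INR, mult_INR; simpl; ring).
  (* [2 (h+1) = P + 1], so [t] is [1 + 1/P]: an even numerator that still gives [e(t) = zeta]. *)
  set (t := RtoC (2 * INR (S h) / INR P)). set (ze := nzeta P).
  assert (Et : e2pi t = ze).
  { unfold t, ze, nzeta. replace (2 * INR (S h) / INR P)%R with (INR 1 + / INR P)%R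
      by (rewrite (S_INR h), EP; change (INR 1) with 1%R; field; lra).
    rewrite RtoC_plus, e2pi_plus, e2pi_INR. ring. }
  assert (Hze : Cmod ze = 1%R) by apply Cmod_e2pi_R.
  assert (ze0 : ze <> 0) by (apply Cmod_neq0; lra).
  assert (Hst : sin2i t <> 0).
  { rewrite sin2i_alt, Et. apply Cmult_neq_0.
    - intros E. apply (e2pi_neq0 (- (t / 2))). replace (e2pi (- (t / 2))) with (- - e2pi (- (t / 2))) by ring.
      rewrite E. ring.
    - apply Cminus_eq_contra. intros E. symmetry in E. revert E. apply e2pi_R_neq1.
      split; [apply Rinv_0_lt_compat; lra|]. rewrite <- Rinv_1. apply Rinv_lt_contravar; lra. }
  set (om := e2pi (RtoC (INR 2 / INR P))).
  assert (om0 : om <> 0) by apply e2pi_neq0.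
  assert (Eom : forall j, om ^ j = e2pi (RtoC (INR (2 * j) / INR P))).
  { intros j. unfold om. now apply root_unity_pow. }
  assert (HomP : om ^ (2 * h + 1) = 1).
  { rewrite Eom. fold P. replace (INR (2 * P) / INR P)%R with (INR 2) by (rewrite mult_INR; field; lra).
    apply e2pi_INR. }
  assert (Homk : forall k, (0 < k < 2 * h + 1)%nat -> om ^ k <> 1).
  { intros k Hk. rewrite Eom, INR_IZR_INZ. apply e2pi_frac_neq1; [exact HP|].
    intros [x Hx]. unfold P in Hx.
    assert (x = 0 \/ x = 1 \/ x < 0 \/ x > 1)%Z as D by lia.
    destruct D as [D|[D|[D|D]]]; nia. }
  set (As := fun s => RtoC (INR (2 * S s) / INR P)).
  assert (EAs : forall s, e2pi (As s) = om ^ S s) by (intros s; now rewrite Eom).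
  (* The parts of row 0 that do not depend on [z]. *)
  set (c0 := two_pi_i / sin2i t * Cprod (fun s => sin2i (As s)) h).
  assert (Hc0 : c0 <> 0).
  { unfold c0. apply Cmult_neq_0.
    - intros E. apply two_pi_i_neq0. transitivity (two_pi_i / sin2i t * sin2i t); [field; exact Hst|].
      rewrite E. ring.
    - apply Cprod_neq0. intros s Hs. apply sin2i_R_neq0.
      assert (0 < INR (2 * S s))%R by (apply lt_0_INR; lia).
      assert (INR (2 * S s) < INR P)%R by (apply lt_INR; unfold P; lia).
      split; [apply Rdiv_lt_0_compat; lra|]. apply Rmult_lt_reg_r with (INR P); [lra|].
      unfold Rdiv. rewrite Rmult_assoc, Rinv_l by lra. lra. }
  exists c0. split; [exact Hc0|]. intros z Hz.
  set (y := e2pi (RtoC (/ INR P) * z)).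
  assert (Hy : (Cmod y < 1)%R).
  { apply e2pi_Cmod_lt1, upper_half_scal; [exact Hz|apply Rinv_0_lt_compat; lra]. }
  assert (y0 : y <> 0) by apply e2pi_neq0.
  assert (Ey : forall n, y ^ n = e2pi (RtoC (INR n / INR P) * z)).
  { intros n. unfold y. rewrite e2pi_pow. f_equal. unfold Rdiv. rewrite RtoC_mult. ring. }
  assert (Eq : forall k, y ^ (P * k) = e2pi (RtoC (INR k) * z)).
  { intros k. rewrite Ey. f_equal. f_equal. f_equal. rewrite mult_INR. field. exact P0. }
  set (Bs := fun s => RtoC (INR (2 * S s) / INR P) * z).
  assert (EBs : forall s, e2pi (Bs s) = y ^ (2 * S s)) by (intros s; now rewrite Ey).
  set (F := fun n => block_factor (crank_block ze) n y).
  assert (D1 : forall n, (0 < n)%nat -> 1 - ze * y ^ n <> 0)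
    by (intros n Hn; apply one_minus_neq0, Cmod_mul_pow_lt1; [exact Hn|lra|exact Hy]).
  assert (D2 : forall n, (0 < n)%nat -> 1 - / ze * y ^ n <> 0).
  { intros n Hn; apply one_minus_neq0, Cmod_mul_pow_lt1; [exact Hn| |exact Hy].
    rewrite Cmod_inv, Hze by exact ze0. lra. }
  assert (D3 : forall n, (0 < n)%nat -> 1 - y ^ n <> 0).
  { intros n Hn. rewrite <- (Cmult_1_l (y ^ n)). apply one_minus_neq0, Cmod_mul_pow_lt1; [exact Hn| |exact Hy].
    rewrite Cmod_1; lra. }
  assert (EF : forall n, (0 < n)%nat -> F n = (1 - y ^ n) / ((1 - ze * y ^ n) * (1 - / ze * y ^ n))).
  { intros n Hn. unfold F, block_factor, crank_block; cbv beta iota delta [bu bd bv be bw bf].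
    specialize (D1 n Hn). specialize (D2 n Hn). unfold Cdiv.
    set (u := 1 - ze * y ^ n) in *. set (v := 1 - / ze * y ^ n) in *. field. auto. }
  set (row := fun Z k => theta_row Z z (S k)).
  assert (Erow : forall Z k, row Z k = (1 - y ^ (P * S k) * e2pi Z) * (1 - y ^ (P * S k) / e2pi Z)
                    / (1 - y ^ (P * S k)) ^ 2).
  { intros Z k. unfold row. rewrite theta_row_alt by exact Hz. rewrite Eq, e2pi_plus, e2pi_minus. reflexivity. }
  assert (Hpow : forall k s, (s < h)%nat -> y ^ (P * S k - 2 * S s) = y ^ (P * S k) / y ^ (2 * S s)).
  { intros k s Hs. replace (P * S k)%nat with ((P * S k - 2 * S s) + 2 * S s)%nat at 2 by (unfold P; nia).
    rewrite Cpow_add_r. field. now apply Cpow_nz. }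
  assert (L1 : forall k s, (s < h)%nat ->
     row (As s) k * row (Bs s) k * / (row (Bs s + t) k * row (- Bs s + t) k) =
     (1 - om ^ S s * y ^ (P * S k)) * (1 - / om ^ S s * y ^ (P * S k)) *
     (F (P * S k + 2 * S s)%nat * F (P * S k - 2 * S s)%nat)).
  { intros k s Hs. rewrite !EF by (unfold P; nia). rewrite !Erow, !e2pi_plus, e2pi_opp, Et, EAs, EBs.
    pose proof (D1 (P * S k + 2 * S s)%nat ltac:(nia)) as Q1.
    pose proof (D2 (P * S k + 2 * S s)%nat ltac:(nia)) as Q2.
    pose proof (D1 (P * S k - 2 * S s)%nat ltac:(unfold P; nia)) as Q3.
    pose proof (D2 (P * S k - 2 * S s)%nat ltac:(unfold P; nia)) as Q4.
    pose proof (D3 (P * S k)%nat ltac:(nia)) as Q5.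
    rewrite Cpow_add_r in *. rewrite Hpow in * by exact Hs.
    assert (W0 : om ^ S s <> 0) by now apply Cpow_nz.
    assert (V0 : y ^ (2 * S s) <> 0) by now apply Cpow_nz.
    set (q := y ^ (P * S k)) in *. set (v := y ^ (2 * S s)) in *. set (w := om ^ S s) in *.
    replace (1 - q * (v * ze)) with (1 - ze * (q * v)) by ring.
    replace (1 - q / (v * ze)) with (1 - / ze * (q / v)) by (field; auto).
    replace (1 - q * (/ v * ze)) with (1 - ze * (q / v)) by (field; auto).
    replace (1 - q / (/ v * ze)) with (1 - / ze * (q * v)) by (field; auto).
    set (x1 := 1 - ze * (q * v)) in *. set (x2 := 1 - / ze * (q * v)) in *.
    set (x3 := 1 - ze * (q / v)) in *. set (x4 := 1 - / ze * (q / v)) in *.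
    set (x5 := 1 - q) in *. field. repeat split; auto. }
  assert (L2 : forall k, / row t k = (1 - y ^ (P * S k)) * F (P * S k)%nat).
  { intros k. rewrite EF by nia. rewrite Erow, Et.
    pose proof (D1 (P * S k)%nat ltac:(nia)) as Q1. pose proof (D2 (P * S k)%nat ltac:(nia)) as Q2.
    pose proof (D3 (P * S k)%nat ltac:(nia)) as Q3. set (q := y ^ (P * S k)) in *.
    replace (1 - q * ze) with (1 - ze * q) by ring.
    replace (1 - q / ze) with (1 - / ze * q) by (field; auto).
    set (x1 := 1 - ze * q) in *. set (x2 := 1 - / ze * q) in *. field. auto. }
  (* With [X = q^(k+1)], the factor [1 - X] left over in [L2] completes the factors at the
     nontrivial roots of unity to [1 - X^P], a factor of the eta product. *)
  assert (L3 : forall k, (1 - y ^ (P * S k)) *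
     Cprod (fun s => (1 - om ^ S s * y ^ (P * S k)) * (1 - / om ^ S s * y ^ (P * S k))) h
     = 1 - e2pi z ^ (P * S k)).
  { intros k. rewrite <- (geom_sum_factor om h _ HomP Homk), geom_sum. fold P.
    replace ((y ^ (P * S k)) ^ P) with (e2pi z ^ (P * S k)); [reflexivity|].
    rewrite Eq, !e2pi_pow. f_equal. rewrite mult_INR, RtoC_mult. ring. }
  (* Row 0 supplies the missing exponents [2s] below [P], together with the power [y^s]. *)
  assert (L4 : forall s, (s < h)%nat ->
     sin2i (Bs s) * / (sin2i (Bs s + t) * sin2i (- Bs s + t)) = y ^ S s * F (2 * S s)%nat).
  { intros s Hs. rewrite EF by lia. rewrite !sin2i_alt, !e2pi_plus, (e2pi_opp (Bs s)), Et, EBs.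
    pose proof (D1 (2 * S s)%nat ltac:(lia)) as Q1. pose proof (D2 (2 * S s)%nat ltac:(lia)) as Q2.
    assert (EB2 : e2pi (- (Bs s / 2)) = / y ^ S s).
    { rewrite e2pi_opp, Ey. f_equal. f_equal. unfold Bs. rewrite mult_INR. change (INR 2) with 2%R.
      replace (2 * INR (S s) / INR P)%R with (INR (S s) / INR P * 2)%R by (field; lra).
      rewrite RtoC_mult. field. }
    assert (Em : e2pi (- ((Bs s + t) / 2)) * e2pi (- ((- Bs s + t) / 2)) = / ze).
    { rewrite <- e2pi_plus, <- Et, <- e2pi_opp. f_equal. field. }
    rewrite EB2. assert (V0 : y ^ (2 * S s) <> 0) by now apply Cpow_nz.
    assert (V1 : y ^ S s <> 0) by now apply Cpow_nz.
    replace (y ^ (2 * S s)) with (y ^ S s * y ^ S s) in * by (rewrite <- Cpow_add_r; f_equal; lia).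
    set (v := y ^ S s) in *.
    replace (- e2pi (- ((Bs s + t) / 2)) * (1 - v * v * ze) * (- e2pi (- ((- Bs s + t) / 2)) * (1 - / (v * v) * ze)))
      with (e2pi (- ((Bs s + t) / 2)) * e2pi (- ((- Bs s + t) / 2)) * ((1 - v * v * ze) * (1 - / (v * v) * ze))) by ring.
    rewrite Em.
    replace (1 - v * v * ze) with (1 - ze * (v * v)) by ring.
    replace (1 - / (v * v) * ze) with (- (ze / (v * v)) * (1 - / ze * (v * v))) by (field; auto).
    set (x1 := 1 - ze * (v * v)) in *. set (x2 := 1 - / ze * (v * v)) in *. field. auto. }
  assert (Htp : forall Z M, theta_partial Z z M = sin2i Z / two_pi_i * Cprod (row Z) M) by reflexivity.
  assert (inv0 : forall x : C, x <> 0 -> / x <> 0).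
  { intros x Hx E. apply C1_nz. rewrite <- (Cinv_r x Hx), E. ring. }
  assert (NR : forall k s, (s < h)%nat -> row (Bs s + t) k <> 0 /\ row (- Bs s + t) k <> 0).
  { intros k s Hs. rewrite !Erow, !e2pi_plus, e2pi_opp, Et, EBs.
    pose proof (D1 (P * S k + 2 * S s)%nat ltac:(nia)) as Q1.
    pose proof (D2 (P * S k + 2 * S s)%nat ltac:(nia)) as Q2.
    pose proof (D1 (P * S k - 2 * S s)%nat ltac:(unfold P; nia)) as Q3.
    pose proof (D2 (P * S k - 2 * S s)%nat ltac:(unfold P; nia)) as Q4.
    pose proof (D3 (P * S k)%nat ltac:(nia)) as Q5.
    rewrite Cpow_add_r in *. rewrite Hpow in * by exact Hs.
    assert (V0 : y ^ (2 * S s) <> 0) by now apply Cpow_nz.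
    set (q := y ^ (P * S k)) in *. set (v := y ^ (2 * S s)) in *.
    replace (1 - q * (v * ze)) with (1 - ze * (q * v)) by ring.
    replace (1 - q / (v * ze)) with (1 - / ze * (q / v)) by (field; auto).
    replace (1 - q * (/ v * ze)) with (1 - ze * (q / v)) by (field; auto).
    replace (1 - q / (/ v * ze)) with (1 - / ze * (q * v)) by (field; auto).
    split; (apply Cmult_neq_0; [now apply Cmult_neq_0|now apply inv0, Cpow_nz]). }
  assert (NT : forall k, row t k <> 0).
  { intros k. rewrite Erow, Et.
    pose proof (D1 (P * S k)%nat ltac:(nia)) as Q1. pose proof (D2 (P * S k)%nat ltac:(nia)) as Q2.
    pose proof (D3 (P * S k)%nat ltac:(nia)) as Q3. set (q := y ^ (P * S k)) in *.
    replace (1 - q * ze) with (1 - ze * q) by ring.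
    replace (1 - q / ze) with (1 - / ze * q) by (field; auto).
    apply Cmult_neq_0; [now apply Cmult_neq_0|now apply inv0, Cpow_nz]. }
  assert (NS : forall s, sin2i (Bs s + t) <> 0 /\ sin2i (- Bs s + t) <> 0).
  { intros s. pose proof (D1 (2 * S s)%nat ltac:(lia)) as Q1. pose proof (D2 (2 * S s)%nat ltac:(lia)) as Q2.
    assert (V0 : y ^ (2 * S s) <> 0) by now apply Cpow_nz.
    assert (ne : forall w, - e2pi w <> 0).
    { intros w E. apply (e2pi_neq0 w). replace (e2pi w) with (- - e2pi w) by ring. rewrite E. ring. }
    rewrite !sin2i_alt, !e2pi_plus, (e2pi_opp (Bs s)), Et, EBs. set (v := y ^ (2 * S s)) in *.
    split; (apply Cmult_neq_0; [apply ne|]).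
    - now rewrite (Cmult_comm v).
    - intros E. apply Q2. transitivity (- (v / ze) * (1 - / v * ze)); [field; auto|]. rewrite E. ring. }
  set (Q := fun M => Cprod (fun s => theta_partial (As s) z M * theta_partial (Bs s) z M *
      / (theta_partial (Bs s + t) z M * theta_partial (- Bs s + t) z M)) h * / theta_partial t z M).
  pose proof two_pi_i_neq0 as Hpi.
  (* After [M] rows every exponent up to [P M] has occurred once; beyond it only the [h] factors at
     [P M + 2s] are present, and they tend to 1. *)
  assert (EQ : forall M, Q M = c0 * Cprod (fun s => y ^ S s) h *
     (Cprod (fun k => 1 - e2pi z ^ (P * S k)) M *
      (block_partial (crank_block ze) y (P * M) * Cprod (fun s => F (P * M + 2 * S s)%nat) h))).
  { intros M. unfold Q.
    rewrite (Cprod_ext _ (fun s => sin2i (As s) * (y ^ S s * (F (2 * S s)%nat *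
       (Cprod (fun k => (1 - om ^ S s * y ^ (P * S k)) * (1 - / om ^ S s * y ^ (P * S k)) *
          (F (P * S k + 2 * S s)%nat * F (P * S k - 2 * S s)%nat)) M))))).
    2:{ intros s Hs. rewrite !Htp. destruct (NS s) as [S1 S2].
        assert (N1 : Cprod (row (Bs s + t)) M <> 0)
          by (apply Cprod_neq0; intros k _; exact (proj1 (NR k s Hs))).
        assert (N2 : Cprod (row (- Bs s + t)) M <> 0)
          by (apply Cprod_neq0; intros k _; exact (proj2 (NR k s Hs))).
        rewrite <- (Cprod_ext (fun k => row (As s) k * row (Bs s) k * / (row (Bs s + t) k * row (- Bs s + t) k)))
          with (1 := fun k _ => L1 k s Hs).
        rewrite !Cprod_mult, (Cprod_inv (fun k => row (Bs s + t) k * row (- Bs s + t) k))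
          by (intros k _; apply Cmult_neq_0; [exact (proj1 (NR k s Hs))|exact (proj2 (NR k s Hs))]).
        rewrite Cprod_mult. rewrite (Cmult_assoc (y ^ S s)), <- L4 by exact Hs.
        set (a := Cprod (row (As s)) M). set (b := Cprod (row (Bs s)) M).
        set (c := Cprod (row (Bs s + t)) M) in *. set (d := Cprod (row (- Bs s + t)) M) in *.
        field. repeat split; assumption. }
    rewrite !Cprod_mult. rewrite Cprod_swap.
    rewrite (Cprod_ext (fun k => Cprod _ h) (fun k =>
       Cprod (fun s => (1 - om ^ S s * y ^ (P * S k)) * (1 - / om ^ S s * y ^ (P * S k))) h *
       Cprod (fun s => F (P * S k + 2 * S s)%nat * F (P * S k - 2 * S s)%nat) h))
      by (intros; apply Cprod_mult).
    rewrite Htp.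
    assert (NTp : Cprod (row t) M <> 0) by (apply Cprod_neq0; intros; apply NT).
    replace (/ (sin2i t / two_pi_i * Cprod (row t) M)) with (two_pi_i / sin2i t * / Cprod (row t) M)
      by (field; auto).
    rewrite <- Cprod_inv by (intros; apply NT).
    rewrite (Cprod_ext (fun k => / row t k) (fun k => (1 - y ^ (P * S k)) * F (P * S k)%nat)) by (intros; apply L2).
    pose proof (Cprod_regroup F h M) as RG. cbv zeta in RG. fold P in RG.
    unfold block_partial. fold F. change (fun i => block_factor (crank_block ze) (S i) y) with (fun n => F (S n)).
    rewrite <- RG.
    rewrite <- (Cprod_ext (fun k => (1 - y ^ (P * S k)) *
       Cprod (fun s => (1 - om ^ S s * y ^ (P * S k)) * (1 - / om ^ S s * y ^ (P * S k))) h)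
       (fun k => 1 - e2pi z ^ (P * S k))) by (intros; apply L3).
    rewrite !Cprod_mult. unfold c0. ring. }
  assert (K1 : forall s, kz P 0 (2 * Z.of_nat (S s)) z = theta (As s) z).
  { intros s. unfold kz, klein. replace (0 / INR P)%R with 0%R by (field; exact P0).
    rewrite mult_IZR, <- INR_IZR_INZ.
    replace (lat z 0 (2 * INR (S s) / INR P)) with (As s)
      by (unfold As, lat; rewrite mult_INR; change (INR 2) with 2%R; ring).
    replace (RtoC 0 * As s / 2) with (RtoC 0) by field. rewrite e2pi_0. ring. }
  assert (K2 : forall s, kz P (2 * Z.of_nat (S s)) 0 z = e2pi (As s * Bs s / 2) * theta (Bs s) z).
  { intros s. unfold kz, klein. replace (0 / INR P)%R with 0%R by (field; exact P0).
    rewrite mult_IZR, <- INR_IZR_INZ.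
    replace (2 * INR (S s) / INR P)%R with (INR (2 * S s) / INR P)%R by (rewrite mult_INR; reflexivity).
    replace (lat z (INR (2 * S s) / INR P) 0) with (Bs s) by (unfold Bs, lat; ring). reflexivity. }
  assert (Eh : (IZR (2 * Z.of_nat (S h)) = 2 * INR (S h))%R) by (rewrite mult_IZR, <- INR_IZR_INZ; reflexivity).
  assert (K3 : forall s, kz P (2 * Z.of_nat (S s)) (2 * Z.of_nat (S h)) z
                 = e2pi (As s * (Bs s + t) / 2) * theta (Bs s + t) z).
  { intros s. unfold kz, klein. rewrite Eh, mult_IZR, <- INR_IZR_INZ.
    replace (2 * INR (S s) / INR P)%R with (INR (2 * S s) / INR P)%R by (rewrite mult_INR; reflexivity).
    reflexivity. }
  assert (K4 : forall s, kz P (- (2 * Z.of_nat (S s))) (2 * Z.of_nat (S h)) z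
                 = e2pi (- As s * (- Bs s + t) / 2) * theta (- Bs s + t) z).
  { intros s. unfold kz, klein. rewrite Eh, opp_IZR, mult_IZR, <- INR_IZR_INZ.
    replace (- (2 * INR (S s)) / INR P)%R with (- (INR (2 * S s) / INR P))%R
      by (rewrite mult_INR; change (INR 2) with 2%R; field; exact P0).
    replace (lat z (- (INR (2 * S s) / INR P)) (2 * INR (S h) / INR P)) with (- Bs s + t)
      by (unfold Bs, lat, t; rewrite RtoC_opp; ring).
    rewrite RtoC_opp. reflexivity. }
  assert (K5 : kz P 0 (2 * Z.of_nat (S h)) z = theta t z).
  { unfold kz, klein. rewrite Eh. replace (0 / INR P)%R with 0%R by (field; exact P0).
    replace (lat z 0 (2 * INR (S h) / INR P)) with t by (unfold t, lat; ring).
    replace (RtoC 0 * t / 2) with (RtoC 0) by field. rewrite e2pi_0. ring. }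
  assert (Knz : forall i, kz P i (2 * Z.of_nat (S h)) z <> 0).
  { intros i. destruct (kz_mero P i (2 * Z.of_nat (S h)) HP) as [_ H].
    apply H; [|exact Hz]. intros [_ [x Hx]].
    assert (x = 0 \/ x = 1 \/ x < 0 \/ x > 1)%Z as D by lia.
    unfold P in Hx. destruct D as [D|[D|[D|D]]]; nia. }
  assert (T3 : forall s, theta (Bs s + t) z <> 0).
  { intros s. apply (Cmult_neq0_r (e2pi (As s * (Bs s + t) / 2))). rewrite <- K3. apply Knz. }
  assert (T4 : forall s, theta (- Bs s + t) z <> 0).
  { intros s. apply (Cmult_neq0_r (e2pi (- As s * (- Bs s + t) / 2))). rewrite <- K4. apply Knz. }
  assert (T5 : theta t z <> 0) by (rewrite <- K5; apply Knz).
  set (LQ := Cprod (fun s => theta (As s) z * theta (Bs s) z * / (theta (Bs s + t) z * theta (- Bs s + t) z)) h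
             * / theta t z).
  assert (HQ : Clim Q LQ).
  { unfold Q, LQ. apply Clim_mult; [|apply Clim_inv; [exact T5|now apply theta_lim]].
    apply (Clim_Cprod (fun M s => theta_partial (As s) z M * theta_partial (Bs s) z M *
      / (theta_partial (Bs s + t) z M * theta_partial (- Bs s + t) z M))). intros s.
    apply Clim_mult; [apply Clim_mult; now apply theta_lim|].
    apply Clim_inv; [now apply Cmult_neq_0|]. apply Clim_mult; now apply theta_lim. }
  assert (Heta : Clim (Cprod (fun k => 1 - e2pi z ^ (P * S k))) (block_fun (eta_block P) (e2pi z))).
  { refine (Clim_ext _ _ _ _ (block_lim (eta_block P) (e2pi z) (eta_block_ok P HP) (e2pi_Cmod_lt1 z Hz))).
    intros M. apply Cprod_ext. intros k _. unfold block_factor, eta_block; cbv beta iota delta [bu bd bv be bw bf].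
    rewrite !Cmult_0_l. field. }
  assert (HQ2 : Clim Q (c0 * Cprod (fun s => y ^ S s) h *
     (block_fun (eta_block P) (e2pi z) * (block_fun (crank_block ze) y * 1)))).
  { refine (Clim_ext _ _ _ (fun M => eq_sym (EQ M)) _). apply Clim_scal.
    apply Clim_mult; [exact Heta|]. apply Clim_mult.
    - apply (Clim_subseq (block_partial (crank_block ze) y) _ (fun M => P * M)%nat); [intros; nia|].
      apply block_lim; [now apply crank_block_ok|exact Hy].
    - replace (RtoC 1) with (Cprod (fun _ => 1) h) by (rewrite Cprod_const; apply Cpow_1_l).
      apply (Clim_Cprod (fun M s => F (P * M + 2 * S s)%nat)). intros s.
      apply (Clim_crank_factor ze y (fun M => P * M + 2 * S s)%nat Hze Hy). intros; nia. }
  pose proof (Clim_unique _ _ _ HQ HQ2) as EL.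
  (* Of the prefactors of the Klein forms, the numerator contributes [As Bs/2] and the denominator
     [As Bs], as the parts containing [t] cancel between [s] and [-s]. *)
  transitivity (Cprod (fun s => e2pi (- (As s * Bs s / 2))) h * LQ).
  - unfold klein_quotient, LQ. cbv zeta. fold P. rewrite Cmult_assoc, <- Cprod_mult. rewrite kact_id, K5.
    f_equal. apply Cprod_ext. intros s _. rewrite !kact_id, K1, K2, K3, K4.
    set (th1 := theta (As s) z). set (th2 := theta (Bs s) z).
    pose proof (T3 s) as N3. pose proof (T4 s) as N4.
    set (th3 := theta (Bs s + t) z) in *. set (th4 := theta (- Bs s + t) z) in *.
    replace (e2pi (As s * (Bs s + t) / 2)) with (e2pi (As s * Bs s / 2) * e2pi (As s * t / 2))
      by (rewrite <- e2pi_plus; f_equal; field).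
    replace (e2pi (- As s * (- Bs s + t) / 2)) with (e2pi (As s * Bs s / 2) * / e2pi (As s * t / 2))
      by (rewrite <- e2pi_opp, <- e2pi_plus; f_equal; field).
    rewrite e2pi_opp. field. repeat split; auto; apply e2pi_neq0.
  - rewrite EL. unfold crank_form. fold P ze y.
    replace (INR h * (INR h + 1) / 6 / INR P)%R
      with (Rsum (fun s => (INR (S s) / INR P - 2 * (INR (S s) / INR P) ^ 2)%R) h).
    + rewrite <- Cprod_e2pi.
      rewrite (Cprod_ext (fun s => e2pi (RtoC (INR (S s) / INR P - 2 * (INR (S s) / INR P) ^ 2) * z))
                 (fun s => e2pi (- (As s * Bs s / 2)) * y ^ S s)); [rewrite Cprod_mult; ring|].
      intros s _. rewrite Ey, <- e2pi_plus. f_equal. unfold As, Bs.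
      replace (INR (2 * S s) / INR P)%R with (2 * (INR (S s) / INR P))%R
        by (rewrite mult_INR; change (INR 2) with 2%R; field; exact P0).
      rewrite RtoC_minus, !RtoC_mult, RtoC_pow. field.
    + rewrite Rsum_weights by exact P0. rewrite EP. field. lra.
Qed.

(** * The quotient under SL2(Z) and its invariance under [Gamma(P)] *)

Lemma kact_mmul (P : nat) (B A : mat2) (i j : Z) (z : C) : (0 < P)%nat -> in_SL2Z A -> upper_half z ->
  kact P B i j (mob A z) = / jfac A z * kact P (mmul B A) i j z.
Proof.
  intros HP HA Hz. assert (P0 : INR P <> 0%R) by (apply not_0_INR; lia).
  unfold kact, kz. rewrite (klein_covariant_SL2Z A HA) by exact Hz.
  f_equal. unfold mmul; simpl.
  f_equal; rewrite !plus_IZR, !mult_IZR, !plus_IZR, !mult_IZR; field; exact P0.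
Qed.

(** A matrix of determinant 1 is invertible modulo [P]; [j] is recovered from the transformed row by
    Cramer's rule. *)
Lemma not_dvd_row (P i j : Z) (A : mat2) : in_SL2Z A -> ~ (P | j)%Z ->
  ~ ((P | i * ma A + j * mc A)%Z /\ (P | i * mb A + j * md A)%Z).
Proof.
  intros HA Hj [H1 H2]. apply Hj.
  replace j with ((i * mb A + j * md A) * ma A - (i * ma A + j * mc A) * mb A)%Z.
  - apply Z.divide_sub_r; now apply Z.divide_mul_l.
  - unfold in_SL2Z in HA. transitivity (j * (ma A * md A - mb A * mc A))%Z; [ring|]. rewrite HA. ring.
Qed.

Lemma not_dvd_succ (h : nat) : (0 < h)%nat -> ~ (Z.of_nat (2 * h + 1) | 2 * Z.of_nat (S h))%Z.
Proof.
  intros Hh [x Hx]. assert (x = 0 \/ x = 1 \/ x < 0 \/ x > 1)%Z as D by lia.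
  destruct D as [D|[D|[D|D]]]; nia.
Qed.

(** Every denominator has second index [2 (h+1) = P + 1], which is prime to [P]. So it remains a
    nonvanishing Klein form under every matrix, and the quotient has no poles in the half-plane. *)
Lemma kact_den (h : nat) (A : mat2) (i : Z) : (0 < h)%nat -> in_SL2Z A ->
  let P := (2 * h + 1)%nat in
  (forall z, upper_half z -> kact P A i (2 * Z.of_nat (S h)) z <> 0) /\
  mero (cusp_width P) (fun z => / kact P A i (2 * Z.of_nat (S h)) z).
Proof.
  intros Hh HA P. apply kz_mero; [unfold P; lia|].
  apply not_dvd_row; [exact HA|]. now apply not_dvd_succ.
Qed.

(** There are [2h] Klein forms above and [2h+1] below, each contributing one inverse automorphy
    factor; the surplus denominator makes the weight 1. *)
Lemma klein_quotient_mmul (h : nat) (B A : mat2) (z : C) : (0 < h)%nat -> in_SL2Z A -> in_SL2Z B ->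
  upper_half z -> / jfac A z * klein_quotient h B (mob A z) = klein_quotient h (mmul B A) z.
Proof.
  intros Hh HA HB Hz. pose proof (jfac_neq0 A z HA Hz) as J. unfold klein_quotient. cbv zeta.
  set (P := (2 * h + 1)%nat). assert (HP : (0 < P)%nat) by (unfold P; lia).
  pose proof (in_SL2Z_mmul B A HB HA) as HBA.
  rewrite (Cprod_ext _ (fun s => kact P (mmul B A) 0 (2 * Z.of_nat (S s)) z *
      kact P (mmul B A) (2 * Z.of_nat (S s)) 0 z *
      / (kact P (mmul B A) (2 * Z.of_nat (S s)) (2 * Z.of_nat (S h)) z *
         kact P (mmul B A) (- (2 * Z.of_nat (S s))) (2 * Z.of_nat (S h)) z))).
  - rewrite kact_mmul by assumption.
    pose proof (proj1 (kact_den h (mmul B A) 0 Hh HBA) z Hz) as N. fold P in N.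
    field. auto.
  - intros s _. rewrite !kact_mmul by assumption.
    pose proof (proj1 (kact_den h (mmul B A) (2 * Z.of_nat (S s)) Hh HBA) z Hz) as N1.
    pose proof (proj1 (kact_den h (mmul B A) (- (2 * Z.of_nat (S s))) Hh HBA) z Hz) as N2.
    fold P in N1, N2. field. auto.
Qed.

Lemma klein_quotient_mero (h : nat) (A : mat2) : (0 < h)%nat -> in_SL2Z A ->
  mero (cusp_width (2 * h + 1)) (klein_quotient h A).
Proof.
  intros Hh HA. unfold klein_quotient. cbv zeta.
  set (P := (2 * h + 1)%nat). assert (HP : (0 < P)%nat) by (unfold P; lia).
  apply mero_mult; [|now apply kact_den].
  apply (mero_Cprod (cusp_width P) (fun s z => kact P A 0 (2 * Z.of_nat (S s)) z *
      kact P A (2 * Z.of_nat (S s)) 0 z * / (kact P A (2 * Z.of_nat (S s)) (2 * Z.of_nat (S h)) z *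
         kact P A (- (2 * Z.of_nat (S s))) (2 * Z.of_nat (S h)) z))). intros s _.
  destruct (kact_den h A (2 * Z.of_nat (S s)) Hh HA) as [N1 M1].
  destruct (kact_den h A (- (2 * Z.of_nat (S s))) Hh HA) as [N2 M2]. fold P in N1, M1, N2, M2.
  apply mero_mult; [apply mero_mult; now apply kz_mero|].
  refine (mero_ext _ _ _ _ (mero_mult _ _ _ M1 M2)). intros z Hz. cbv beta.
  field. split; [now apply N2|now apply N1].
Qed.

Lemma Rsum_quadratic (a b : R) (n : nat) :
  Rsum (fun s => (a * INR (S s) ^ 2 + b)%R) n =
  (a * (INR n * (INR n + 1) * (2 * INR n + 1) / 6) + b * INR n)%R.
Proof.
  induction n as [|n IH]; [simpl; field|]. rewrite Rsum_S, IH, !S_INR. field.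
Qed.

(** For [A] congruent to 1 modulo [P] the even vector [(2i, 2j)/P] moves by twice an integral
    vector, so only the phase of [klein_even_shift] appears. It is a quadratic form in [(i, j)]. *)
Lemma kact_Gamma (P : nat) (A : mat2) (al be ga de i j : Z) (z : C) : (0 < P)%nat -> upper_half z ->
  (ma A = 1 + Z.of_nat P * al)%Z -> (mb A = Z.of_nat P * be)%Z ->
  (mc A = Z.of_nat P * ga)%Z -> (md A = 1 + Z.of_nat P * de)%Z ->
  kact P A (2 * i) (2 * j) z =
  e2pi (RtoC (IZR (2 * (i * i * be + i * j * (de - al) - j * j * ga)) / INR P)) * kz P (2 * i) (2 * j) z.
Proof.
  intros HP Hz E1 E2 E3 E4. assert (P0 : INR P <> 0%R) by (apply not_0_INR; lia).
  unfold kact, kz. rewrite E1, E2, E3, E4.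
  replace (IZR (2 * i * (1 + Z.of_nat P * al) + 2 * j * (Z.of_nat P * ga)) / INR P)%R
    with (IZR (2 * i) / INR P + 2 * IZR (i * al + j * ga))%R.
  2:{ rewrite !plus_IZR, !mult_IZR, !plus_IZR, !mult_IZR, <- INR_IZR_INZ. field. exact P0. }
  replace (IZR (2 * i * (Z.of_nat P * be) + 2 * j * (1 + Z.of_nat P * de)) / INR P)%R
    with (IZR (2 * j) / INR P + 2 * IZR (i * be + j * de))%R.
  2:{ rewrite !plus_IZR, !mult_IZR, !plus_IZR, !mult_IZR, <- INR_IZR_INZ. field. exact P0. }
  rewrite klein_even_shift by exact Hz. f_equal. f_equal. f_equal.
  rewrite !mult_IZR, !minus_IZR, !plus_IZR, !mult_IZR, !minus_IZR. field. exact P0.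
Qed.

(** In the phases the mixed terms cancel between the denominators at [t] and [-t]. What remains is
    [- 2 (be + ga) t^2 + 4 u^2 ga] for each [t], and [2 u^2 ga] from the last denominator, all over
    [P]. The squares sum to [P s], and the terms in [u^2] number [4h + 2 = 2P], so the total is an
    integer. *)
Lemma klein_quotient_Gamma (h : nat) (s : Z) (A : mat2) (z : C) : (0 < h)%nat ->
  (6 * s = Z.of_nat h * (Z.of_nat h + 1))%Z ->
  in_Gamma (Z.of_nat (2 * h + 1)) A -> upper_half z ->
  klein_quotient h A z = klein_quotient h mat_id z.
Proof.
  intros Hh Hs [HA [Ha [Hd [Hb Hc]]]] Hz. set (P := (2 * h + 1)%nat) in *.
  assert (HP : (0 < P)%nat) by (unfold P; lia).
  assert (P0 : INR P <> 0%R) by (apply not_0_INR; lia).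
  assert (EP : INR P = (2 * INR h + 1)%R) by (unfold P; rewrite plus_INR, mult_INR; simpl; ring).
  assert (HP1 : (1 < Z.of_nat P)%Z) by (unfold P; lia).
  rewrite (Z.mod_small 1) in Ha, Hd by lia.
  pose proof (Z.div_mod (ma A) (Z.of_nat P) ltac:(lia)) as E1. rewrite Ha, Z.add_comm in E1.
  pose proof (Z.div_mod (mb A) (Z.of_nat P) ltac:(lia)) as E2. rewrite Hb, Z.add_0_r in E2.
  pose proof (Z.div_mod (mc A) (Z.of_nat P) ltac:(lia)) as E3. rewrite Hc, Z.add_0_r in E3.
  pose proof (Z.div_mod (md A) (Z.of_nat P) ltac:(lia)) as E4. rewrite Hd, Z.add_comm in E4.
  set (al := (ma A / Z.of_nat P)%Z) in *. set (be := (mb A / Z.of_nat P)%Z) in *.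
  set (ga := (mc A / Z.of_nat P)%Z) in *. set (de := (md A / Z.of_nat P)%Z) in *.
  set (x := fun i j => (2 * (i * i * be + i * j * (de - al) - j * j * ga))%Z).
  set (e := fun i j => e2pi (RtoC (IZR (x i j) / INR P))).
  assert (K : forall i j, kact P A (2 * i) (2 * j) z = e i j * kz P (2 * i) (2 * j) z)
    by (intros; now apply kact_Gamma).
  set (u := Z.of_nat (S h)).
  assert (Hid : in_SL2Z mat_id) by reflexivity.
  assert (N : forall i, kz P i (2 * u) z <> 0).
  { intros i. rewrite <- kact_id. apply (kact_den h mat_id i Hh Hid). exact Hz. }
  unfold klein_quotient. cbv zeta. fold P u.
  (* The trailing [* 1] gives the phase the shape of [Cprod_e2pi] at [z = 1], so that the product
     over [k] becomes a sum of exponents. *)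
  rewrite (Cprod_ext _ (fun k => let t := Z.of_nat (S k) in
     e2pi (RtoC (- 2 * IZR (be + ga) / INR P * INR (S k) ^ 2 + 4 * IZR (u * u * ga) / INR P)%R * 1) *
     (kact P mat_id 0 (2 * t) z * kact P mat_id (2 * t) 0 z *
      / (kact P mat_id (2 * t) (2 * u) z * kact P mat_id (- (2 * t)) (2 * u) z)))).
  - cbv zeta. rewrite Cprod_mult, Cprod_e2pi, Rsum_quadratic.
    change (kact P A 0 (2 * u) z) with (kact P A (2 * 0) (2 * u) z). rewrite K, !kact_id.
    change (2 * 0)%Z with 0%Z. set (R := Cprod _ h).
    assert (E : e2pi (RtoC (- 2 * IZR (be + ga) / INR P * (INR h * (INR h + 1) * (2 * INR h + 1) / 6)
                + 4 * IZR (u * u * ga) / INR P * INR h)%R * 1) = e 0%Z u).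
    { unfold e, x.
      replace (RtoC (IZR (2 * (0 * 0 * be + 0 * u * (de - al) - u * u * ga)) / INR P))
        with (RtoC (- 2 * IZR (u * u * ga) / INR P)).
      2:{ f_equal. rewrite !mult_IZR, !minus_IZR, !plus_IZR, !mult_IZR. field. exact P0. }
      replace (RtoC (- 2 * IZR (be + ga) / INR P * (INR h * (INR h + 1) * (2 * INR h + 1) / 6)
                + 4 * IZR (u * u * ga) / INR P * INR h) * 1)
        with (RtoC (- 2 * IZR (u * u * ga) / INR P) + RtoC (IZR (- 2 * (be + ga) * s + 2 * (u * u * ga)))).
      - rewrite e2pi_plus, e2pi_IZR. ring.
      - rewrite Cmult_1_r, <- RtoC_plus. f_equal.
        assert (S6 : (6 * IZR s = INR h * (INR h + 1))%R).
        { rewrite <- mult_IZR, Hs, mult_IZR, plus_IZR, <- INR_IZR_INZ. reflexivity. }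
        replace (INR h * (INR h + 1) * (2 * INR h + 1) / 6)%R with (IZR s * INR P)%R
          by (rewrite EP, <- S6; field).
        rewrite plus_IZR, !mult_IZR, !plus_IZR.
        replace (INR h) with ((INR P - 1) / 2)%R by (rewrite EP; field). field. exact P0. }
    rewrite E. field. split; [apply N|apply e2pi_neq0].
  - intros k _. cbv zeta. set (t := Z.of_nat (S k)).
    change (kact P A 0 (2 * t) z) with (kact P A (2 * 0) (2 * t) z).
    change (kact P A (2 * t) 0 z) with (kact P A (2 * t) (2 * 0) z).
    replace (- (2 * t))%Z with (2 * (- t))%Z by ring. rewrite !K, !kact_id.
    change (2 * 0)%Z with 0%Z.
    assert (E : e 0%Z t * e t 0%Z = e2pi (RtoC (- 2 * IZR (be + ga) / INR P * INR (S k) ^ 2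
              + 4 * IZR (u * u * ga) / INR P)%R * 1) * (e t u * e (- t)%Z u)).
    { unfold e. rewrite <- !e2pi_plus. f_equal. rewrite Cmult_1_r, <- !RtoC_plus. f_equal. unfold x.
      replace (INR (S k)) with (IZR t) by (unfold t; now rewrite <- INR_IZR_INZ).
      rewrite !mult_IZR, !minus_IZR, !plus_IZR, !mult_IZR, !minus_IZR, !opp_IZR. field. exact P0. }
    transitivity (e 0%Z t * e t 0%Z / (e t u * e (- t)%Z u) *
      (kz P 0 (2 * t) z * kz P (2 * t) 0 z * / (kz P (2 * t) (2 * u) z * kz P (2 * - t) (2 * u) z))).
    + field. repeat split; try apply N; apply e2pi_neq0.
    + rewrite E. field. repeat split; try apply N; apply e2pi_neq0.
Qed.

(** * Splitting by residues and the theorem *)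

Lemma root_unity_sum (P i : nat) : (0 < P)%nat ->
  Csum (fun j => e2pi (RtoC (INR j * INR i / INR P))) P = if Nat.eqb (i mod P) 0 then RtoC (INR P) else 0.
Proof.
  intros HP. assert (P0 : INR P <> 0%R) by (apply not_0_INR; lia).
  set (w := e2pi (RtoC (INR i / INR P))).
  rewrite (Csum_ext _ (fun j => w ^ j)).
  2:{ intros j _. unfold w. rewrite e2pi_pow, <- RtoC_mult. f_equal. f_equal. field. exact P0. }
  destruct (Nat.eqb_spec (i mod P) 0) as [E|E].
  - assert (W : w = 1).
    { unfold w. apply Nat.Lcm0.mod_divide in E. destruct E as [k ->].
      replace (INR (k * P) / INR P)%R with (INR k) by (rewrite mult_INR; field; exact P0).
      apply e2pi_INR. }
    rewrite W, (Csum_ext _ (fun _ => 1)) by (intros; apply Cpow_1_l).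
    clear. induction P as [|P IH]; [reflexivity|]. rewrite S_INR, RtoC_plus, <- IH. reflexivity.
  - assert (W : w <> 1).
    { unfold w. rewrite (INR_IZR_INZ i). apply e2pi_frac_neq1; [exact HP|]. intros [x Hx].
      apply E. apply Nat.Lcm0.mod_divide. exists (Z.to_nat x). nia. }
    assert (WP : w ^ P = 1).
    { unfold w. rewrite root_unity_pow by exact HP.
      replace (INR (i * P) / INR P)%R with (INR i) by (rewrite mult_INR; field; exact P0).
      apply e2pi_INR. }
    pose proof (geom_sum w P) as G. rewrite WP in G.
    assert (N : 1 - w <> 0) by (apply Cminus_eq_contra; auto).
    destruct (Ceq_dec (Csum (fun i => w ^ i) P) 0) as [|D]; [assumption|].
    exfalso. apply (Cmult_neq_0 _ _ N D). rewrite G. ring.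
Qed.

(** A window of length [P J + 1] begins and ends at a multiple of [P], hence the [J + 1] surviving
    terms. *)
Lemma Csum_multiples (g : nat -> C) (P J : nat) : (0 < P)%nat ->
  Csum (fun i => (if Nat.eqb (i mod P) 0 then RtoC (INR P) else 0) * g i) (P * J + 1) =
  RtoC (INR P) * Csum (fun k => g (P * k)%nat) (S J).
Proof.
  intros HP. induction J as [|J IH].
  - rewrite Nat.mul_0_r. simpl. rewrite Nat.Div0.mod_0_l. simpl. rewrite Nat.mul_0_r. ring.
  - replace (P * S J + 1)%nat with ((P * J + 1) + S (P - 1))%nat by lia.
    rewrite Csum_add, IH.
    change (Csum (fun k => g (P * k)%nat) (S (S J))) with (Csum (fun k => g (P * k)%nat) (S J) + g (P * S J)%nat).
    rewrite Cmult_plus_distr_l. f_equal.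
    change (Csum ?f (S (P - 1))) with (Csum f (P - 1) + f (P - 1)%nat).
    rewrite Csum_0.
    + replace (P * J + 1 + (P - 1))%nat with (P * S J)%nat by lia.
      rewrite Nat.mul_comm, Nat.Div0.mod_mul. simpl. ring.
    + intros i Hi. replace (P * J + 1 + i)%nat with ((1 + i) + J * P)%nat by lia.
      rewrite Nat.Div0.mod_add, Nat.mod_small by lia.
      destruct (Nat.eqb_spec (1 + i) 0); [lia|]. ring.
Qed.

Lemma eta_partial_lim (P : nat) (z : C) : (0 < P)%nat -> upper_half z ->
  Clim (eta_partial (Z.of_nat P) z) (block_fun (eta_block P) (e2pi z)).
Proof.
  intros HP Hz.
  refine (Clim_ext _ _ _ _ (block_lim (eta_block P) (e2pi z) (eta_block_ok P HP) (e2pi_Cmod_lt1 z Hz))).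
  intros N. induction N as [|N IH]; [reflexivity|].
  change (eta_partial (Z.of_nat P) z (S N)) with
    (eta_partial (Z.of_nat P) z N * (1 - qpow (IZR (Z.of_nat P) * INR (S N)) z)).
  rewrite <- IH. unfold block_partial. rewrite Cprod_S. f_equal.
  unfold block_factor, eta_block; cbv beta iota delta [bu bd bv be bw bf].
  rewrite !Cmult_0_l, e2pi_pow. unfold qpow. rewrite <- INR_IZR_INZ, <- mult_INR. field.
Qed.

(** The average over [j] of the translates by [j] keeps the exponents congruent to [m - s] modulo
    [P], by orthogonality of roots of unity. Both sides are compared at the finite level of the
    symmetric partial sums. *)
Lemma Ksum_lim (h : nat) (s m : Z) (z : C) : (0 < h)%nat -> (0 < s)%Z ->
  let P := (2 * h + 1)%nat in s_p (Z.of_nat P) = s ->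
  (0 <= m < Z.of_nat P)%Z -> upper_half z ->
  Clim (Ksum_partial (Z.of_nat P) m z)
    (RtoC (/ INR P) * Csum (fun j => e2pi (RtoC (IZR (s - m) / INR P) * (z + RtoC (INR j))) *
       block_fun (crank_block (nzeta P)) (e2pi (RtoC (/ INR P) * (z + RtoC (INR j))))) P).
Proof.
  intros Hh Hs0 P Hs Hm Hz. assert (HP : (0 < P)%nat) by (unfold P; lia).
  assert (P0 : INR P <> 0%R) by (apply not_0_INR; lia).
  assert (Pi : (0 < / INR P)%R) by (apply Rinv_0_lt_compat, lt_0_INR; exact HP).
  assert (Ez : zeta (Z.of_nat P) = nzeta P).
  { unfold zeta, nzeta. rewrite <- INR_IZR_INZ. do 2 f_equal. unfold Rdiv. ring. }
  set (b := crank_block (nzeta P)).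
  assert (Hb : block_ok b) by (apply crank_block_ok, Cmod_e2pi_R).
  set (y := fun j => e2pi (RtoC (/ INR P) * (z + RtoC (INR j)))).
  assert (Hy : forall j, (Cmod (y j) < 1)%R).
  { intros j. apply e2pi_Cmod_lt1, upper_half_scal; [now apply upper_half_plus_R|exact Pi]. }
  (* The window reaches up to the coefficient with index [P N + m - s], which makes [L N]
     nonnegative indices. [L'] agrees with [L] from [N = s] on and is at least [N] everywhere, as
     [Clim_subseq] demands. *)
  set (L := fun N => Z.to_nat (Z.of_nat P * Z.of_nat N + 1 + m - s)).
  set (L' := fun N => max N (L N)).
  assert (Hlim : Clim (fun N => RtoC (/ INR P) * Csum (fun j =>
      e2pi (RtoC (IZR (s - m) / INR P) * (z + RtoC (INR j))) *
      Csum (fun l => block_coef b l * y j ^ l) (L' N)) P)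
    (RtoC (/ INR P) * Csum (fun j => e2pi (RtoC (IZR (s - m) / INR P) * (z + RtoC (INR j))) *
       block_fun b (y j)) P)).
  { apply Clim_scal. generalize P at 2 4. intros n. induction n as [|n IH]; simpl; [apply Clim_const|].
    apply Clim_plus; [exact IH|]. apply Clim_scal.
    apply (Clim_subseq (Csum (fun l => block_coef b l * y n ^ l)) _ L'); [intros; unfold L'; lia|].
    apply (is_ps_block b Hb), Hy. }
  apply (Clim_ext_ev _ _ _ (Z.to_nat s)) with (2 := Hlim). intros N HN.
  assert (HL : L' N = L N) by (unfold L', L; nia). rewrite HL.
  (* The lowest crank index in the window. The first [n0] indices are negative, where [crank_coef]
     is 0 by definition. *)
  set (l0 := (- (Z.of_nat P * Z.of_nat N) + m - s)%Z).
  set (g := fun i => crank_coef (nzeta P) (l0 + Z.of_nat i) *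
                     e2pi (RtoC (IZR (l0 + Z.of_nat i + s - m) / INR P) * z)).
  assert (E1 : Ksum_partial (Z.of_nat P) m z N = Csum (fun k => g (P * k)%nat) (S (2 * N))).
  { unfold Ksum_partial. rewrite sum_n_Csum, Ez, Hs. apply Csum_ext. intros k _. cbv zeta. unfold g, qpow.
    replace (l0 + Z.of_nat (P * k))%Z with (Z.of_nat P * (Z.of_nat k - Z.of_nat N) + m - s)%Z
      by (unfold l0; rewrite Nat2Z.inj_mul; ring).
    f_equal. f_equal. f_equal. f_equal.
    replace (Z.of_nat P * (Z.of_nat k - Z.of_nat N) + m - s + s - m)%Z
      with (Z.of_nat P * (Z.of_nat k - Z.of_nat N))%Z by ring.
    rewrite mult_IZR, <- (INR_IZR_INZ P). field. exact P0. }
  assert (Hl0 : (l0 <= 0)%Z) by (unfold l0; nia).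
  set (n0 := Z.to_nat (- l0)).
  assert (Hn0 : (P * (2 * N) + 1 = n0 + L N)%nat) by (unfold n0, L, l0; nia).
  assert (E2 : forall j, Csum (fun i => e2pi (RtoC (INR j * INR i / INR P)) * g i) (P * (2 * N) + 1) =
     e2pi (RtoC (IZR (s - m) / INR P) * (z + RtoC (INR j))) * Csum (fun l => block_coef b l * y j ^ l) (L N)).
  { intros j. rewrite Hn0, Csum_support.
    - rewrite <- Csum_scal. apply Csum_ext. intros l Hl. unfold g.
      replace (l0 + Z.of_nat (n0 + l))%Z with (Z.of_nat l) by (unfold n0; lia).
      rewrite crank_coef_block. fold b.
      replace (e2pi (RtoC (INR j * INR (n0 + l) / INR P)))
        with (e2pi (RtoC (IZR (Z.of_nat l + s - m) / INR P) * RtoC (INR j))).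
      + unfold y. rewrite e2pi_pow.
        transitivity (block_coef b l * (e2pi (RtoC (IZR (Z.of_nat l + s - m) / INR P) * RtoC (INR j)) *
           e2pi (RtoC (IZR (Z.of_nat l + s - m) / INR P) * z))); [ring|].
        transitivity (block_coef b l * (e2pi (RtoC (IZR (s - m) / INR P) * (z + RtoC (INR j))) *
           e2pi (RtoC (INR l) * (RtoC (/ INR P) * (z + RtoC (INR j)))))); [|ring].
        f_equal. rewrite <- !e2pi_plus. f_equal. rewrite !minus_IZR, plus_IZR, <- INR_IZR_INZ.
        unfold Rdiv. rewrite !RtoC_mult, !RtoC_minus, !RtoC_plus. ring.
      + replace (INR (n0 + l)) with (IZR (Z.of_nat l + s - m) + INR P * INR N)%R.
        2:{ rewrite !INR_IZR_INZ, <- mult_IZR, <- plus_IZR. f_equal. unfold n0, l0. nia. }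
        replace (RtoC (INR j * (IZR (Z.of_nat l + s - m) + INR P * INR N) / INR P))
          with (RtoC (IZR (Z.of_nat l + s - m) / INR P) * RtoC (INR j) + RtoC (INR (j * N))).
        * rewrite e2pi_plus, e2pi_INR. ring.
        * rewrite <- RtoC_mult, <- RtoC_plus, mult_INR. f_equal. field. exact P0.
    - intros i Hi. unfold g, crank_coef.
      destruct (Z.ltb_spec (l0 + Z.of_nat i) 0); [ring|unfold n0 in Hi; lia]. }
  rewrite (Csum_ext _ (fun j => Csum (fun i => e2pi (RtoC (INR j * INR i / INR P)) * g i) (P * (2 * N) + 1)))
    by (intros j _; symmetry; apply E2).
  rewrite Csum_swap.
  rewrite (Csum_ext _ (fun i => (if Nat.eqb (i mod P) 0 then RtoC (INR P) else 0) * g i)).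
  - rewrite Csum_multiples, E1 by exact HP. rewrite RtoC_inv by exact P0. field.
    now apply INR_C_neq0.
  - intros i _. rewrite <- root_unity_sum by exact HP. rewrite Cmult_comm, <- Csum_scal.
    apply Csum_ext. intros; ring.
Qed.

(** The eta product is a series in [q] and does not change under [z -> z + j], so it can be moved
    inside the average. The power [q^(m/p)] then turns the exponents [s - m] into [s] at the cost of
    [e(- j m/P)]. *)
Lemma Kcrank_filter (h : nat) (s m : Z) (z : C) : (0 < h)%nat ->
  (6 * s = Z.of_nat h * (Z.of_nat h + 1))%Z ->
  let P := (2 * h + 1)%nat in s_p (Z.of_nat P) = s ->
  (0 <= m < Z.of_nat P)%Z -> upper_half z ->
  Kcrank (Z.of_nat P) m z =
  RtoC (/ INR P) * Csum (fun j => e2pi (RtoC (- (INR j * IZR m / INR P))) * crank_form h (z + RtoC (INR j))) P.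
Proof.
  intros Hh H6 P Hs Hm Hz. assert (HP : (0 < P)%nat) by (unfold P; lia).
  assert (P0 : INR P <> 0%R) by (apply not_0_INR; lia).
  unfold Kcrank. rewrite (limC_eq _ _ (eta_partial_lim P z HP Hz)).
  assert (Hs0 : (0 < s)%Z) by nia.
  pose proof (Ksum_lim h s m z Hh Hs0) as L. cbv zeta in L. fold P in L.
  rewrite (limC_eq _ _ (L Hs Hm Hz)).
  set (E := block_fun (eta_block P) (e2pi z)). unfold qpow. rewrite <- INR_IZR_INZ.
  set (f := fun j => e2pi (RtoC (IZR (s - m) / INR P) * (z + RtoC (INR j))) *
       block_fun (crank_block (nzeta P)) (e2pi (RtoC (/ INR P) * (z + RtoC (INR j))))).
  transitivity (RtoC (/ INR P) * (e2pi (RtoC (IZR m / INR P) * z) * E * Csum f P)); [ring|].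
  f_equal. rewrite <- Csum_scal. apply Csum_ext. intros j _. unfold f, crank_form. cbv zeta. fold P.
  rewrite (e2pi_plus z), e2pi_INR, Cmult_1_r. fold E.
  set (B := block_fun (crank_block (nzeta P)) _).
  transitivity (e2pi (RtoC (IZR m / INR P) * z) * e2pi (RtoC (IZR (s - m) / INR P) * (z + RtoC (INR j))) * (E * B)); [ring|].
  transitivity (e2pi (RtoC (- (INR j * IZR m / INR P))) *
     e2pi (RtoC (INR h * (INR h + 1) / 6 / INR P) * (z + RtoC (INR j))) * (E * B)); [|ring].
  f_equal. rewrite <- !e2pi_plus. f_equal.
  replace (INR h * (INR h + 1) / 6 / INR P)%R with (IZR s / INR P)%R.
  - rewrite minus_IZR. unfold Rdiv. rewrite RtoC_opp, !RtoC_mult, RtoC_minus. ring.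
  - f_equal. rewrite INR_IZR_INZ, <- plus_IZR, <- mult_IZR, <- H6, mult_IZR. field.
Qed.

(** * Translations and the passage between [Gamma(p)] and [Gamma1(p)] *)

Definition tmat (j : Z) : mat2 := Mat2 1 j 0 1.

Lemma in_SL2Z_tmat (j : Z) : in_SL2Z (tmat j).
Proof. unfold in_SL2Z, tmat. cbn [ma mb mc md]. lia. Qed.

Lemma mob_tmat (j : Z) (z : C) : mob (tmat j) z = z + RtoC (IZR j).
Proof. unfold mob, jfac, tmat; cbn [ma mb mc md]. rewrite Cmult_0_l, Cplus_0_l, Cmult_1_l. field. Qed.

Lemma jfac_tmat (j : Z) (z : C) : jfac (tmat j) z = 1.
Proof. unfold jfac, tmat; cbn [ma mb mc md]. ring. Qed.

(** Both limit factors are built from integral powers of [q], so their approximating sequences are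
    literally the same at [z + b]; only [q^(m/p)] changes. *)
Lemma Kcrank_translate (p m b : Z) (z : C) : p <> 0%Z ->
  Kcrank p m (z + RtoC (IZR b)) = e2pi (RtoC (IZR (b * m) / IZR p)) * Kcrank p m z.
Proof.
  intros Hp. assert (p0 : IZR p <> 0%R) by now apply not_0_IZR.
  assert (Q : forall n : Z, qpow (IZR n) (z + RtoC (IZR b)) = qpow (IZR n) z).
  { intros n. unfold qpow. rewrite Cmult_plus_distr_l, e2pi_plus, <- RtoC_mult, <- mult_IZR, e2pi_IZR. ring. }
  unfold Kcrank.
  replace (eta_partial p (z + RtoC (IZR b))) with (eta_partial p z).
  2:{ apply functional_extensionality. intros N. induction N as [|N IH]; [reflexivity|].
      cbn [eta_partial]. rewrite IH. do 2 f_equal. rewrite INR_IZR_INZ, <- mult_IZR. now rewrite Q. }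
  replace (Ksum_partial p m (z + RtoC (IZR b))) with (Ksum_partial p m z).
  2:{ apply functional_extensionality. intros N. unfold Ksum_partial. apply sum_n_ext. intros k.
      cbv zeta. now rewrite Q. }
  unfold qpow at 1. rewrite Cmult_plus_distr_l, e2pi_plus. fold (qpow (IZR m / IZR p) z).
  replace (RtoC (IZR m / IZR p) * RtoC (IZR b)) with (RtoC (IZR (b * m) / IZR p)).
  - ring.
  - rewrite <- RtoC_mult, mult_IZR. f_equal. field. exact p0.
Qed.

(** For [p = 2h+1] one has [p^2 - 1 = 4 h (h+1)]. The product [h (h+1)] is even, and it is divisible
    by 3 because [h = 1] modulo 3 would make [p] a multiple of 3; so the division in [s_p] is
    exact. *)
Lemma prime_gt3_form (p : Z) : prime p -> (3 < p)%Z ->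
  exists h : nat, (0 < h)%nat /\ p = Z.of_nat (2 * h + 1) /\
    (6 * s_p p = Z.of_nat h * (Z.of_nat h + 1))%Z.
Proof.
  intros hp hp3. destruct hp as [_ hrel].
  assert (H2 : (p mod 2 <> 0)%Z).
  { intros E. pose proof (hrel 2%Z ltac:(lia)) as [_ _ G].
    assert (D : (2 | p)%Z) by (apply Z.mod_divide; [lia|exact E]).
    specialize (G 2%Z (Z.divide_refl 2) D). apply Z.divide_1_r_nonneg in G; lia. }
  assert (H3 : (p mod 3 <> 0)%Z).
  { intros E. pose proof (hrel 3%Z ltac:(lia)) as [_ _ G].
    assert (D : (3 | p)%Z) by (apply Z.mod_divide; [lia|exact E]).
    specialize (G 3%Z (Z.divide_refl 3) D). apply Z.divide_1_r_nonneg in G; lia. }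
  exists (Z.to_nat (p / 2)).
  assert (E : (p = 2 * (p / 2) + 1)%Z) by (Z.to_euclidean_division_equations; lia).
  set (k := (p / 2)%Z) in *. assert (0 < k)%Z by lia.
  split; [lia|]. split; [lia|]. rewrite Z2Nat.id by lia.
  assert (D : exists r, (k * (k + 1) = 6 * r)%Z).
  { assert (H3' : (k mod 3 = 0 \/ k mod 3 = 2)%Z) by (Z.to_euclidean_division_equations; lia).
    assert (H2' : (k mod 2 = 0 \/ k mod 2 = 1)%Z) by (Z.to_euclidean_division_equations; lia).
    pose proof (Z.div_mod k 6 ltac:(lia)) as E6. set (a := (k / 6)%Z) in *.
    assert (R6 : (k mod 6 = 0 \/ k mod 6 = 2 \/ k mod 6 = 3 \/ k mod 6 = 5)%Z)
      by (Z.to_euclidean_division_equations; lia).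
    destruct R6 as [R6|[R6|[R6|R6]]]; rewrite R6 in E6.
    - exists (a * (k + 1))%Z. rewrite E6 at 1. ring.
    - exists ((3 * a + 1) * (2 * a + 1))%Z. rewrite E6. ring.
    - exists ((2 * a + 1) * (3 * a + 2))%Z. rewrite E6. ring.
    - exists (k * (a + 1))%Z. rewrite E6 at 2. ring. }
  destruct D as [r Hr]. unfold s_p.
  replace (p * p - 1)%Z with (r * 24)%Z by (rewrite E; nia).
  rewrite Z.div_mul by lia. lia.
Qed.

(** The instance of the normality of [Gamma(p)] that moves a matrix past the translations in the
    average. *)
Lemma in_Gamma_conj_tmat (p j : Z) (A : mat2) : (1 < p)%Z -> in_Gamma p A ->
  in_Gamma p (mmul (mmul (tmat j) A) (tmat (- j))).
Proof.
  intros Hp [HA [Ha [Hd [Hb Hc]]]]. split.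
  { repeat apply in_SL2Z_mmul; auto; apply in_SL2Z_tmat. }
  rewrite (Z.mod_small 1) in * by lia.
  pose proof (Z.div_mod (ma A) p ltac:(lia)) as E1. rewrite Ha in E1.
  pose proof (Z.div_mod (mb A) p ltac:(lia)) as E2. rewrite Hb in E2.
  pose proof (Z.div_mod (mc A) p ltac:(lia)) as E3. rewrite Hc in E3.
  pose proof (Z.div_mod (md A) p ltac:(lia)) as E4. rewrite Hd in E4.
  set (al := (ma A / p)%Z) in *. set (be := (mb A / p)%Z) in *.
  set (ga := (mc A / p)%Z) in *. set (de := (md A / p)%Z) in *.
  unfold mmul, tmat; cbn [ma mb mc md]. rewrite E1, E2, E3, E4.
  repeat split.
  - symmetry. apply Zmod_unique with (al + j * ga)%Z; [lia|]. ring.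
  - symmetry. apply Zmod_unique with (de - j * ga)%Z; [lia|]. ring.
  - symmetry. apply Zmod_unique with (be + j * de - j * (al + j * ga))%Z; [lia|]. ring.
  - symmetry. apply Zmod_unique with ga; [lia|]. ring.
Qed.

(** The upper right entry becomes [b (1 - d)], which vanishes modulo [p] since [d] is congruent to
    1. *)
Lemma in_Gamma_of_Gamma1 (p : Z) (A : mat2) : (1 < p)%Z -> in_Gamma1 p A ->
  in_Gamma p (mmul (tmat (- mb A)) A).
Proof.
  intros Hp [HA [Ha [Hd Hc]]]. split.
  { apply in_SL2Z_mmul; [apply in_SL2Z_tmat|exact HA]. }
  rewrite (Z.mod_small 1) in * by lia.
  pose proof (Z.div_mod (ma A) p ltac:(lia)) as E1. rewrite Ha in E1.
  pose proof (Z.div_mod (mc A) p ltac:(lia)) as E3. rewrite Hc in E3.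
  pose proof (Z.div_mod (md A) p ltac:(lia)) as E4. rewrite Hd in E4.
  set (al := (ma A / p)%Z) in *. set (ga := (mc A / p)%Z) in *. set (de := (md A / p)%Z) in *.
  unfold mmul, tmat; cbn [ma mb mc md]. rewrite E1, E3, E4.
  repeat split.
  - symmetry. apply Zmod_unique with (al - mb A * ga)%Z; [lia|]. ring.
  - symmetry. apply Zmod_unique with de; [lia|]. ring.
  - symmetry. apply Zmod_unique with (- mb A * de)%Z; [lia|]. ring.
  - symmetry. apply Zmod_unique with ga; [lia|]. ring.
Qed.

Lemma Kcrank_modular (p m : Z) : prime p -> (3 < p)%Z -> (0 <= m <= p - 1)%Z ->
  weakly_holomorphic_modular_form 1 (in_Gamma p) (Kcrank p m).
Proof.
  intros hp hp3 Hm. destruct (prime_gt3_form p hp hp3) as [h [Hh [Ep H6]]].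
  set (s := s_p p) in H6. destruct (crank_form_klein h Hh) as [c [Hc Hck]].
  set (P := (2 * h + 1)%nat) in *.
  assert (Hs : s_p (Z.of_nat P) = s) by (unfold s; now rewrite Ep).
  assert (Hid : in_SL2Z mat_id) by reflexivity.
  set (al := fun j => RtoC (/ INR P) * (e2pi (RtoC (- (INR j * IZR m / INR P))) * / c)).
  (* Each slash of [Kcrank] is a combination, with coefficients independent of [A] and [z], of the
     Klein quotients for [T^j A]. Holomorphy, invariance and the expansions are all deduced from
     this formula. *)
  assert (F : forall A z, in_SL2Z A -> upper_half z -> slash 1 (Kcrank p m) A z =
     Csum (fun j => al j * klein_quotient h (mmul (tmat (Z.of_nat j)) A) z) P).
  { intros A z HA Hz. pose proof (upper_half_mob A z HA Hz) as Hw.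
    rewrite slash_1, Ep. rewrite (Kcrank_filter h s m _ Hh H6 Hs) by (auto; lia). fold P.
    rewrite Cmult_assoc, (Cmult_comm (/ jfac A z)), <- Cmult_assoc, <- !Csum_scal.
    apply Csum_ext. intros j _. unfold al.
    assert (Hu : upper_half (mob A z + RtoC (INR j))) by now apply upper_half_plus_R.
    replace (crank_form h (mob A z + RtoC (INR j))) with (/ c * klein_quotient h mat_id (mob A z + RtoC (INR j)))
      by (rewrite Hck by exact Hu; field; exact Hc).
    rewrite <- (klein_quotient_mmul h (tmat (Z.of_nat j)) A z Hh HA (in_SL2Z_tmat _) Hz).
    assert (E : klein_quotient h mat_id (mob A z + RtoC (INR j)) = klein_quotient h (tmat (Z.of_nat j)) (mob A z)).
    { pose proof (klein_quotient_mmul h mat_id (tmat (Z.of_nat j)) _ Hh (in_SL2Z_tmat _) Hid Hw) as E.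
      rewrite jfac_tmat, mob_tmat, <- INR_IZR_INZ in E.
      replace (mmul mat_id (tmat (Z.of_nat j))) with (tmat (Z.of_nat j)) in E
        by (unfold mmul, tmat, mat_id; cbn [ma mb mc md]; f_equal; ring).
      rewrite <- E. field. }
    rewrite E. ring. }
  assert (Mero : forall A, in_SL2Z A -> mero (cusp_width P) (slash 1 (Kcrank p m) A)).
  { intros A HA. apply (mero_ext (cusp_width P)) with (1 := fun z Hz => eq_sym (F A z HA Hz)).
    apply (mero_Csum (cusp_width P) (fun j z => al j * klein_quotient h (mmul (tmat (Z.of_nat j)) A) z)).
    intros j _. apply mero_scal, klein_quotient_mero; [exact Hh|].
    apply in_SL2Z_mmul; [apply in_SL2Z_tmat|exact HA]. }
  assert (Sid : forall z, slash 1 (Kcrank p m) mat_id z = Kcrank p m z).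
  { intros z. rewrite slash_1. change mat_id with (tmat 0). rewrite jfac_tmat, mob_tmat, Cplus_0_r. field. }
  split; [|split].
  - apply (mero_holomorphic (cusp_width P)). refine (mero_ext _ _ _ _ (Mero mat_id Hid)). intros; apply Sid.
  - intros A HA z Hz. rewrite <- (Sid z). assert (HA0 := HA). destruct HA0 as [HSL _].
    rewrite !F by assumption. apply Csum_ext. intros j _. f_equal.
    (* [T^j A = B T^j] with [B] again in [Gamma(p)], so every term of the combination is invariant
       separately. *)
    set (B := mmul (mmul (tmat (Z.of_nat j)) A) (tmat (- Z.of_nat j))).
    assert (HB : in_Gamma p B) by (apply in_Gamma_conj_tmat; [lia|exact HA]).
    assert (HB0 := HB). destruct HB0 as [HBSL _].
    replace (mmul (tmat (Z.of_nat j)) A) with (mmul B (tmat (Z.of_nat j)))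
      by (unfold B, mmul, tmat; cbn [ma mb mc md]; f_equal; ring).
    assert (Hj : upper_half (mob (tmat (Z.of_nat j)) z)) by (apply upper_half_mob; [apply in_SL2Z_tmat|exact Hz]).
    rewrite <- (klein_quotient_mmul h B (tmat (Z.of_nat j)) z Hh (in_SL2Z_tmat _) HBSL Hz).
    rewrite Ep in HB. rewrite (klein_quotient_Gamma h s B _ Hh H6 HB Hj).
    rewrite (klein_quotient_mmul h mat_id (tmat (Z.of_nat j)) z Hh (in_SL2Z_tmat _) Hid Hz).
    f_equal. unfold mmul, tmat, mat_id; cbn [ma mb mc md]. f_equal; ring.
  - intros g Hg. exists (cusp_width P). exact (mero_expansion (cusp_width P) _ (Mero g Hg)).
Qed.

Lemma Kcrank_Gamma1 (p m : Z) (A : mat2) (z : C) : prime p -> (3 < p)%Z -> (0 <= m <= p - 1)%Z ->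
  in_Gamma1 p A -> upper_half z ->
  slash 1 (Kcrank p m) A z = e2pi (RtoC (IZR (mb A * m) / IZR p)) * Kcrank p m z.
Proof.
  intros hp hp3 Hm HA Hz. pose proof (in_Gamma_of_Gamma1 p A ltac:(lia) HA) as HG.
  destruct (Kcrank_modular p m hp hp3 Hm) as [_ [HI _]]. rewrite <- (HI _ HG z Hz).
  destruct HA as [HSL _]. rewrite !slash_1.
  rewrite mob_mmul, jfac_mmul, jfac_tmat, mob_tmat by (auto; apply in_SL2Z_tmat).
  rewrite Kcrank_translate by lia. rewrite Cmult_1_l.
  set (a := / jfac A z). set (K := Kcrank p m (mob A z)).
  (* With [A = T^b (T^(-b) A)], the factor [T^(-b) A] of [Gamma(p)] acts trivially. Undoing the
     translation by [-b] at the point [A z] produces the phase. *)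
  transitivity (e2pi (RtoC (IZR (mb A * m) / IZR p)) * e2pi (RtoC (IZR (- mb A * m) / IZR p)) * (a * K)); [|ring].
  rewrite <- e2pi_plus, <- RtoC_plus.
  replace (IZR (mb A * m) / IZR p + IZR (- mb A * m) / IZR p)%R with 0%R.
  - rewrite e2pi_0. ring.
  - rewrite !mult_IZR, opp_IZR. field. apply not_0_IZR. lia.
Qed.

Close Scope C_scope.

Theorem theorem2p6 (p : Z) (hp : prime p) (hp3 : (3 < p)%Z) :
  weakly_holomorphic_modular_form 1 (in_Gamma1 p) (Kcrank p 0)
  /\
  (forall m : Z, (1 <= m <= p - 1)%Z ->
     weakly_holomorphic_modular_form 1 (in_Gamma p) (Kcrank p m) /\
     (forall A : mat2, in_Gamma1 p A ->
        forall z : C, upper_half z ->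
          slash 1 (Kcrank p m) A z
          = Cmult (e2pi (RtoC (IZR (mb A * m) / IZR p))) (Kcrank p m z))).
Proof.
  split.
  - destruct (Kcrank_modular p 0 hp hp3 ltac:(lia)) as [H1 [_ H3]].
    split; [exact H1|]. split; [|exact H3]. intros A HA z Hz.
    rewrite (Kcrank_Gamma1 p 0 A z hp hp3 ltac:(lia) HA Hz), Z.mul_0_r.
    replace (0 / IZR p)%R with 0%R by (unfold Rdiv; ring). rewrite e2pi_0. ring.
  - intros m Hm. split; [apply Kcrank_modular; auto; lia|].
    intros A HA z Hz. apply Kcrank_Gamma1; auto; lia.
Qed.
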